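(* Assume that the exercise payoff $g$ is nondecreasing, that there is a unique interior threshold $y^\ast\in\mathcal I$ such that $\hat f(x\pm)\le0$ for $x\in(a,y^\ast)$ and $\hat f(x\pm)>0$ for $x\in(y^\ast,b)$, that $g'$ is lower semicontinuous on $[y^\ast,b)$, that $\hat f$ is nondecreasing on $[y^\ast,b)$, and that $g(x)/\psi(x)\downarrow0$ as $x\uparrow b$. Then, for all $x\in\mathcal I$, $$V(x)=V_{y^\ast}(x)=J_{y^\ast}(x)=\mathbb E_x\Big[\sup_{t\in[0,T]}\big\{\hat f(X_t)\mathbf 1_{[y^\ast,b)}(X_t)\big\}\Big].$$
   Context: Diffusion. $X=\{X_t;\,t\in[0,\xi)\}$ is a linear, time-homogeneous, regular diffusion on $\mathcal I=(a,b)\subset\mathbb R$ with possibly infinite lifetime $\xi$, drift coefficient $\mu:\mathcal I\to\mathbb R$ and volatility coefficient $\sigma:\mathcal I\to(0,\infty)$, both continuous. $X$ does not die inside $\mathcal I$; the boundaries $a,b$ are natural, entrance, exit or regular, a regular boundary being killing (the process is sent to a cemetery state $\partial\notin\mathcal I$ on hitting it). Functions on $\mathcal I$ are taken to vanish at $\partial$. $r>0$ is a constant, and $T\sim\mathrm{Exp}(r)$ is independent of $X$. $M_t=\sup\{X_s; s\in[0,t]\}$ is the running supremum. $\psi$ is the (unique up to a positive multiple) positive increasing fundamental solution of $\frac12\sigma^2u''+\mu u'-ru=0$ satisfying the boundary conditions of $X$, so that $\mathbb E_x[e^{-r\tau_z}]=\psi(x)/\psi(z)$ for $x\le z$, where $\tau_z=\inf\{t\ge0:X_t\ge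 z\}$. Payoff. $g:\mathcal I\to\mathbb R$ is continuous, $g^{-1}((0,\infty))=(x_g,b)\ne\emptyset$ for some $x_g\in\mathcal I$, $\mathbb E_x[\sup_{t\ge0}e^{-rt}g(X_t)]<\infty$ for all $x\in\mathcal I$, and $g$ is twice continuously differentiable on $\mathcal I\setminus\mathcal P$, where $\mathcal P\subset\mathcal I$ is a finite set with $|g'(x\pm)|<\infty$ and $|g''(x\pm)|<\infty$ for $x\in\mathcal P$. At points $x\in\mathcal P$, $g'(x)$ is understood as the right-hand derivative $g'(x+)$. Functionals. $V(x)=\sup_\tau\mathbb E_x[e^{-r\tau}g(X_\tau)]$ (supremum over stopping times), $\hat f(x)=g(x)-\psi(x)g'(x)/\psi'(x)$ with one-sided limits $\hat f(x\pm)$, and for $y\in g^{-1}((0,\infty))$, $$V_y(x)=\mathbb E_x[e^{-r\tau_y}g(X_{\tau_y});\tau_y<\infty]=\begin{cases}g(x),&x\ge y,\\ \psi(x)\,g(y)/\psi(y),&x<y,\end{cases}$$ $$J_y(x)=\mathbb E_x\big[\hat f(M_T)\mathbf 1_{[y,b)}(M_T)\big].$$ *)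

(* Defs.v *)
From HB Require Import structures.
From mathcomp Require Export all_boot all_order all_algebra.
From mathcomp Require Export all_classical all_reals all_analysis.
From mathcomp Require Export measurable_realfun.
Export Order.TTheory GRing.Theory Num.Theory.
Export numFieldNormedType.Exports.

Set Implicit Arguments.
Unset Strict Implicit.
Unset Printing Implicit Defensive.

#[global] Open Scope classical_set_scope.
#[global] Open Scope ring_scope.

(** * Intervals, smoothness, one-sided limits *)

Definition state_space (R : realType) (a b : \bar R) : set R :=
  [set x | (a < x%:E)%E /\ (x%:E < b)%E].

Definition upper_part (R : realType) (b : \bar R) (y : R) : set R :=
  [set x | y <= x /\ (x%:E < b)%E].

(* Filters at a possibly infinite end point. *)
Definition from_left (R : realType) (b : \bar R) : set_system (\bar R) :=
  within (fun z => (z < b)%E) (nbhs b).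

Definition from_right (R : realType) (a : \bar R) : set_system (\bar R) :=
  within (fun z => (a < z)%E) (nbhs a).

(* To be used with [D] open. *)
Definition C2_on (R : realType) (D : set R) (u : R -> R) : Prop :=
  forall x, D x ->
    [/\ derivable u x 1, derivable (derive1 u) x 1 &
        {for x, continuous (derive1n 2 u)}].

Definition nondecreasing_on (R : realType) (D : set R) (u : R -> R) : Prop :=
  forall x z, D x -> D z -> x <= z -> u x <= u z.

(** * Diffusions *)

(* [coord t w] is the position at time [t] when [0 <= t < life w]; from the
   time [life w] on, the process sits in the cemetery and the value of
   [coord t w] is never looked at.  [law x] is the probability under which the
   process starts from [x]; it is only looked at for [x] in the state space. *)
Record process (R : realType) (d : measure_display) (Om : measurableType d) :=
  Process {
    law : R -> probability Om R ;
    coord : R -> Om -> R ;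
    life : Om -> \bar R ;
    filt : R -> set (set Om) }.

Definition in_at (R : realType) (d : measure_display) (Om : measurableType d)
    (X : process R Om) (t : R) (B : set R) : set Om :=
  [set w | (t%:E < life X w)%E /\ B (coord X t w)].

(* [h (X_t)], where functions vanish at the cemetery. *)
Definition value_at (R : realType) (d : measure_display) (Om : measurableType d)
    (X : process R Om) (h : R -> R) (t : R) (w : Om) : R :=
  if (t%:E < life X w)%E then h (coord X t w) else 0.

Definition stopping_time (R : realType) (d : measure_display)
    (Om : measurableType d) (X : process R Om) (tau : Om -> \bar R) : Prop :=
  (forall w, (0 <= tau w)%E) /\
  (forall t, 0 <= t -> filt X t [set w | (tau w <= t%:E)%E]).

Definition stopped_event (R : realType) (d : measure_display)
    (Om : measurableType d) (X : process R Om) (tau : Om -> \bar R)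
    (A : set Om) : Prop :=
  measurable A /\
  (forall t, 0 <= t -> filt X t (A `&` [set w | (tau w <= t%:E)%E])).

(* [e^{-r tau} h(X_tau)]; it is 0 when [tau] is not before the lifetime, in
   particular when [tau = +oo]. *)
Definition discounted (R : realType) (d : measure_display)
    (Om : measurableType d) (X : process R Om) (r : R) (h : R -> R)
    (tau : Om -> \bar R) (w : Om) : R :=
  if (tau w < life X w)%E
  then expR (- r * fine (tau w)) * h (coord X (fine (tau w)) w) else 0.

Definition hitting_time (R : realType) (d : measure_display)
    (Om : measurableType d) (X : process R Om) (z : R) (w : Om) : \bar R :=
  ereal_inf [set t%:E | t in
    [set t | [/\ 0 <= t, (t%:E < life X w)%E & z <= coord X t w]]].

(* Supremum over the times of [[0, t]] that precede the lifetime. *)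
Definition running_sup (R : realType) (d : measure_display)
    (Om : measurableType d) (X : process R Om) (t : R) (w : Om) : \bar R :=
  ereal_sup [set (coord X s w)%:E | s in
    [set s | [/\ 0 <= s, s <= t & (s%:E < life X w)%E]]].

Definition exits_at (R : realType) (d : measure_display)
    (Om : measurableType d) (X : process R Om) (e : \bar R) : set Om :=
  [set w | (life X w < +oo)%E /\
     (coord X t w)%:E @[t --> (fine (life X w))^'-] --> e].

Definition generator (R : realType) (mu sigma : R -> R) (u : R -> R) : R -> R :=
  fun x => 2^-1 * sigma x ^+ 2 * derive1n 2 u x + mu x * derive1 u x.

Definition semigroup (R : realType) (d : measure_display)
    (Om : measurableType d) (X : process R Om) (h : R -> R) (t x : R) : \bar R :=
  (\int[law X x]_w (value_at X h t w)%:E)%E.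

(* Regular diffusion on [(a, b)] with drift [mu] and volatility [sigma]: a
   continuous strong Markov process whose paths, when the lifetime is finite,
   converge to [a] or [b] (no death inside the interval, killing at the
   boundary), every point of the interval being reached from every other one
   with positive probability.  The coefficients enter through Kolmogorov's
   equation [P_t f = f + int_0^t P_s (L f) ds] for [f] of class C^2 with compact
   support in the interval (Revuz and Yor, Definition VII.2.1).  The strong
   Markov property is with respect to an arbitrary filtration to which the
   process is adapted. *)
Record regular_diffusion (R : realType) (d : measure_display)
    (Om : measurableType d) (a b : \bar R) (mu sigma : R -> R)
    (X : process R Om) : Prop := {
  drift_continuous : forall x, state_space a b x -> {for x, continuous mu} ;
  volatility_continuous :
    forall x, state_space a b x -> {for x, continuous sigma} ;
  volatility_gt0 : forall x, state_space a b x -> 0 < sigma x ;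
  filt_sigma_algebra : forall t : R, 0 <= t -> sigma_algebra setT (filt X t) ;
  filt_measurable : forall t : R, 0 <= t -> filt X t `<=` measurable ;
  filt_nondecreasing :
    forall s t : R, 0 <= s -> s <= t -> filt X s `<=` filt X t ;
  coord_adapted : forall (t : R) (B : set R), 0 <= t -> measurable B -> filt X t (in_at X t B) ;
  life_gt0 : forall w, (0 < life X w)%E ;
  coord_in : forall (t : R) (w : Om), 0 <= t -> (t%:E < life X w)%E ->
    state_space a b (coord X t w) ;
  coord_continuous : forall w,
    {within [set t | 0 <= t /\ (t%:E < life X w)%E],
      continuous (fun t => coord X t w)} ;
  no_interior_death : forall w, (life X w < +oo)%E ->
    exits_at X a w \/ exits_at X b w ;
  coord_start : forall x, state_space a b x ->
    law X x [set w | coord X 0 w = x] = 1%E ;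
  law_measurable : forall (t : R) (B : set R), 0 <= t -> measurable B ->
    measurable_fun (state_space a b) (fun x => law X x (in_at X t B)) ;
  strong_markov : forall (x : R) (tau : Om -> \bar R) (A : set Om) (s : R) (B : set R),
    state_space a b x -> stopping_time X tau -> stopped_event X tau A ->
    0 <= s -> measurable B ->
    law X x [set w | [/\ A w, (tau w < life X w)%E &
                         in_at X (fine (tau w) + s) B w]] =
    (\int[law X x]_(w in A `&` [set w | tau w < life X w])
       law X (coord X (fine (tau w)) w) (in_at X s B))%E ;
  regularity : forall x y, state_space a b x -> state_space a b y ->
    (0 < law X x [set w | exists t : R,
       [/\ (0 <= t)%R, t%:E < life X w & coord X t w = y]])%E ;
  kolmogorov : forall (f : R -> R) (c e : R),
    C2_on setT f -> state_space a b c -> state_space a b e ->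
    (forall z, f z != 0 -> c <= z <= e) ->
    forall x t : R, state_space a b x -> 0 <= t ->
    semigroup X f t x =
      ((f x)%:E + \int[lebesgue_measure]_(s in `[0%R, t])
                    semigroup X (generator mu sigma f) s x)%E }.

(* Exit and regular boundaries are those reached in finite time from inside. *)
Definition attainable (R : realType) (d : measure_display)
    (Om : measurableType d) (a b : \bar R) (X : process R Om) (e : \bar R) :
    Prop :=
  exists2 x, state_space a b x & (0 < law X x (exits_at X e))%E.

(* The boundary condition is the one expressing killing at [a].  At an entrance
   or natural boundary no condition is needed besides monotonicity. *)
Record increasing_solution (R : realType) (d : measure_display)
    (Om : measurableType d) (a b : \bar R) (mu sigma : R -> R) (r : R)
    (X : process R Om) (psi : R -> R) : Prop := {
  psi_C2 : C2_on (state_space a b) psi ;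
  psi_gt0 : forall x, state_space a b x -> 0 < psi x ;
  psi_increasing : forall x z, state_space a b x -> state_space a b z ->
    x < z -> psi x < psi z ;
  psi_ode : forall x, state_space a b x ->
    generator mu sigma psi x - r * psi x = 0 ;
  psi_boundary : attainable a b X a ->
    psi (fine z) @[z --> from_right a] --> (0 : R) }.

(* Under every [law X x], [T] is exponential of parameter [r] and independent of
   the sigma-algebra generated by the process. *)
Record exponential_clock (R : realType) (d : measure_display)
    (Om : measurableType d) (a b : \bar R) (r : R) (X : process R Om)
    (T : {mfun Om >-> R}) : Prop := {
  clock_law : forall x B, state_space a b x -> measurable B ->
    distribution (law X x) T B = exponential_prob r B ;
  clock_independent : forall x A B, state_space a b x ->
    (<<s [set E | exists t C,
            [/\ 0 <= t, measurable C & E = in_at X t C]] >>) A ->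
    measurable B ->
    law X x (A `&` T @^-1` B) = (law X x A * law X x (T @^-1` B))%E }.

(** * Payoff *)

(* [kinks] is the finite exceptional set of the payoff. *)
Record payoff (R : realType) (d : measure_display)
    (Om : measurableType d) (a b : \bar R) (r : R)
    (X : process R Om) (kinks : set R) (xg : R) (g : R -> R) : Prop := {
  g_continuous : forall x, state_space a b x -> {for x, continuous g} ;
  xg_in : state_space a b xg ;
  g_gt0 : forall x, state_space a b x -> (0 < g x <-> xg < x) ;
  g_integrable : forall x, state_space a b x ->
    (\int[law X x]_w
       ereal_sup [set (expR (- r * t) * value_at X g t w)%R%:E | t in
                    [set t | (0 <= t)%R]] < +oo)%E ;
  kinks_finite : finite_set kinks ;
  kinks_in : kinks `<=` state_space a b ;
  g_C2 : C2_on (state_space a b `\` kinks) g ;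
  g_kinks : forall x, kinks x ->
    [/\ cvg (derive1 g z @[z --> x^'-]), cvg (derive1 g z @[z --> x^'+]),
        cvg (derive1n 2 g z @[z --> x^'-]) & cvg (derive1n 2 g z @[z --> x^'+])] }.

Definition dpayoff (R : realType) (kinks : set R) (g : R -> R) (x : R) : R :=
  if x \in kinks then lim (derive1 g z @[z --> x^'+]) else derive1 g x.

Definition fhat (R : realType) (kinks : set R) (g psi : R -> R) (x : R) : R :=
  g x - psi x * dpayoff kinks g x / derive1 psi x.

Definition threshold (R : realType) (a b : \bar R) (f : R -> R) (y : R) : Prop :=
  [/\ state_space a b y,
      forall x, state_space a b x -> x < y ->
        lim (f z @[z --> x^'-]) <= 0 /\ lim (f z @[z --> x^'+]) <= 0 &
      forall x, state_space a b x -> y < x ->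
        0 < lim (f z @[z --> x^'-]) /\ 0 < lim (f z @[z --> x^'+])].

Definition lsc_on (R : realType) (D : set R) (u : R -> R) : Prop :=
  lower_semicontinuous (fun x : subspace D => (u x)%:E).

(* [u] decreases to 0 at the right end point. *)
Definition decreases_to_0 (R : realType) (a b : \bar R) (u : R -> R) : Prop :=
  (exists2 c, state_space a b c & forall x z,
     c < x -> x <= z -> (z%:E < b)%E -> u z <= u x) /\
  (u (fine z) @[z --> from_left b] --> (0 : R)).

(** * Functionals *)

Definition value_function (R : realType) (d : measure_display)
    (Om : measurableType d) (X : process R Om) (r : R) (g : R -> R) (x : R) :
    \bar R :=
  ereal_sup [set (\int[law X x]_w (discounted X r g tau w)%:E)%E | tau in
               [set tau | stopping_time X tau]].

Definition threshold_value (R : realType) (d : measure_display)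
    (Om : measurableType d) (X : process R Om) (r : R) (g : R -> R) (y x : R) :
    \bar R :=
  (\int[law X x]_w (discounted X r g (hitting_time X y) w)%:E)%E.

(* [E_x [f(M_T) 1_{[y, b)}(M_T)]] *)
Definition sup_representation (R : realType) (d : measure_display)
    (Om : measurableType d) (b : \bar R) (X : process R Om) (T : Om -> R)
    (f : R -> R) (y x : R) : \bar R :=
  (\int[law X x]_w
     (if (y%:E <= running_sup X (T w) w < b)%E
      then f (fine (running_sup X (T w) w)) else 0%R)%:E)%E.

(* [E_x [sup_{t in [0, T]} f(X_t) 1_{[y, b)}(X_t)]] *)
Definition sup_functional (R : realType) (d : measure_display)
    (Om : measurableType d) (b : \bar R) (X : process R Om) (T : Om -> R)
    (f : R -> R) (y x : R) : \bar R :=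
  (\int[law X x]_w
     ereal_sup [set (value_at X (fun z => f z * \1_(upper_part b y) z)%R t w)%:E |
                  t in `[0%R, T w]])%E.

(* Main.v *)
(* For [z >= ystar] let [C = fhat z].  The derivative of [(C - g) / psi] is
   [psi' (fhat - C) / psi ^ 2], so this ratio is minimal at [z], that is
   [g <= fhat z + s * psi] with equality at [z] and some [s >= 0]; with [C = 0]
   at [ystar] one gets [g <= (g ystar / psi ystar) * psi].  Since [e^{-rt} psi(X_t)]
   is a supermartingale, taking [z] to be the larger of the starting point and
   [ystar] bounds the value function by the value of the threshold time.

   The supermartingale property and the formula
   [E_x e^{-r tau_z} = psi x / psi z] both come from stopping the process on a fine
   time grid when it leaves a compact interval [[c, e]]: Kolmogorov's equation
   applied to a cut-off of [psi] shows that each step of length [h] changes the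
   expectation by [O(h^2)], and Fatou's lemma, used in both directions, is applied
   as [h] tends to 0 and [c], [e] to the end points.

   Finally [P_x(M_T >= z) = psi x / psi z] by independence of the clock, and
   [E_x (fhat(M_T); u <= M_T < v)] is the decrement of [psi x * g / psi] between [u]
   and [v]: both lie between [fhat u] and [fhat v] times the decrement of
   [psi x / psi], by the tangent inequality, so they agree after bisecting. *)

(* The obstacle is that Kolmogorov's equation speaks of C^2 functions with compact support, and
   [psi] is not one. A horizon [m] with mesh [h] takes [m / h] steps, so an error [O(h)] per step
   would not vanish. It is [O(h^2)] because discounting cancels [L psi = r psi] to first order, and
   because the cut-off matters only to paths that travel a fixed distance out of [[c, e]], which has
   probability [O(s)] by time [s].

   Fatou's lemma on the stopped values, which are nonnegative, gives the supermartingale bound. The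
   reverse bound at [tau_z] needs domination: the upper end [e > z] is then kept fixed, the stopped
   values are at most [psi e'], and Fatou's lemma is applied to their complements. Paths that never
   reach [z] must contribute nothing in the limit; this comes from discounting if they live forever,
   and from the behaviour of [psi] at [a] if they die.

   The stopped payoff of an arbitrary stopping time is not known to be measurable, so comparisons
   with it rest on the monotonicity of the integral alone. *)
From HB Require Import structures.
Require Import Defs.
From mathcomp Require Import ring lra.
From mathcomp Require finmap.

Set Implicit Arguments.
Unset Strict Implicit.
Unset Printing Implicit Defensive.

(** * Integrals of functions that need not be measurable *)

Section integral_nonmeasurable.
Context d (T : measurableType d) (R : realType) (mu : {measure set T -> \bar R}).
Local Open Scope ereal_scope.
Import HBNNSimple.

(* The value function is a supremum of integrals of functions that are not known
   to be measurable. *)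
Lemma ge0_le_integral_nonmeasurable (D : set T) (f g : T -> \bar R) :
  (forall x, D x -> 0 <= f x) -> (forall x, D x -> f x <= g x) ->
  \int[mu]_(x in D) f x <= \int[mu]_(x in D) g x.
Proof.
move=> f0 fg.
rewrite integral_mkcond [leRHS]integral_mkcond.
have f0' x : 0 <= (f \_ D) x.
  by rewrite patchE; case: ifPn => // /[1!inE] /f0.
have fg' x : (f \_ D) x <= (g \_ D) x.
  by rewrite !patchE; case: ifPn => // /[1!inE] /fg.
rewrite !ge0_integralTE//; last by move=> x; exact: le_trans (fg' x).
apply: le_ereal_sup => _ [h /= hf <-]; exists h => // x.
exact: le_trans (hf x) (fg' x).
Qed.

Lemma le_integral_nonmeasurable (D : set T) (f g : T -> \bar R) :
  (forall x, D x -> f x <= g x) ->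
  \int[mu]_(x in D) f x <= \int[mu]_(x in D) g x.
Proof.
move=> fg; rewrite integralE [leRHS]integralE; apply: leeB.
- apply: ge0_le_integral_nonmeasurable => // x Dx.
  by rewrite !funeposE ge_max !le_max fg//= lexx orbT.
- apply: ge0_le_integral_nonmeasurable => // x Dx.
  by rewrite !funenegE ge_max !le_max leeN2 fg//= lexx orbT.
Qed.

(** The integral of a nonnegative function is a supremum over the simple functions below it.
    Restricting such a function to the complement of [N] keeps it simple, keeps its integral, and
    puts it below [g]. *)
Let le_integral_off_null (N : set T) (f g : T -> \bar R) :
  measurable N -> mu N = 0 -> (forall x, 0 <= f x) -> (forall x, 0 <= g x) ->
  (forall x, ~ N x -> f x = g x) -> \int[mu]_x f x <= \int[mu]_x g x.
Proof.
move=> mN N0 f0 g0 fg; rewrite !ge0_integralTE//.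
apply: ge_ereal_sup => _ [h /= hf <-].
have mNC : measurable (~` N) by exact: measurableC.
rewrite -(@integralT_nnsfun _ _ _ mu h).
have mh : measurable_fun setT (fun x => (h x)%:E) by exact/measurable_EFinP.
rewrite -[setT in leLHS](setUv N) ge0_integral_setU//; last 3 first.
- by rewrite setUv.
- by move=> x _; rewrite lee_fin.
- exact/disj_setPCl.
rewrite (_ : integral _ N _ = 0) ?add0e; last first.
  apply: null_set_integral => //.
  exact: measurable_funTS.
rewrite integral_nnsfun// (mrestrict h mNC).
apply: ereal_sup_ubound; exists (proj_nnsfun h mNC) => // x /=.
rewrite mindicE; case: (boolP (x \in ~` N)) => [|_]; last by rewrite mulr0.
by rewrite inE => Nx; rewrite mulr1 -fg.
Qed.

Lemma eq_integral_off_null (D N : set T) (f g : T -> \bar R) :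
  measurable N -> mu N = 0 -> (forall x, D x -> ~ N x -> f x = g x) ->
  \int[mu]_(x in D) f x = \int[mu]_(x in D) g x.
Proof.
move=> mN N0 fg; rewrite integral_mkcond [RHS]integral_mkcond.
have fg' x : ~ N x -> (f \_ D) x = (g \_ D) x.
  by move=> Nx; rewrite !patchE; case: ifPn => // /[1!inE] /fg; exact.
rewrite integralE [RHS]integralE; congr (_ - _);
  apply/eqP; rewrite eq_le; apply/andP; split;
  by apply: (le_integral_off_null mN N0) => // x /fg' {}fg;
    rewrite ?funeposE ?funenegE fg.
Qed.

End integral_nonmeasurable.

(** * State space and calculus *)

Section state_space_lemmas.
Context (R : realType) (a b : \bar R).
Notation I := (state_space a b).

Lemma state_space_between x z y : I x -> I z -> x <= y <= z -> I y.
Proof.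
move=> [ax _] [_ zb] /andP[xy yz]; split.
  by apply: lt_le_trans ax _; rewrite lee_fin.
by apply: le_lt_trans zb; rewrite lee_fin.
Qed.

Lemma state_space_open : open I.
Proof.
rewrite (_ : I = [set x | (a < x%:E)%E] `&` [set x | (x%:E < b)%E]) //.
by apply: openI; [exact: open_ereal_gt | exact: open_ereal_lt].
Qed.

Lemma measurable_state_space : measurable I.
Proof. exact: open_measurable state_space_open. Qed.

(** Being eventually below each point replaces convergence to [a], so that finite and infinite end
    points are used in the same way afterwards. *)
Lemma exhaust_left x : I x -> exists c : nat -> R,
  (forall n, I (c n)) /\ forall y, I y -> exists n0, forall n, (n0 <= n)%N -> c n <= y.
Proof.
move=> Ix; have [ax xb] := Ix; case: a ax => [a'| |] // ax.
- rewrite lte_fin in ax.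
  exists (fun n => a' + (x - a') / n.+1%:R); split.
    move=> n; split; first by rewrite lte_fin ltrDl divr_gt0// subr_gt0.
    apply: le_lt_trans xb; rewrite lee_fin -lerBrDl ler_pdivrMr// ler_peMr
      ?subr_ge0 ?(ltW ax)//.
    by rewrite ler1n.
  move=> y [a'y _]; rewrite lte_fin in a'y.
  exists (Num.truncn ((x - a') / (y - a'))) => n nn.
  rewrite -lerBrDl ler_pdivrMr// mulrC -ler_pdivrMr ?subr_gt0//.
  apply: le_trans (ltW (truncnS_gt _)) _.
  by rewrite ler_nat ltnS.
- exists (fun n => Num.min x (- n%:R)); split.
    move=> n; split; first by rewrite ltNyr.
    by apply: le_lt_trans xb; rewrite lee_fin ge_min lexx.
  move=> y _; exists (Num.truncn (- y)).+1 => n nn.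
  rewrite ge_min lerNl; apply/orP; right.
  by apply: le_trans (ltW (truncnS_gt _)) _; rewrite ler_nat.
Qed.

Lemma exhaust_right x : I x -> exists c : nat -> R,
  (forall n, I (c n)) /\ forall y, I y -> exists n0, forall n, (n0 <= n)%N -> y <= c n.
Proof.
move=> Ix; have [ax xb] := Ix; case: b xb => [b'| |] // xb.
- rewrite lte_fin in xb.
  exists (fun n => b' - (b' - x) / n.+1%:R); split.
    move=> n; split; last by rewrite lte_fin ltrBlDr ltrDl divr_gt0// subr_gt0.
    apply: lt_le_trans ax _; rewrite lee_fin lerBrDl -lerBrDr ler_pdivrMr//.
    by rewrite ler_peMr ?subr_ge0 ?(ltW xb)// ler1n.
  move=> y [_ yb]; rewrite lte_fin in yb.
  exists (Num.truncn ((b' - x) / (b' - y))) => n nn.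
  rewrite lerBrDl -lerBrDr ler_pdivrMr// mulrC -ler_pdivrMr ?subr_gt0//.
  apply: le_trans (ltW (truncnS_gt _)) _.
  by rewrite ler_nat ltnS.
- exists (fun n => Num.max x n%:R); split.
    move=> n; split; last by rewrite ltry.
    by apply: lt_le_trans ax _; rewrite lee_fin le_max lexx.
  move=> y _; exists (Num.truncn y).+1 => n nn.
  rewrite le_max; apply/orP; right.
  by apply: le_trans (ltW (truncnS_gt _)) _; rewrite ler_nat.
Qed.

Lemma state_space_left x : I x -> exists2 y, I y & y < x.
Proof.
move=> Ix; have /nbhs_ballP[e /= e0 eI] := state_space_open Ix.
exists (x - e / 2); last by rewrite ltrBlDr ltrDl divr_gt0.
apply: eI; rewrite /ball/= opprB addrCA subrr addr0 gtr0_norm ?divr_gt0//.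
by rewrite ltr_pdivrMr// ltr_pMr// ltr1n.
Qed.

Lemma state_space_right x : I x -> exists2 y, I y & x < y.
Proof.
move=> Ix; have /nbhs_ballP[e /= e0 eI] := state_space_open Ix.
exists (x + e / 2); last by rewrite ltrDl divr_gt0.
apply: eI; rewrite /ball/= opprD addrA subrr sub0r normrN gtr0_norm ?divr_gt0//.
by rewrite ltr_pdivrMr// ltr_pMr// ltr1n.
Qed.

End state_space_lemmas.

(** * Monotonicity and the sign of the derivative *)

Section monotonicity.
Context (R : realType).

Lemma continuous_within_segment (u : R -> R) p q :
  (forall y, p <= y <= q -> {for y, continuous u}) ->
  {within `[p, q], continuous u}.
Proof.
by move=> cu; apply: continuous_in_subspaceT => y /[1!inE] /=; rewrite in_itv/=; exact: cu.
Qed.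

(** Induction on the list of exceptional points: an exceptional point inside the interval splits it
    in two, and continuity glues the halves; with no point left, this is the mean value theorem. *)
Lemma le_derive1_off_seq (s : seq R) (u : R -> R) p q : p <= q ->
  (forall y, p <= y <= q -> {for y, continuous u}) ->
  (forall y, p < y < q -> y \notin s -> exists2 du, is_derive y 1 u du & 0 <= du) ->
  u p <= u q.
Proof.
elim: s p q => [|k s IH] p q pq cu du.
  move: pq; rewrite le_eqVlt => /predU1P[->//|pq].
  have dP y : y \in `]p, q[ -> is_derive y 1 u (derive1 u y).
    rewrite in_itv/= => /du /(_ isT)[e de _].
    by rewrite derive1E; apply/derivableP/ex_derive.
  have [c cpq upq] := MVT pq dP (continuous_within_segment cu).
  rewrite -subr_ge0 upq mulr_ge0 ?subr_ge0 ?(ltW pq)//.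
  move: cpq; rewrite in_itv/= => /du /(_ isT)[e de e0].
  by rewrite derive1E derive_val.
have [/andP[pk kq]|npkq] := boolP (p < k < q).
- apply: (@le_trans _ _ (u k)).
  + apply: IH; first exact: ltW.
      by move=> y /andP[py yk]; apply: cu; rewrite py (le_trans yk)// ltW.
    move=> y /andP[py yk] ys; apply: du; first by rewrite py (lt_trans yk).
    by rewrite inE negb_or (lt_eqF yk).
  + apply: IH; first exact: ltW.
      by move=> y /andP[ky yq]; apply: cu; rewrite yq (le_trans _ ky)// ltW.
    move=> y /andP[ky yq] ys; apply: du; first by rewrite yq (lt_trans pk).
    by rewrite inE negb_or (gt_eqF ky).
- apply: IH => // y pyq ys; apply: du => //; rewrite inE negb_or ys andbT.
  by apply: contraNN npkq => /eqP <-.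
Qed.

Lemma derive1_ge0_of_nondecreasing (D : set R) (u : R -> R) x : open D -> D x ->
  (forall y, D y -> derivable u y 1) -> nondecreasing_on D u -> 0 <= derive1 u x.
Proof.
move=> oD Dx du ndu; rewrite leNgt; apply/negP => u'0.
(* Adding the slope [e] makes [u] strictly increasing, yet its derivative at [x] would be half of
   [derive1 u x], still negative. *)
pose e := - derive1 u x / 2.
have e0 : 0 < e by rewrite divr_gt0// oppr_gt0.
have iv y : D y -> is_derive y 1 (u \+ ( *%R e)) (derive1 u y + e).
  move=> Dy; apply: is_deriveD; first by rewrite derive1E; exact/derivableP/du.
  rewrite -[X in is_derive _ _ _ X]mulr1.
  exact: (is_deriveZ).
have /(_ (u \+ *%R e) D x) := @incr_derive1_ge0 R.
have ivx := iv x Dx; rewrite derive1E derive_val => H.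
have : 0 <= derive1 u x + e.
  apply: H.
  - by move=> y; rewrite inE (interior_id _).1// => /iv ?; exact: ex_derive.
  - move=> y z /[!inE] Dy Dz yz /=; rewrite ler_ltD// ?ltr_pM2l//.
    by apply: ndu => //; exact: ltW.
  - by rewrite (interior_id _).1.
rewrite /e; lra.
Qed.

End monotonicity.

(** * C^2 functions and smooth cut-offs *)

Section C2_functions.
Context (R : realType).
Implicit Types (D : set R) (u v w : R -> R).

(** The derivatives are explicit functions, so that product and chain rules compose without
    identifying [derive1] on neighbourhoods each time. *)
Definition C2_jet D u u1 u2 := forall x, D x ->
  [/\ is_derive x 1 u (u1 x), is_derive x 1 u1 (u2 x) & {for x, continuous u2}].

Lemma is_derive_eq_on D u v (x du : R) : open D -> D x -> (forall y, D y -> u y = v y) ->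
  is_derive x 1 u du -> is_derive x 1 v du.
Proof.
move=> oD Dx uv; apply: near_eq_is_derive.
by apply: filterS (open_nbhs_nbhs (conj oD Dx)) => y; exact: uv.
Qed.

Lemma continuous_eq_on D u v x : open D -> D x -> (forall y, D y -> u y = v y) ->
  {for x, continuous u} -> {for x, continuous v}.
Proof.
move=> oD Dx uv cu; rewrite /prop_for /continuous_at -(uv x Dx).
apply: cvg_trans cu; apply: near_eq_cvg.
by apply: filterS (open_nbhs_nbhs (conj oD Dx)) => y; exact: uv.
Qed.

Lemma is_derive1_derive1 u (x du : R) : is_derive x 1 u du -> derive1 u x = du.
Proof. by move=> H; rewrite derive1E derive_val. Qed.

Lemma is_derive_continuous u (x du : R) : is_derive x 1 u du -> {for x, continuous u}.
Proof.
move=> H; apply: differentiable_continuous.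
exact/derivable1_diffP/(@ex_derive _ _ _ _ _ _ _ H).
Qed.

Lemma C2_jet_derive D u u1 u2 x : open D -> C2_jet D u u1 u2 -> D x ->
  derive1 u x = u1 x /\ derive1n 2 u x = u2 x.
Proof.
move=> oD jet Dx; have [du du1 _] := jet x Dx.
split; first exact: is_derive1_derive1.
rewrite /derive1n/=; apply: is_derive1_derive1.
apply: (is_derive_eq_on oD Dx _ du1) => y /jet[duy _ _].
by rewrite (is_derive1_derive1 duy).
Qed.

Lemma C2_jet_C2_on D u u1 u2 : open D -> C2_jet D u u1 u2 -> C2_on D u.
Proof.
move=> oD jet x Dx; have [du du1 cu2] := jet x Dx; split.
- exact: ex_derive.
- apply: (@ex_derive _ _ _ _ _ _ (u2 x)).
  apply: (is_derive_eq_on oD Dx _ du1) => y /(C2_jet_derive oD jet) [-> //].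
- by apply: (continuous_eq_on oD Dx _ cu2) => y /(C2_jet_derive oD jet) [_ ->].
Qed.

Lemma C2_on_jet D u : C2_on D u -> C2_jet D u (derive1 u) (derive1n 2 u).
Proof.
move=> Du x /Du[du du1 cu2]; split; last exact: cu2.
- have := derivableP du; rewrite -derive1E; exact.
- have := derivableP du1; rewrite -derive1E; exact.
Qed.

Lemma C2_jetS D D' u u1 u2 : D `<=` D' -> C2_jet D' u u1 u2 -> C2_jet D u u1 u2.
Proof. by move=> DD' jet x /DD' /jet. Qed.

Lemma C2_jet_mul D u u1 u2 v v1 v2 : C2_jet D u u1 u2 -> C2_jet D v v1 v2 ->
  C2_jet D (fun x => u x * v x) (fun x => u x * v1 x + v x * u1 x)
    (fun x => u x * v2 x + v x * u2 x + 2 * (u1 x * v1 x)).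
Proof.
move=> ju jv x Dx; have [du du1 cu2] := ju x Dx; have [dv dv1 cv2] := jv x Dx.
have cu := is_derive_continuous du; have cu1 := is_derive_continuous du1.
have cv := is_derive_continuous dv; have cv1 := is_derive_continuous dv1.
split.
- exact: is_deriveM.
- have -> : u x * v2 x + v x * u2 x + 2 * (u1 x * v1 x) =
    (u x *: v2 x + v1 x *: u1 x) + (v x *: u2 x + u1 x *: v1 x).
    by rewrite /GRing.scale/=; ring.
  exact: is_deriveD.
- apply: continuousD; first apply: continuousD; try exact: continuousM.
  by apply: continuousM; [exact: cst_continuous|exact: continuousM].
Qed.

Lemma C2_jet_comp D u u1 u2 v v1 v2 :
  C2_jet setT u u1 u2 -> C2_jet D v v1 v2 ->
  C2_jet D (u \o v) (fun x => u1 (v x) * v1 x)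
    (fun x => u1 (v x) * v2 x + v1 x * (u2 (v x) * v1 x)).
Proof.
move=> ju jv x Dx; have [dv dv1 cv2] := jv x Dx.
have [du du1 cu2] := ju (v x) I.
have cv := is_derive_continuous dv; have cv1 := is_derive_continuous dv1.
have cu1 := is_derive_continuous du1.
have cuv : {for x, continuous (u1 \o v)} by exact: continuous_comp.
split.
- exact: is_derive1_comp.
- have := is_deriveM (is_derive1_comp du1 dv) dv1.
  by [].
- apply: continuousD; first exact: continuousM.
  apply: continuousM => //; apply: continuousM => //.
  exact: continuous_comp.
Qed.

Lemma C2_jet_affine D (k m : R) :
  C2_jet D (fun x => k * x + m) (fun=> k) (fun=> 0).
Proof.
move=> x _; split; last exact: cst_continuous.
- have := is_deriveD (is_deriveZ k (is_derive_id x (1 : R))) (is_derive_cst m x (1 : R)).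
  by rewrite [_ *: _ + 0]addr0 [k *: 1]mulr1.
- exact: is_derive_cst.
Qed.

(** The difference quotient at 0 is [k] itself. Only continuity of [k] is required, which allows [k]
    to contain [Num.max t 0], where the product rule fails. *)
Lemma is_derive_id_mul (k : R -> R) : {for 0, continuous k} ->
  is_derive (0 : R) (1 : R) (fun t : R => t * k t) (k 0).
Proof.
move=> ck.
have H : (fun h : R => h^-1 *: (((fun t => t * k t) \o shift 0) (h *: 1) - 0 * k 0))
    @ 0^' --> k 0.
  have ck' : k h @[h --> 0^'] --> k 0 by apply: cvg_within_filter; exact: ck.
  apply: cvg_trans ck'.
  apply: near_eq_cvg; near=> h.
  have h0 : h != 0 by near: h; exact: nbhs_dnbhs_neq.
  rewrite /= /GRing.scale/= mulr1 addr0 mul0r subr0 mulrA mulVf// mul1r//.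
apply: DeriveDef; first by apply/cvg_ex; exists (k 0).
exact/cvg_lim.
Unshelve. all: by end_near. Qed.

(** The cube of the positive part, the lowest integer power of it that is C^2. A factor [t] is kept
    in front so that [is_derive_id_mul] gives the derivative at 0. *)
Definition cube_pos (t : R) := t * (t * Num.max t 0).

Lemma max0_continuous : continuous (fun t : R => Num.max t 0).
Proof. by move=> t; apply: continuous_max => //; exact: cst_continuous. Qed.

Lemma C2_cube_pos : C2_jet setT cube_pos
  (fun t => 3 * (t * Num.max t 0)) (fun t => 6 * Num.max t 0).
Proof.
move=> t _; split; last first.
- by apply: continuousM; [exact: cst_continuous|exact: max0_continuous].
- have -> : 6 * Num.max t 0 = 3 *: (2 * Num.max t 0).
    by rewrite /GRing.scale/= mulrA; congr (_ * _); ring.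
  apply: is_deriveZ.
  have [t0|t0|t0] := ltgtP t 0.
  + rewrite mulr0.
    have oD : open [set y : R | y < 0] by exact: open_lt.
    apply: (@is_derive_eq_on _ (cst 0) _ t 0 oD t0) => y y0.
    by rewrite /= max_r ?mulr0// ltW.
  + have oD : open [set y : R | 0 < y] by exact: open_gt.
    apply: (@is_derive_eq_on _ (fun y => y * y) _ t _ oD t0) => [y y0|].
      by rewrite /= max_l// ltW.
    have := is_deriveM (is_derive_id t 1) (is_derive_id t 1).
    by rewrite /GRing.scale/= mulr1 -mulr2n -[_ *+ 2]mulr_natl.
  + rewrite t0 mulr0.
    have := @is_derive_id_mul (fun t => Num.max t 0) ltac:(exact: max0_continuous).
    by rewrite /= maxxx.
- have [t0|t0|t0] := ltgtP t 0.
  + rewrite !mulr0.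
    have oD : open [set y : R | y < 0] by exact: open_lt.
    apply: (@is_derive_eq_on _ (cst 0) _ t 0 oD t0) => y y0.
    by rewrite /cube_pos max_r ?mulr0// ltW.
  + have oD : open [set y : R | 0 < y] by exact: open_gt.
    apply: (@is_derive_eq_on _ (fun y => y * (y * y)) _ t _ oD t0) => [y y0|].
      by rewrite /cube_pos max_l// ltW.
    have := is_deriveM (is_derive_id t 1) (is_deriveM (is_derive_id t 1)
      (is_derive_id t 1)).
    by congr is_derive; rewrite ?fctE /GRing.scale/=; ring.
  + rewrite t0 !mulr0.
    have := @is_derive_id_mul (fun t => t * Num.max t 0).
    rewrite /= maxxx mulr0; apply.
    by apply: continuousM => //; exact: max0_continuous.
Qed.

Lemma cube_pos_le0 t : t <= 0 -> cube_pos t = 0.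
Proof. by move=> t0; rewrite /cube_pos max_r// !mulr0. Qed.

Lemma cube_pos_ge0 t : 0 <= cube_pos t.
Proof.
have [t0|t0] := leP t 0; first by rewrite cube_pos_le0.
by rewrite /cube_pos max_l ?(ltW t0)// !mulr_ge0// ltW.
Qed.

Lemma cube_pos_le1 t : t <= 1 -> cube_pos t <= 1.
Proof.
move=> t1; have [t0|t0] := leP t 0; first by rewrite cube_pos_le0.
have t0' := ltW t0.
by rewrite /cube_pos max_l// mulr_ile1 ?mulr_ge0// mulr_ile1.
Qed.

Lemma cube_pos_ge1 t : 1 <= t -> 1 <= cube_pos t.
Proof.
move=> t1; have t0 : 0 <= t by rewrite (le_trans _ t1).
rewrite /cube_pos max_l//.
by rewrite -[leLHS]mulr1 ler_pM// -[leLHS]mulr1 ler_pM.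
Qed.

(** The inner cube makes the step flat to second order at 0, the outer one at 1. *)
Definition smooth_step (t : R) := 1 - cube_pos (1 - cube_pos t).

Lemma smooth_step_itv t : 0 <= smooth_step t <= 1.
Proof.
rewrite /smooth_step subr_ge0 lerBlDr lerDl cube_pos_ge0 andbT.
by rewrite cube_pos_le1// lerBlDr lerDl cube_pos_ge0.
Qed.

Lemma smooth_step_le0 t : t <= 0 -> smooth_step t = 0.
Proof.
by move=> t0; rewrite /smooth_step (cube_pos_le0 t0) subr0 /cube_pos max_l// !mulr1 subrr.
Qed.

Lemma smooth_step_ge1 t : 1 <= t -> smooth_step t = 1.
Proof.
by move=> t1; rewrite /smooth_step cube_pos_le0 ?subr0// subr_le0 cube_pos_ge1.
Qed.

Lemma C2_smooth_step : exists s1 s2, C2_jet setT smooth_step s1 s2.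
Proof.
have := C2_jet_comp (C2_jet_affine (-1) 1) (C2_jet_comp C2_cube_pos
  (C2_jet_comp (C2_jet_affine (-1) 1) C2_cube_pos)).
set s1 := (X in C2_jet _ _ X); set s2 := (X in C2_jet _ _ _ X).
move=> H; exists s1, s2; suff -> : smooth_step = (fun x : R => -1 * x + 1) \o
  (cube_pos \o ((fun x : R => -1 * x + 1) \o cube_pos)) by [].
by apply/funext => t; rewrite /smooth_step /= !mulN1r ![- _ + 1]addrC.
Qed.

Lemma cutoff_exists (c' c e e' : R) : c' < c -> c <= e -> e < e' ->
  exists chi chi1 chi2, [/\ C2_jet setT chi chi1 chi2,
    forall z, 0 <= chi z <= 1, forall z, c <= z <= e -> chi z = 1 &
    forall z, chi z != 0 -> c' < z < e'].
Proof.
move=> cc ce ee; have [s1 [s2 js]] := C2_smooth_step.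
(* [l] sends [c'] to 0 and [c] to 1; [m] sends [e'] to 0 and [e] to 1. The cut-off is the product of
   the two steps. *)
pose l z := (c - c')^-1 * z + - c' / (c - c').
pose m z := - (e' - e)^-1 * z + e' / (e' - e).
have lE z : l z = (z - c') / (c - c') by rewrite /l; ring.
have mE z : m z = (e' - z) / (e' - e) by rewrite /m; ring.
have c0 : 0 < c - c' by rewrite subr_gt0.
have e0 : 0 < e' - e by rewrite subr_gt0.
have := C2_jet_mul (C2_jet_comp js (@C2_jet_affine setT (c - c')^-1 (- c' / (c - c'))))
  (C2_jet_comp js (@C2_jet_affine setT (- (e' - e)^-1) (e' / (e' - e)))).
set chi1 := (X in C2_jet _ _ X); set chi2 := (X in C2_jet _ _ _ X) => j.
exists (fun z => smooth_step (l z) * smooth_step (m z)), chi1, chi2; split => //.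
- move=> z; have /andP[s0 s1'] := smooth_step_itv (l z).
  have /andP[t0 t1] := smooth_step_itv (m z).
  by rewrite mulr_ge0// mulr_ile1.
- move=> z /andP[cz ze]; rewrite !smooth_step_ge1 ?mulr1//.
    by rewrite mE ler_pdivlMr// mul1r lerD2l lerN2.
  by rewrite lE ler_pdivlMr// mul1r lerD2r.
- move=> z; rewrite mulf_eq0 negb_or => /andP[sl sm].
  apply/andP; split; rewrite ltNge.
    apply: contraNN sl => zc; apply/eqP/smooth_step_le0.
    by rewrite lE pmulr_lle0 ?invr_gt0// subr_le0.
  apply: contraNN sm => ez; apply/eqP/smooth_step_le0.
  by rewrite mE pmulr_lle0 ?invr_gt0// subr_le0.
Qed.

End C2_functions.

(** * Extension by cut-off from the state space to the line *)

Section localization.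
Context (R : realType) (a b : \bar R) (mu sigma : R -> R).
Notation I := (state_space a b).
Hypothesis mu_cont : forall x, I x -> {for x, continuous mu}.
Hypothesis sigma_cont : forall x, I x -> {for x, continuous sigma}.

Lemma C2_jet_eq (D : set R) (u v u1 u2 : R -> R) : open D -> (forall y, D y -> u y = v y) ->
  C2_jet D u u1 u2 -> C2_jet D v u1 u2.
Proof.
move=> oD uv j x Dx; have [du du1 cu2] := j x Dx.
by split=> //; exact: (is_derive_eq_on oD Dx uv).
Qed.

Lemma C2_jet0 (D : set R) : C2_jet D (fun=> 0 : R) (fun=> 0) (fun=> 0).
Proof.
by move=> x _; split; [exact: is_derive_cst|exact: is_derive_cst|exact: cst_continuous].
Qed.

Lemma outside_open (c e : R) : open [set z : R | z < c \/ e < z].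
Proof.
rewrite (_ : [set z | _] = [set z | z < c] `|` [set z | e < z])//.
by apply: openU; [exact: open_lt|exact: open_gt].
Qed.

(** The coefficients are controlled inside the state space only. On [[c, e]] the bound is continuity
    on a compact set; off it, [f] vanishes on an open set and so does its generator. *)
Lemma generator_bounded (f : R -> R) c e : C2_on setT f -> I c -> I e ->
  (forall z, f z != 0 -> c <= z <= e) ->
  exists M, 0 <= M /\ forall z, `|generator mu sigma f z| <= M.
Proof.
move=> C2f Ic Ie supp.
have out z : ~~ (c <= z <= e) -> generator mu sigma f z = 0.
  move=> zce; pose D := [set z : R | z < c \/ e < z].
  have oD : open D := @outside_open c e.
  have Dz : D z.
    by move: zce; rewrite negb_and -!ltNge => /orP.
  have f0 y : D y -> 0 = f y.
    move=> Dy; apply/esym/eqP; apply: contraT => /supp /andP[cy ye].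
    by case: Dy => [|]; rewrite ltNge ?cy ?ye.
  have [d1 d2] := C2_jet_derive oD (C2_jet_eq oD f0 (@C2_jet0 D)) Dz.
  by rewrite /generator d1 d2 !mulr0 addr0.
have [ce|ec] := leP c e; last first.
  exists 0; split=> // z; rewrite out ?normr0//.
  by apply/negP => /andP[cz ze]; move: (le_trans cz ze); rewrite leNgt ec.
have cont : {within `[c, e], continuous (fun z => `|generator mu sigma f z|)}.
  apply: continuous_within_segment => y cye.
  have Iy : I y by exact: (state_space_between Ic Ie).
  have [du du1 cu2] := C2_on_jet C2f (Logic.I : setT y).
  apply: (@continuous_comp _ _ _ _ (@Num.norm _ R)); last exact: norm_continuous.
  have cs := sigma_cont Iy.
  apply: continuousD; apply: continuousM => //.
  - apply: continuousM; first exact: cst_continuous.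
    exact: continuousM.
  - exact: mu_cont.
  - exact: is_derive_continuous du1.
have [m mce Hm] := EVT_max ce cont.
exists `|generator mu sigma f m|; split => // z.
have [cze|cze] := boolP (c <= z <= e); first by apply: Hm; rewrite in_itv.
by rewrite out ?normr0.
Qed.

(** [f] is the cut-off times [w], extended by 0, since [w] means nothing outside the state space.
    The last clause carries bounds over: a positive [w] gives [0 <= f <= w]. *)
Lemma localization (w : R -> R) c' c e e' : C2_on I w -> I c' -> I e' ->
  c' < c -> c <= e -> e < e' ->
  exists f : R -> R, [/\ C2_on setT f, forall z, c <= z <= e -> f z = w z,
    forall z, f z != 0 -> c' < z < e',
    forall z, c < z < e -> generator mu sigma f z = generator mu sigma w z &
    forall z, I z -> exists2 k, 0 <= k <= 1 & f z = k * w z].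
Proof.
move=> C2w Ic Ie cc ce ee.
have [chi [chi1 [chi2 [jchi chi01 chi_one chi_supp]]]] := cutoff_exists cc ce ee.
have oI : open I := @state_space_open R a b.
pose f z := if z \in I then chi z * w z else 0.
have fE z : I z -> chi z * w z = f z by move=> Iz; rewrite /f mem_set.
have supp z : f z != 0 -> c' < z < e'.
  rewrite /f; case: ifPn => [_|]; last by rewrite eqxx.
  by rewrite mulf_eq0 negb_or => /andP[/chi_supp].
have IwE z : c <= z <= e -> I z.
  by move=> /andP[cz ze]; apply: (state_space_between Ic Ie);
    rewrite !ltW ?(lt_le_trans cc)// (le_lt_trans ze).
exists f; split => //.
- move=> x _; have [Ix|NIx] := pselect (I x).
    have j := C2_jet_mul (C2_jetS (@subsetT _ I) jchi) (C2_on_jet C2w).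
    exact: (C2_jet_C2_on oI (C2_jet_eq oI fE j)).
  pose D := [set z : R | z < c' \/ e' < z].
  have oD : open D := @outside_open c' e'.
  have Dx : D x.
    have [?|cx] := ltP x c'; first by left.
    have [?|xe] := ltP e' x; first by right.
    by exfalso; apply: NIx; apply: (state_space_between Ic Ie); rewrite cx xe.
  have f0 y : D y -> 0 = f y.
    move=> Dy; apply/esym/eqP; apply: contraT => /supp /andP[cy ye].
    by case: Dy => [|]; rewrite ltNge ltW.
  exact: (C2_jet_C2_on oD (C2_jet_eq oD f0 (@C2_jet0 D))).
- by move=> z zce; rewrite -fE ?chi_one ?mul1r//; exact: IwE.
- move=> z /andP[cz ze].
  have oD : open [set y : R | c < y < e].
    rewrite (_ : [set y | _] = `]c, e[%classic); first exact: itv_open.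
    by apply/seteqP; split=> y /=; rewrite in_itv.
  have Dz : [set y : R | c < y < e] z by rewrite /= cz ze.
  have wf y : [set y : R | c < y < e] y -> w y = f y.
    by move=> /= /andP[cy ye]; rewrite -fE ?chi_one ?mul1r ?ltW//; apply: IwE; rewrite !ltW.
  have jw : C2_jet [set y : R | c < y < e] w (derive1 w) (derive1n 2 w).
    by move=> y /= /andP[cy ye]; apply: (C2_on_jet C2w); apply: IwE; rewrite !ltW.
  have [d1 d2] := C2_jet_derive oD (C2_jet_eq oD wf jw) Dz.
  by rewrite /generator d1 d2.
- by move=> z Iz; exists (chi z) => //; rewrite fE.
Qed.

End localization.

(** * Semigroup of the diffusion *)

Section bounded_functions.
Context d (T : measurableType d) (R : realType) (P : probability T R).

Lemma integrable_bounded (F : T -> R) (M : R) : measurable_fun setT F ->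
  (forall w, `|F w| <= M) -> P.-integrable setT (EFin \o F).
Proof.
move=> mF FM; apply: measurable_bounded_integrable => //.
- by rewrite (le_lt_trans (probability_le1 _ measurableT))// ltry.
- by exists M; split; [rewrite num_real|move=> y My w _; exact: (le_trans (FM w) (ltW My))].
Qed.

Lemma integral_cst_probability (M : R) : (\int[P]_w M%:E)%E = M%:E.
Proof. by rewrite integral_cst// [X in (_ * X)%E]probability_setT mule1. Qed.

Lemma integral_bounded_between (F : T -> R) (m M : R) :
  (forall w, m <= F w <= M) -> (m%:E <= \int[P]_w (F w)%:E <= M%:E)%E.
Proof.
move=> FM; rewrite -[X in (X <= _ <= _)%E]integral_cst_probability.
rewrite -[X in (_ <= _ <= X)%E]integral_cst_probability.
by apply/andP; split; apply: le_integral_nonmeasurable => w _;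
  have /andP[] := FM w; rewrite lee_fin.
Qed.

End bounded_functions.

Section diffusion.
Context (R : realType) (d : measure_display) (Om : measurableType d).
Context (a b : \bar R) (mu sigma : R -> R) (X : process R Om).
Hypothesis hX : regular_diffusion a b mu sigma X.
Notation I := (state_space a b).

Lemma in_at_measurable t B : 0 <= t -> measurable B -> measurable (in_at X t B).
Proof. by move=> t0 mB; apply: (filt_measurable hX t0);
  exact: coord_adapted hX _ _ t0 mB. Qed.

Lemma value_at_measurable (f : R -> R) t : 0 <= t -> measurable_fun setT f ->
  measurable_fun setT (value_at X f t).
Proof.
move=> t0 mf _ B mB; rewrite setTI.
have -> : value_at X f t @^-1` B = in_at X t (f @^-1` B) `|`
    (~` in_at X t setT `&` [set _ | B 0]).
  apply/seteqP; split => w /=; rewrite /value_at /in_at/=.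
    by case: ifPn => tl Bw; [left|right; split=> // -[]].
  by move=> [[-> //]|[]]; case: ifPn => // tl []; split.
apply: measurableU.
  by apply: in_at_measurable => //; rewrite -[_ @^-1` _]setTI; exact: mf.
apply: measurableI; first by apply: measurableC; exact: in_at_measurable.
by have [B0|B0] := pselect (B 0); [rewrite (_ : [set _ | _] = setT)//|
  rewrite (_ : [set _ | _] = set0)//]; apply/seteqP; split.
Qed.

Lemma value_at_bounded (f : R -> R) t w (M : R) : 0 <= t -> 0 <= M ->
  (forall z, I z -> `|f z| <= M) -> `|value_at X f t w| <= M.
Proof.
move=> t0 M0 fM; rewrite /value_at; case: ifPn => [tl|_]; last by rewrite normr0.
exact/fM/(coord_in hX).
Qed.

Lemma semigroup_bounded (f : R -> R) t y (M : R) : 0 <= t -> 0 <= M ->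
  (forall z, I z -> `|f z| <= M) -> ((- M)%:E <= semigroup X f t y <= M%:E)%E.
Proof.
move=> t0 M0 fM; apply: integral_bounded_between => w.
by rewrite -ler_norml; exact: value_at_bounded.
Qed.

Lemma semigroup_fin_num (f : R -> R) t y (M : R) : 0 <= t -> 0 <= M ->
  (forall z, I z -> `|f z| <= M) -> semigroup X f t y \is a fin_num.
Proof.
move=> t0 M0 fM; have /andP[lo hi] := semigroup_bounded y t0 M0 fM.
by rewrite fin_numElt (lt_le_trans _ lo) ?ltNyr// (le_lt_trans hi)// ltry.
Qed.

Lemma kolmogorov_bound (f : R -> R) c e x h (l u : R) :
  C2_on setT f -> I c -> I e -> (forall z, f z != 0 -> c <= z <= e) ->
  I x -> 0 <= h ->
  (forall s, 0 <= s <= h -> (l%:E <= semigroup X (generator mu sigma f) s x <= u%:E)%E) ->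
  ((f x + l * h)%:E <= semigroup X f h x <= (f x + u * h)%:E)%E.
Proof.
move=> C2f Ic Ie supp Ix h0 lu.
rewrite (kolmogorov hX C2f Ic Ie supp Ix h0) !EFinD.
have leb : lebesgue_measure `[0, h]%classic = h%:E :> \bar R.
  by rewrite lebesgue_measure_itv/= lte_fin; case: ltP => [_|h0'];
    rewrite ?oppr0 ?adde0 ?EFinN ?sube0//; congr EFin; apply/eqP; rewrite eq_le h0 h0'.
have cstE (k : R) : (k * h)%:E = (\int[lebesgue_measure]_(s in `[0%R, h]) k%:E)%E.
  by rewrite integral_cst//= EFinM; congr (_ * _)%E; exact/esym/leb.
rewrite !cstE !leeD2lE//; apply/andP; split;
  by apply: le_integral_nonmeasurable => s /=; rewrite in_itv/= => /lu /andP[].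
Qed.

End diffusion.

(** First-order terms cancel: [exp(- r h) (1 + r h)] lies between [1 - (r h)^2] and 1. This accounts
    for [F * r ^+ 2]; the error [C] on [p] only shrinks under discounting. *)
Lemma discounted_growth (R : realType) (r h F C v p : R) :
  0 < r -> 0 <= h -> 0 <= v <= F -> 0 <= C ->
  v * (1 + r * h) - C * h ^+ 2 <= p <= v * (1 + r * h) + C * h ^+ 2 ->
  `|expR (- r * h) * p - v| <= (F * r ^+ 2 + C) * h ^+ 2.
Proof.
move=> hr h0 /andP[v0 vF] C0 /andP[pl pu].
have E1 : 1 + - r * h <= expR (- r * h) by exact: expR_ge1Dx.
have E0 : 0 < expR (- r * h) by exact: expR_gt0.
have E2 : expR (- r * h) * (1 + r * h) <= 1.
  rewrite [leRHS](_ : 1 = expR (- r * h) * expR (r * h));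
    last by rewrite -expRD mulNr addNr expR0.
  by rewrite ler_pM2l//; exact: expR_ge1Dx.
have E3 : expR (- r * h) <= 1.
  by rewrite -[leRHS](@expR0 R) ler_expR mulNr lerNl oppr0 mulr_ge0// ltW.
have rh0 : 0 <= r * h by rewrite mulr_ge0// ltW.
set E := expR (- r * h) in E0 E1 E2 E3 *.
have E4 : 1 - (r * h) ^+ 2 <= E * (1 + r * h).
  have : (1 - r * h) * (1 + r * h) <= E * (1 + r * h) by rewrite ler_wpM2r//; lra.
  by apply: le_trans; rewrite [leRHS](_ : _ = 1 - (r * h) ^+ 2)//; ring.
have h2 : 0 <= h ^+ 2 by exact: sqr_ge0.
have up : E * p <= E * (v * (1 + r * h) + C * h ^+ 2) by rewrite ler_pM2l.
have lo : E * (v * (1 + r * h) - C * h ^+ 2) <= E * p by rewrite ler_pM2l.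
have Ch : E * (C * h ^+ 2) <= C * h ^+ 2 by rewrite ler_piMl// mulr_ge0.
have u1 : v * (E * (1 + r * h)) <= v by rewrite ler_piMr.
have l1 : v * (1 - (r * h) ^+ 2) <= v * (E * (1 + r * h)) by rewrite ler_wpM2l.
have l2 : v * (r * h) ^+ 2 <= F * (r * h) ^+ 2 by rewrite ler_wpM2r// sqr_ge0.
have l3 : F * (r * h) ^+ 2 = F * r ^+ 2 * h ^+ 2 by ring.
have e0 : 0 <= F * r ^+ 2 * h ^+ 2.
  by apply: mulr_ge0 => //; apply: mulr_ge0; [exact: le_trans v0 vF|exact: sqr_ge0].
rewrite ler_norml; apply/andP; split; lra.
Qed.

(** * The second-order estimate for one time step *)

Section one_step.
Context (R : realType) (d : measure_display) (Om : measurableType d).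
Context (a b : \bar R) (mu sigma : R -> R) (r : R) (X : process R Om).
Context (psi : R -> R).
Hypothesis hr : 0 < r.
Hypothesis hX : regular_diffusion a b mu sigma X.
Hypothesis hpsi : increasing_solution a b mu sigma r X psi.
Notation I := (state_space a b).

Lemma C2_on_measurable (f : R -> R) : C2_on setT f -> measurable_fun setT f.
Proof.
move=> C2f; apply: continuous_measurable_fun => x.
by have [du _ _] := C2_on_jet C2f (Logic.I : setT x); exact: is_derive_continuous du.
Qed.

Lemma semigroup_affine (f f1 : R -> R) s y (M M1 p q A B C : R) :
  measurable_fun setT f -> measurable_fun setT f1 -> 0 <= s ->
  0 <= M -> (forall z, I z -> `|f z| <= M) ->
  0 <= M1 -> (forall z, I z -> `|f1 z| <= M1) ->
  semigroup X f s y = p%:E -> semigroup X f1 s y = q%:E ->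
  (\int[law X y]_w (A * value_at X f s w + B * value_at X f1 s w + C)%:E)%E =
    (A * p + B * q + C)%:E.
Proof.
move=> mf mf1 s0 M0 fM M10 f1M pE qE.
have if_ : (law X y).-integrable setT (EFin \o value_at X f s).
  apply: (@integrable_bounded _ _ _ _ _ M); first exact: (value_at_measurable hX).
  by move=> w; exact: (value_at_bounded hX).
have if1 : (law X y).-integrable setT (EFin \o value_at X f1 s).
  apply: (@integrable_bounded _ _ _ _ _ M1); first exact: (value_at_measurable hX).
  by move=> w; exact: (value_at_bounded hX).
have ic : (law X y).-integrable setT (EFin \o (fun _ : Om => C)).
  by apply: (@integrable_bounded _ _ _ _ _ `|C|).
under eq_integral => w _ do rewrite EFinD EFinD (EFinM A) (EFinM B).
rewrite integralD//; last by apply: integrableD => //; exact: integrableZl.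
rewrite integralD//; try exact: integrableZl.
rewrite !integralZl// integral_cst_probability.
by move: pE qE; rewrite /semigroup => -> ->.
Qed.

Lemma psi_nd x z : I x -> I z -> x <= z -> psi x <= psi z.
Proof.
move=> Ix Iz; rewrite le_eqVlt => /predU1P[->//|xz].
by apply: ltW; exact: (psi_increasing hpsi).
Qed.

(* [f] is [psi] near [c, e], where [L f = r f]; away from there [L f - r f] is
   bounded, and the plateau function [f1] and Kolmogorov's equation bound the
   probability of getting there in time [s] by a multiple of [s]. *)
Lemma one_step c' c e e' : I c' -> I e' -> c' < c -> c <= e -> e < e' ->
  exists f K, [/\ C2_on setT f, forall z, c <= z <= e -> f z = psi z,
    forall z, f z != 0 -> c' < z < e',
    forall z, I z -> 0 <= f z <= psi z &
    0 <= K /\ forall h y, 0 <= h <= 1 -> c <= y <= e ->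
      exists p, semigroup X f h y = p%:E /\ `|expR (- r * h) * p - psi y| <= K * h ^+ 2].
Proof.
move=> Ic' Ie' cc ce ee.
(* The midpoints leave room for two nested cut-offs: [f] agrees with [psi] on [[c1, e1]], and the
   plateau [f1], equal to 1 on [[c, e]], is supported inside [(c1, e1)], where [L f = r f]. *)
pose c1 := (c' + c) / 2; pose e1 := (e + e') / 2.
have c'c1 : c' < c1 by rewrite /c1; lra.
have c1c : c1 < c by rewrite /c1; lra.
have ee1 : e < e1 by rewrite /e1; lra.
have e1e' : e1 < e' by rewrite /e1; lra.
have c1e1 : c1 <= e1 by lra.
have bI y : c' <= y <= e' -> I y by exact: (state_space_between Ic' Ie').
have Ic1 : I c1 by apply: bI; rewrite ltW//=; lra.
have Ie1 : I e1 by apply: bI; lra.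
have mc := drift_continuous hX; have sc := volatility_continuous hX.
have [f [C2f fpsi fsupp fgen fk]] :=
  localization mu sigma (psi_C2 hpsi) Ic' Ie' c'c1 c1e1 e1e'.
have C2one : C2_on I (cst 1 : R -> R).
  apply: (@C2_jet_C2_on _ _ _ (fun=> 0) (fun=> 0)); first exact: state_space_open.
  by move=> x _; split; [exact: is_derive_cst|exact: is_derive_cst|exact: cst_continuous].
have [f1 [C2f1 f1one f1supp _ f1k]] :=
  localization mu sigma C2one Ic1 Ie1 c1c ce ee1.
have f1_01 z : 0 <= f1 z <= 1.
  have [->|/f1supp/andP[cz ze]] := eqVneq (f1 z) 0; first by rewrite lexx ler01.
  have Iz : I z by apply: bI; rewrite !ltW//; lra.
  by have [k kk ->] := f1k _ Iz; rewrite /= mulr1.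
have f_psi z : I z -> 0 <= f z <= psi z.
  move=> Iz; have [k /andP[k0 k1] ->] := fk _ Iz; have p0 := psi_gt0 hpsi Iz.
  by rewrite mulr_ge0 ?(ltW p0)//= ler_piMl// ltW.
have fsuppw z : f z != 0 -> c' <= z <= e' by move=> /fsupp/andP[? ?]; rewrite !ltW.
have f1suppw z : f1 z != 0 -> c1 <= z <= e1 by move=> /f1supp/andP[? ?]; rewrite !ltW.
have [M [M0 fM]] := generator_bounded mc sc C2f Ic' Ie' fsuppw.
have [M1 [M10 f1M]] := generator_bounded mc sc C2f1 Ic1 Ie1 f1suppw.
pose F := psi e'.
have F0 : 0 < F by exact: (psi_gt0 hpsi).
have fF z : I z -> 0 <= f z <= F.
  move=> Iz; have /andP[f0 fp] := f_psi z Iz; rewrite f0/=.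
  have [->|/fsupp/andP[cz ze]] := eqVneq (f z) 0; first exact: ltW.
  by apply: (le_trans fp); apply: psi_nd => //; exact: ltW.
have absf z : I z -> `|f z| <= F.
  by move=> /fF /andP[f0 fF']; rewrite ger0_norm.
have absf1 z : I z -> `|f1 z| <= 1 by move=> _; have /andP[f0 ff] := f1_01 z;
  rewrite ger0_norm.
(* [M'] bounds [L f - r f] everywhere. In [C], the term [r * M] comes from the drift of the mean of
   [f] away from [psi y], and [M' * M1] from the paths that have left the plateau. *)
pose M' := M + r * F.
have M'0 : 0 <= M' by rewrite addr_ge0// mulr_ge0// ltW.
pose C := r * M + M' * M1.
have C0 : 0 <= C by rewrite addr_ge0// mulr_ge0// ltW.
exists f, (F * r ^+ 2 + C); split => //.
  by move=> z /andP[cz ze]; apply: fpsi;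
    rewrite (le_trans _ cz) ?(ltW c1c)//= (le_trans ze)// ltW.
split; first by rewrite addr_ge0// mulr_ge0 ?sqr_ge0// ltW.
move=> h y /andP[h0 h1] /andP[cy ye].
have Iy : I y by apply: bI; lra.
have fyE : f y = psi y by apply: fpsi; lra.
have Sf s : 0 <= s -> exists2 p, semigroup X f s y = p%:E & `|p - psi y| <= s * M.
  move=> s0; have fin := semigroup_fin_num hX y s0 (ltW F0) absf.
  exists (fine (semigroup X f s y)); first by rewrite fineK.
  have /(kolmogorov_bound hX C2f Ic' Ie' fsuppw Iy s0) : forall u, 0 <= u <= s ->
      ((- M)%:E <= semigroup X (generator mu sigma f) u y <= M%:E)%E.
    by move=> u /andP[u0 _]; apply: (semigroup_bounded hX) => // z _; exact: fM.
  rewrite -(fineK fin) !lee_fin fyE /= ler_norml => /andP[H1 H2].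
  by apply/andP; split; lra.
have Sf1 s : 0 <= s -> exists2 q, semigroup X f1 s y = q%:E & 1 - s * M1 <= q.
  move=> s0; have fin := semigroup_fin_num hX y s0 ler01 absf1.
  exists (fine (semigroup X f1 s y)); first by rewrite fineK.
  have /(kolmogorov_bound hX C2f1 Ic1 Ie1 f1suppw Iy s0) : forall u, 0 <= u <= s ->
      ((- M1)%:E <= semigroup X (generator mu sigma f1) u y <= M1%:E)%E.
    by move=> u /andP[u0 _]; apply: (semigroup_bounded hX) => // z _; exact: f1M.
  rewrite -(fineK fin) !lee_fin f1one ?cy//= => /andP[H1 H2].
  lra.
have mf := C2_on_measurable C2f; have mf1 := C2_on_measurable C2f1.
(* In other words [L f - r f] is at most [M' (1 - f1)] in absolute value: it vanishes where [f1]
   does not. *)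
have gen z : I z -> r * f z - M' + M' * f1 z <= generator mu sigma f z <= r * f z +
  M' - M' * f1 z.
  move=> Iz; have /andP[f10 f11] := f1_01 z; have /andP[f0 fF'] := fF z Iz.
  have := fM z; rewrite ler_norml => /andP[gl gu].
  have [f1z|/f1supp zz] := eqVneq (f1 z) 0.
    rewrite f1z mulr0 subr0 addr0 /M'.
    have : 0 <= r * f z by rewrite mulr_ge0// ltW.
    have : r * f z <= r * F by rewrite ler_pM2l.
    by move=> H1 H2; apply/andP; split; lra.
  have -> : generator mu sigma f z = r * f z.
    rewrite fgen// fpsi; last by move: zz => /andP[? ?]; rewrite !ltW.
    by apply/eqP; rewrite -subr_eq0; apply/eqP; exact: (psi_ode hpsi).
  have : 0 <= M' * (1 - f1 z) by rewrite mulr_ge0// subr_ge0.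
  by move=> H; apply/andP; split; lra.
(* Bootstrapping: the crude bounds [Sf] and [Sf1], of order [s], place the mean of [L f] within
   [C h] of [r psi y]. Integrating this over [[0, h]] by Kolmogorov's equation gives the error
   [C h^2]. *)
have key s : 0 <= s <= h ->
    ((r * psi y - C * h)%:E <= semigroup X (generator mu sigma f) s y <= (r * psi y
      + C * h)%:E)%E.
  move=> /andP[s0 sh]; have [p pE pb] := Sf s s0; have [q qE qb] := Sf1 s s0.
  move: pb; rewrite ler_norml => /andP[pl pu].
  have sM : s * M <= h * M by rewrite ler_wpM2r.
  have sM1 : s * M1 <= h * M1 by rewrite ler_wpM2r.
  have q1 : 1 - h * M1 <= q by lra.
  have M'q : M' * (1 - q) <= M' * (h * M1) by rewrite ler_wpM2l//; lra.
  have rp1 : r * (p - psi y) <= r * (h * M) by rewrite ler_pM2l//; lra.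
  have rp2 : r * (- (h * M)) <= r * (p - psi y) by rewrite ler_pM2l//; lra.
  apply/andP; split.
  - apply: (@le_trans _ _ (r * p + M' * q + - M')%:E).
      by rewrite lee_fin /C; lra.
    rewrite -(semigroup_affine r M' (- M') mf mf1 s0 (ltW F0) absf ler01 absf1 pE qE).
    apply: le_integral_nonmeasurable => w _; rewrite lee_fin /value_at;
      case: ifPn => sl; last first.
      by rewrite !mulr0 !add0r lerNl oppr0.
    by have /andP[g1 g2] := gen _ (coord_in hX s0 sl); lra.
  - apply: (@le_trans _ _ (r * p + - M' * q + M')%:E); last first.
      by rewrite lee_fin /C; lra.
    rewrite -(semigroup_affine r (- M') M' mf mf1 s0 (ltW F0) absf ler01 absf1 pE qE).
    apply: le_integral_nonmeasurable => w _; rewrite lee_fin /value_at;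
      case: ifPn => sl; last first.
      by rewrite !mulr0 !add0r.
    by have /andP[g1 g2] := gen _ (coord_in hX s0 sl); lra.
have [p pE _] := Sf h h0; exists p; split => //.
have := kolmogorov_bound hX C2f Ic' Ie' fsuppw Iy h0 key.
rewrite pE !lee_fin fyE => /andP[pl pu].
have psi0 := psi_gt0 hpsi Iy.
have psiF : psi y <= F by apply: psi_nd => //; lra.
apply: discounted_growth => //; first by rewrite ltW.
have -> : psi y * (1 + r * h) - C * h ^+ 2 = psi y + (r * psi y - C * h) * h by ring.
have -> : psi y * (1 + r * h) + C * h ^+ 2 = psi y + (r * psi y + C * h) * h by ring.
by rewrite pl.
Qed.

End one_step.

(** * Induction on nonnegative measurable functions *)

Section measurable_induction.
Context d (T : measurableType d) (R : realType).
Import HBNNSimple.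

Lemma ge0_measurable_ind (Q : (T -> R) -> Prop) :
  (forall B, measurable B -> Q (\1_B)) ->
  (forall f g : T -> R, measurable_fun setT f -> measurable_fun setT g ->
    (forall x, 0 <= f x) -> (forall x, 0 <= g x) -> Q f -> Q g -> Q (f \+ g)) ->
  (forall (k : R) (f : T -> R), 0 <= k -> measurable_fun setT f -> (forall x, 0 <= f x) ->
    Q f -> Q (fun x => k * f x)) ->
  (forall (f_ : nat -> T -> R) (f : T -> R), (forall n, measurable_fun setT (f_ n)) ->
    measurable_fun setT f -> (forall n x, 0 <= f_ n x) ->
    (forall x, {homo f_^~ x : m n / (m <= n)%N >-> m <= n}) ->
    (forall x, f_ n x @[n --> \oo] --> f x) -> (forall n, Q (f_ n)) -> Q f) ->
  forall f : T -> R, measurable_fun setT f -> (forall x, 0 <= f x) -> Q f.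
Proof.
move=> Qi Qadd Qscale Qlim f mf f0.
have mEf : measurable_fun setT (EFin \o f) by exact/measurable_EFinP.
pose f_ := nnsfun_approx measurableT mEf.
apply: (Qlim (fun n => f_ n : T -> R)) => //.
- by move=> x m n mn; exact/lefP/nd_nnsfun_approx.
- move=> x; have : (EFin \o f_ ^~ x) n @[n --> \oo] --> (f x)%:E.
    by apply: (@cvg_nnsfun_approx _ _ _ _ measurableT _ mEf) => // y _; rewrite lee_fin.
  by move=> /fine_cvgP[_]; apply.
- move=> n; set h := f_ n.
  rewrite (_ : (h : T -> R) = fun x => \sum_(y <- finmap.enum_fset (fset_set (range
    h))) (y * \1_(h @^-1` [set y]) x)); last first.
    by apply/funext => x; rewrite [LHS]fimfunE fsbig_finite.
  have : forall y, y \in finmap.enum_fset (fset_set (range h)) -> 0 <= y.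
    move=> y yh; have fin : finite_set (range h) by exact: fimfunP.
    have := in_fset_set fin y; rewrite [LHS]yh => /esym yh'.
    by have [x _ <-] := set_mem yh'; exact: fun_ge0.
  (* A simple function is a sum over the list of its values. Measurability and sign of the partial
     sums are carried along because closure under addition asks for them. *)
  suff H : forall s : seq R, (forall y, y \in s -> 0 <= y) ->
      [/\ measurable_fun setT (fun x => \sum_(y <- s) (y * \1_(h @^-1` [set y]) x)),
        forall x, 0 <= \sum_(y <- s) (y * \1_(h @^-1` [set y]) x) &
        Q (fun x => \sum_(y <- s) (y * \1_(h @^-1` [set y]) x))].
    by move=> /H [].
  elim=> [_|y s IH ys].
    have -> : (fun x => \sum_(y <- [::]) (y * \1_(h @^-1` [set y]) x)) = \1_(set0 : set T).
      by apply/funext => x; rewrite big_nil indicE in_set0.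
    by split; [exact: measurable_indic|move=> x; rewrite big_nil|exact: Qi].
  have [ms s0 Qs] := IH (fun z zs => ys z (mem_behead (s := y :: s) zs)).
  have y0 : 0 <= y by apply: ys; rewrite mem_head.
  have mh : measurable (h @^-1` [set y]) by exact: measurable_sfunP.
  have m1 : measurable_fun setT (fun x => y * \1_(h @^-1` [set y]) x : R).
    by apply: measurable_funM => //; exact: measurable_indic.
  have ge0 x : 0 <= y * \1_(h @^-1` [set y]) x by rewrite mulr_ge0.
  rewrite (_ : (fun x => _) = (fun x => y * \1_(h @^-1` [set y]) x) \+
    (fun x => \sum_(y <- s) (y * \1_(h @^-1` [set y]) x))); last first.
    by apply/funext => x; rewrite big_cons.
  split; [exact: measurable_funD|by move=> x /=; rewrite big_cons addr_ge0|].
  by apply: Qadd => //; apply: Qscale => //; exact: Qi.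
Qed.

End measurable_induction.

(** * Closure properties of a sigma-algebra given as a set of sets *)

Section sigma_algebras.
Context (T : Type) (G : set (set T)).
Hypothesis sG : sigma_algebra setT G.

Lemma sigma_algebra_set0 : G set0.
Proof. by have [] := sG. Qed.

Lemma sigma_algebra_setT : G setT.
Proof. by have [G0 GC _] := sG; have := GC _ G0; rewrite setD0. Qed.

Lemma sigma_algebra_setC A : G A -> G (~` A).
Proof. by have [_ GC _] := sG; move=> /GC; rewrite setTD. Qed.

Lemma sigma_algebra_bigcup (A : nat -> set T) : (forall n, G (A n)) -> G (\bigcup_n A n).
Proof. by have [_ _] := sG; apply. Qed.

Lemma sigma_algebra_bigcap (A : nat -> set T) : (forall n, G (A n)) -> G (\bigcap_n A n).
Proof.
move=> GA; rewrite -[\bigcap_n A n]setCK setC_bigcap; apply: sigma_algebra_setC.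
by apply: sigma_algebra_bigcup => n; exact: sigma_algebra_setC.
Qed.

Lemma sigma_algebra_setU A B : G A -> G B -> G (A `|` B).
Proof.
move=> GA GB; rewrite -bigcup2E; apply: sigma_algebra_bigcup => -[|[|n]] //=.
exact: sigma_algebra_set0.
Qed.

Lemma sigma_algebra_setI A B : G A -> G B -> G (A `&` B).
Proof.
move=> GA GB; rewrite -[A `&` B]setCK setCI; apply: sigma_algebra_setC.
by apply: sigma_algebra_setU; exact: sigma_algebra_setC.
Qed.

End sigma_algebras.

(** * The Markov property at a fixed time *)

Section markov.
Context (R : realType) (d : measure_display) (Om : measurableType d).
Context (a b : \bar R) (mu sigma : R -> R) (X : process R Om).
Hypothesis hX : regular_diffusion a b mu sigma X.
Notation I := (state_space a b).

Lemma stopping_time_cst t : 0 <= t -> stopping_time X (fun=> t%:E).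
Proof.
move=> t0; split=> [w|s s0]; first by rewrite lee_fin.
have [ts|st] := boolP (t%:E <= s%:E)%E.
  rewrite (_ : [set _ | _] = setT);
    first exact: sigma_algebra_setT (filt_sigma_algebra hX s0).
  by apply/seteqP; split.
rewrite (_ : [set _ | _] = set0);
  first exact: sigma_algebra_set0 (filt_sigma_algebra hX s0).
by apply/seteqP; split.
Qed.

Lemma stopped_event_cst t A : 0 <= t -> filt X t A -> stopped_event X (fun=> t%:E) A.
Proof.
move=> t0 fA; split; first exact: (filt_measurable hX t0).
move=> s s0; have [ts|st] := boolP (t%:E <= s%:E)%E.
  rewrite (_ : A `&` [set _ | _] = A);
    first by apply: (filt_nondecreasing hX t0) fA; rewrite -lee_fin.
  by apply/seteqP; split=> [w []|w Aw] //; split.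
rewrite (_ : A `&` [set _ | _] = set0);
  first exact: sigma_algebra_set0 (filt_sigma_algebra hX s0).
by apply/seteqP; split=> // w [].
Qed.

Lemma value_at_indic t B w : value_at X \1_B t w = \1_(in_at X t B) w.
Proof.
rewrite /value_at; case: ifPn => tl; rewrite !indicE.
  rewrite (_ : (w \in in_at X t B) = (coord X t w \in B))//.
  by apply/idP/idP => [/set_mem[_ ?]|/set_mem ?]; apply/mem_set.
by rewrite memNset// => -[tl' _]; rewrite tl' in tl.
Qed.

Lemma coord_measurable t (A : set Om) : 0 <= t -> measurable A ->
  A `<=` in_at X t setT -> measurable_fun A (coord X t).
Proof.
move=> t0 mA Aal _ B mB.
rewrite (_ : A `&` _ = A `&` in_at X t B); first by apply: measurableI => //;
  exact: (in_at_measurable hX).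
by apply/seteqP; split=> w [Aw Bw]; split => //; [split=> //; have [] := Aal _ Aw|case: Bw].
Qed.

(** For indicators this is the strong Markov property at the constant time [t]; measurable induction
    does the rest. The event [A] consists of living paths, so that the new starting point lies in
    the state space, where the kernel is measurable. Measurability of the inner mean is part of the
    induction, because linearity and monotone convergence use it. *)
Lemma markov_property x t s A (f : R -> R) : I x -> 0 <= t -> 0 <= s ->
  filt X t A -> A `<=` in_at X t setT ->
  measurable_fun setT f -> (forall z, 0 <= f z) ->
  measurable_fun A (fun w => semigroup X f s (coord X t w)) /\
  (\int[law X x]_(w in A) (value_at X f (t + s) w)%:E =
   \int[law X x]_(w in A) semigroup X f s (coord X t w))%E.
Proof.
move=> Ix t0 s0 fA Aal.
have mA : measurable A := filt_measurable hX t0 fA.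
have ts0 : 0 <= t + s by rewrite addr_ge0.
have mc := coord_measurable t0 mA Aal.
have vm h u : 0 <= u -> measurable_fun setT h -> measurable_fun setT (EFin \o
  value_at X h u).
  by move=> u0 mh; apply/measurable_EFinP; exact: (value_at_measurable hX).
have v0 h u w : (forall z, 0 <= h z) -> 0 <= value_at X h u w.
  by move=> h0; rewrite /value_at; case: ifP.
have K0 h y : (forall z, 0 <= h z) -> (0 <= semigroup X h s y)%E.
  by move=> h0; apply: integral_ge0 => w _; rewrite lee_fin v0.
pose Q (h : R -> R) := measurable_fun A (fun w => semigroup X h s (coord X t w)) /\
  (\int[law X x]_(w in A) (value_at X h (t + s) w)%:E =
   \int[law X x]_(w in A) semigroup X h s (coord X t w))%E.
suff : forall h : R -> R, measurable_fun setT h -> (forall z, 0 <= h z) -> Q h by exact.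
apply: ge0_measurable_ind => {f}; rewrite {}/Q.
- move=> B mB.
  have E y : I y -> semigroup X \1_B s y = law X y (in_at X s B).
    move=> Iy; rewrite /semigroup; under eq_integral do rewrite value_at_indic.
    by rewrite integral_indic ?setIT//; exact: (in_at_measurable hX).
  have EA w : A w -> semigroup X \1_B s (coord X t w) = law X (coord X t w) (in_at X s B).
    by move=> /Aal[tl _]; apply: E; exact: (coord_in hX).
  split.
    apply: (eq_measurable_fun (fun w => law X (coord X t w) (in_at X s B))).
      by move=> w /[!inE] Aw; rewrite EA.
    apply: (@measurable_comp _ _ _ _ _ _ I (fun y => law X y (in_at X s B)) A
      (coord X t)) => //.
    + exact: measurable_state_space.
    + by move=> _ [w /Aal[tl _] <-]; exact: (coord_in hX).
    + exact: (law_measurable hX).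
  under eq_integral do rewrite value_at_indic.
  rewrite integral_indic//; last exact: (in_at_measurable hX).
  have := strong_markov hX Ix (stopping_time_cst t0) (stopped_event_cst t0 fA) s0 mB.
  rewrite (_ : A `&` [set w | (t%:E < life X w)%E] = A); last first.
    by apply/seteqP; split=> [w []|w Aw] //; split=> //; have [] := Aal _ Aw.
  rewrite (_ : [set w | _] = in_at X (t + s) B `&` A); last first.
    apply/seteqP; split=> w /=; first by move=> [].
    by move=> [Hw Aw]; split => //; have [] := Aal _ Aw.
  by move=> H; apply: (eq_trans H); apply: eq_integral => w /[!inE] Aw; rewrite EA.
- move=> f g mf mg f0 g0 [mKf Ef] [mKg Eg].
  have vD u w : value_at X (f \+ g) u w = value_at X f u w + value_at X g u w.
    by rewrite /value_at; case: ifP; rewrite ?addr0.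
  have KD y : semigroup X (f \+ g) s y = (semigroup X f s y + semigroup X g s y)%E.
    rewrite /semigroup; under eq_integral do rewrite vD EFinD.
    by rewrite ge0_integralD//; try (by move=> w _; rewrite lee_fin v0); exact: vm.
  split.
    apply: (eq_measurable_fun (fun w => semigroup X f s (coord X t w) + semigroup X
      g s (coord X t w))%E).
      by move=> w _; rewrite KD.
    exact: emeasurable_funD.
  under eq_integral do rewrite vD EFinD.
  under [in RHS]eq_integral do rewrite KD.
  rewrite [LHS]ge0_integralD//; try (by move=> w _; rewrite lee_fin v0);
    try (by apply: measurable_funTS; exact: vm).
  rewrite [RHS]ge0_integralD//; try (by move=> w _; exact: K0).
  by rewrite Ef Eg.
- move=> k f k0 mf f0 [mKf Ef].
  have vZ u w : value_at X (fun z => k * f z) u w = k * value_at X f u w.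
    by rewrite /value_at; case: ifP; rewrite ?mulr0.
  have KZ y : semigroup X (fun z => k * f z) s y = (k%:E * semigroup X f s y)%E.
    rewrite /semigroup; under eq_integral do rewrite vZ EFinM.
    by rewrite ge0_integralZl_EFin//; [move=> w _; rewrite lee_fin v0|exact: vm].
  split.
    apply: (eq_measurable_fun (fun w => k%:E * semigroup X f s (coord X t w))%E).
      by move=> w _; rewrite KZ.
    exact: measurable_funeM.
  under eq_integral do rewrite vZ EFinM.
  under [in RHS]eq_integral do rewrite KZ.
  rewrite [LHS]ge0_integralZl_EFin//; try (by move=> w _; rewrite lee_fin v0);
    try (by apply: measurable_funTS; exact: vm).
  rewrite [RHS]ge0_integralZl_EFin//; first by rewrite Ef.
  by move=> w _; exact: K0.
- move=> f_ f mf_ mf f_0 ndf fcvg KEf.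
  have vlim u w : (value_at X (f_ n) u w)%:E @[n --> \oo] --> (value_at X f u w)%:E.
    apply: cvg_EFin; first by apply: nearW.
    by rewrite /value_at; case: ifP => _; [exact: fcvg|exact: cvg_cst].
  have vnd u w : {homo (fun n => (value_at X (f_ n) u w)%:E) : m n / (m <= n)%N >->
    (m <= n)%E}.
    by move=> m n mn; rewrite lee_fin /value_at; case: ifP => // _; exact: ndf.
  have Klim y : semigroup X (f_ n) s y @[n --> \oo] --> semigroup X f s y.
    rewrite /semigroup (_ : (\int[law X y]_w (value_at X f s w)%:E)%E =
        (\int[law X y]_w limn (fun n => (value_at X (f_ n) s w)%:E))%E); last first.
      by apply: eq_integral => w _; apply/esym/cvg_lim => //; exact: vlim.
    apply: cvg_monotone_convergence => //.
    + by move=> n; exact: vm.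
    + by move=> n w _; rewrite lee_fin v0.
  have mK : measurable_fun A (fun w => semigroup X f s (coord X t w)).
    apply: (emeasurable_fun_cvg (fun n w => semigroup X (f_ n) s (coord X t w))).
      by move=> n; exact: (KEf n).1.
    by move=> w _; exact: Klim.
  split => //.
  rewrite (_ : (\int[law X x]_(w in A) (value_at X f (t + s) w)%:E)%E =
    (\int[law X x]_(w in A) limn (fun n => (value_at X (f_ n) (t + s) w)%:E))%E);
      last first.
    by apply: eq_integral => w _; apply/esym/cvg_lim => //; exact: vlim.
  rewrite (_ : (\int[law X x]_(w in A) semigroup X f s (coord X t w))%E =
    (\int[law X x]_(w in A) limn (fun n => semigroup X (f_ n) s (coord X t w)))%E);
      last first.
    by apply: eq_integral => w _; apply/esym/cvg_lim => //; exact: Klim.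
  rewrite monotone_convergence//; first last.
  + by move=> n w _; rewrite lee_fin v0.
  + by move=> n; apply: measurable_funTS; exact: vm.
  rewrite monotone_convergence//; first last.
  + move=> w _ m n mn; apply: ge0_le_integral_nonmeasurable => u _;
    first by rewrite lee_fin v0.
    exact: vnd.
  + by move=> n w _; exact: K0.
  + by move=> n; exact: (KEf n).1.
  by congr (limn _); apply/funext => n; exact: (KEf n).2.
Qed.

End markov.

(** * Stopping on a time grid *)

Section grid.
Context (R : realType) (d : measure_display) (Om : measurableType d).
Context (X : process R Om).

Definition grid_value (r : R) (f : R -> R) (h : R) (k : nat) (w : Om) : R :=
  expR (- r * (k%:R * h)) * value_at X f (k%:R * h) w.

(** For decreasing [A], the discounted value at the first grid index whose event fails, or at [n].
    The recursion displays that passing from [n] to the next index changes the value on [A n]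
    only. *)
Fixpoint grid_stopped (r : R) (f : R -> R) (h : R) (A : nat -> set Om) (n : nat) (w
  : Om) : R :=
  if n is n'.+1 then
    if w \in A n' then grid_value r f h n w else grid_stopped r f h A n' w
  else grid_value r f h 0 w.

Lemma grid_stoppedP r f h (A : nat -> set Om) n w : (forall k, A k.+1 `<=` A k) ->
  exists2 k, grid_stopped r f h A n w = grid_value r f h k w &
    [/\ (k <= n)%N, forall j, (j < k)%N -> A j w & (k < n)%N -> ~ A k w].
Proof.
move=> Adecr; elim: n => [|n [k Zk [kn Aj Ak]]] /=; first by exists 0%N.
case: ifPn => [/set_mem An|/negP NAn].
  exists n.+1 => //; split => // [j jn|]; last by rewrite ltnn.
  have {}jn : (j <= n)%N by [].
  elim: n {Zk kn Ak} An jn => [|n IH] An; first by rewrite leqn0 => /eqP ->.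
  by rewrite leq_eqVlt => /predU1P[->//|]; apply: IH; exact: Adecr.
exists k => //; split => // [|_ Akw]; first exact: leqW.
have : (k < n)%N || (k == n) by rewrite orbC -leq_eqVlt.
by move=> /orP[/Ak //|/eqP kn']; apply: NAn; apply/mem_set; rewrite -kn'.
Qed.

Lemma grid_stopped_on r f h (A : nat -> set Om) n w : (forall k, A k.+1 `<=` A k) ->
  A n w -> grid_stopped r f h A n w = grid_value r f h n w.
Proof. by move=> Adecr; case: n => [|n] // /Adecr An /=; rewrite mem_set. Qed.

End grid.

Section grid_dynkin.
Context (R : realType) (d : measure_display) (Om : measurableType d).
Context (a b : \bar R) (mu sigma : R -> R) (r : R) (X : process R Om).
Hypothesis hr : 0 < r.
Hypothesis hX : regular_diffusion a b mu sigma X.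
Notation I := (state_space a b).

Context (f psi : R -> R) (c e h K B : R) (A : nat -> set Om).
Hypothesis f_meas : measurable_fun setT f.
Hypothesis f_bounded : forall z, 0 <= f z <= B.
Hypothesis f_psi : forall z, c <= z <= e -> f z = psi z.
Hypothesis h_pos : 0 <= h <= 1.
Hypothesis K_ge0 : 0 <= K.
Hypothesis one_step_h : forall h' y, 0 <= h' <= 1 -> c <= y <= e ->
  exists p, semigroup X f h' y = p%:E /\ `|expR (- r * h') * p - psi y| <= K * h' ^+ 2.
Hypothesis A_filt : forall k, filt X (k%:R * h) (A k).
Hypothesis A_decr : forall k, A k.+1 `<=` A k.
Hypothesis A_in : forall k, A k `<=` in_at X (k%:R * h) [set z | c <= z <= e].

Let kh0 k : 0 <= k%:R * h.
Proof. by have /andP[h0 _] := h_pos; rewrite mulr_ge0. Qed.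

Lemma grid_value_measurable k : measurable_fun setT (grid_value X r f h k).
Proof.
by apply: measurable_funM; [exact: measurable_cst|exact: (value_at_measurable hX)].
Qed.

Lemma grid_value_itv k w : 0 <= grid_value X r f h k w <= B.
Proof.
have B0 : 0 <= B by have /andP[f0 fB] := f_bounded 0; exact: le_trans fB.
have /andP[v0 vB] : 0 <= value_at X f (k%:R * h) w <= B.
  by rewrite /value_at; case: ifP; rewrite ?f_bounded// lexx B0.
rewrite /grid_value mulr_ge0 ?expR_ge0//= (le_trans _ vB)// ler_piMl//.
by rewrite -[leRHS](@expR0 R) ler_expR mulNr lerNl oppr0 mulr_ge0// ltW.
Qed.

Lemma grid_stopped_itv n w : 0 <= grid_stopped X r f h A n w <= B.
Proof. by have [k -> _] := grid_stoppedP X r f h n w A_decr; exact: grid_value_itv. Qed.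

Let mA k : measurable (A k).
Proof. exact: (filt_measurable hX (kh0 k)). Qed.

Lemma grid_stopped_measurable n : measurable_fun setT (grid_stopped X r f h A n).
Proof.
elim: n => [|n IH] /=; first exact: grid_value_measurable.
apply: measurable_fun_ifT => //; last exact: grid_value_measurable.
apply: (measurable_fun_bool true); rewrite setTI.
rewrite (_ : _ @^-1` _ = A n)//.
by apply/seteqP; split=> w; [exact: set_mem|exact: mem_set].
Qed.

(** The Markov property at time [n h] restarts the process inside [[c, e]], where the one-step
    estimate holds; the discount accumulated so far is at most 1 and does not enlarge its error. *)
Let step x n : I x ->
  (\int[law X x]_(w in A n) (grid_value X r f h n.+1 w)%:E <=
    \int[law X x]_(w in A n) (grid_value X r f h n w)%:E + (K * h ^+ 2)%:E)%E /\
  (\int[law X x]_(w in A n) (grid_value X r f h n w)%:E <=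
    \int[law X x]_(w in A n) (grid_value X r f h n.+1 w)%:E + (K * h ^+ 2)%:E)%E.
Proof.
move=> Ix; have /andP[h0 _] := h_pos.
have Aal : A n `<=` in_at X (n%:R * h) setT by move=> w /A_in[].
have f0 z : 0 <= f z by have /andP[] := f_bounded z.
have [mK EK] := markov_property hX Ix (kh0 n) h0 (A_filt n) Aal f_meas f0.
have Kh0 : 0 <= K * h ^+ 2 by rewrite mulr_ge0 ?sqr_ge0.
have nE : n.+1%:R * h = n%:R * h + h by rewrite -natr1 mulrDl mul1r.
pose E1 := expR (- r * (n.+1%:R * h)).
have E1E : E1 = expR (- r * (n%:R * h)) * expR (- r * h).
  by rewrite /E1 nE mulrDr expRD.
have E10 : 0 <= E1 by exact: expR_ge0.
have S0 y : (0 <= semigroup X f h y)%E.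
  by apply: integral_ge0 => w _; rewrite lee_fin /value_at; case: ifP.
have Y1 : (\int[law X x]_(w in A n) (grid_value X r f h n.+1 w)%:E =
   \int[law X x]_(w in A n) (E1%:E * semigroup X f h (coord X (n%:R * h) w)))%E.
  under eq_integral do rewrite EFinM.
  rewrite ge0_integralZl_EFin//; first last.
  - by apply: measurable_funTS; apply/measurable_EFinP; exact: (value_at_measurable hX).
  - by move=> w _; rewrite lee_fin /value_at; case: ifP.
  by rewrite [RHS]ge0_integralZl_EFin// -EK -nE.
have cstle : (\int[law X x]_(w in A n) (K * h ^+ 2)%:E <= (K * h ^+ 2)%:E)%E.
  rewrite integral_cst// -[leRHS]mule1 lee_wpmul2l// probability_le1//.
have key w : A n w -> exists p, [/\ semigroup X f h (coord X (n%:R * h) w) = p%:E,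
   E1 * p <= grid_value X r f h n w + K * h ^+ 2 &
   grid_value X r f h n w <= E1 * p + K * h ^+ 2].
  { move=> /A_in [al cez]; have [p [pE]] := one_step_h h_pos cez.
  rewrite ler_norml => /andP[p1 p2]; exists p; split => //.
  all: rewrite E1E /grid_value /value_at al f_psi//.
  all: set E0 := expR (- r * (n%:R * h)).
  all: have E01 : E0 <= 1
    by rewrite -[leRHS](@expR0 R) ler_expR mulNr lerNl oppr0 mulr_ge0// ltW.
  all: have E00 : 0 <= E0 by exact: expR_ge0.
  all: have EKh : E0 * (K * h ^+ 2) <= K * h ^+ 2 by rewrite ler_piMl.
  + rewrite -mulrA (le_trans _ (lerD (lexx _) EKh))// -mulrDr ler_wpM2l//; lra.
  + rewrite -mulrA (le_trans _ (lerD (lexx _) EKh))// -mulrDr ler_wpM2l//; lra. }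
have mY : measurable_fun (A n) (fun w => (grid_value X r f h n w)%:E).
  by apply: measurable_funTS; apply/measurable_EFinP; exact: grid_value_measurable.
have Y0 w : (0 <= (grid_value X r f h n w)%:E)%E by have /andP[] := grid_value_itv n w.
have mES : measurable_fun (A n) (fun w => (E1%:E * semigroup X f h (coord X (n%:R *
  h) w))%E).
  exact: measurable_funeM.
rewrite Y1; split.
- apply: (@le_trans _ _ (\int[law X x]_(w in A n) ((grid_value X r f h n w)%:E + (K
  * h ^+ 2)%:E))%E).
    apply: ge0_le_integral_nonmeasurable => w Aw; first by rewrite mule_ge0.
    by have [p [-> H _]] := key w Aw; rewrite -EFinM -EFinD lee_fin.
  by rewrite ge0_integralD// leeD2l.
- apply: (@le_trans _ _ (\int[law X x]_(w in A n) (E1%:E * semigroup X f h (coord X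
  (n%:R * h) w) + (K * h ^+ 2)%:E))%E).
    apply: ge0_le_integral_nonmeasurable => w Aw; first exact: Y0.
    by have [p [-> _ H]] := key w Aw; rewrite -EFinM -EFinD lee_fin.
  by rewrite ge0_integralD// ?leeD2l// => w _; rewrite mule_ge0.
Qed.

Lemma grid_dynkin x n : I x -> c <= x <= e ->
  (\int[law X x]_w (grid_stopped X r f h A n w)%:E <= (psi x + n%:R * (K * h ^+ 2))%:E)%E /\
  ((psi x)%:E <= \int[law X x]_w (grid_stopped X r f h A n w)%:E + (n%:R * (K * h
    ^+ 2))%:E)%E.
Proof.
move=> Ix cxe; have Kh0 : 0 <= K * h ^+ 2 by rewrite mulr_ge0 ?sqr_ge0.
elim: n => [|n [IH1 IH2]].
  (* With [h' = 0] the error term vanishes, so the estimate evaluates the mean at time 0 exactly. *)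
  have [||p [pE]] := @one_step_h 0 x => //; first by rewrite lexx ler01.
  rewrite !mulr0 expR0 mul1r expr0n/= mulr0 normr_le0 subr_eq0 => /eqP px.
  rewrite /grid_stopped /grid_value !mul0r mulr0 expR0 addr0 adde0.
  under eq_integral do rewrite mul1r.
  by move: pE; rewrite /semigroup => ->; rewrite px.
have mZ m D : measurable D -> measurable_fun D (fun w => (grid_stopped X r f h A m w)%:E).
  by move=> _; apply: measurable_funTS; apply/measurable_EFinP;
    exact: grid_stopped_measurable.
have Z0 m w : (0 <= (grid_stopped X r f h A m w)%:E)%E by have /andP[] :=
  grid_stopped_itv m w.
have split_int m : (\int[law X x]_w (grid_stopped X r f h A m w)%:E =
    \int[law X x]_(w in A n) (grid_stopped X r f h A m w)%:E +
    \int[law X x]_(w in ~` A n) (grid_stopped X r f h A m w)%:E)%E.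
  have mC : measurable (~` A n) by exact: measurableC.
  rewrite -ge0_integral_setU//; [by rewrite setUv|by rewrite setUv;
    exact: mZ|exact/disj_setPCl].
have ZS : (\int[law X x]_w (grid_stopped X r f h A n.+1 w)%:E =
    \int[law X x]_(w in A n) (grid_value X r f h n.+1 w)%:E +
    \int[law X x]_(w in ~` A n) (grid_stopped X r f h A n w)%:E)%E.
  rewrite split_int; congr (_ + _)%E; apply: eq_integral => w /[!inE] Aw /=.
    by rewrite mem_set.
  by rewrite memNset.
have Zn : (\int[law X x]_w (grid_stopped X r f h A n w)%:E =
    \int[law X x]_(w in A n) (grid_value X r f h n w)%:E +
    \int[law X x]_(w in ~` A n) (grid_stopped X r f h A n w)%:E)%E.
  rewrite split_int; congr (_ + _)%E; apply: eq_integral => w /[!inE] Aw.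
  by rewrite grid_stopped_on.
have [s1 s2] := step n Ix.
have comb (p q z t : \bar R) (k m : R) : (q <= p + k%:E)%E ->
    (t <= q + z + m%:E)%E -> (t <= p + z + (m + k)%:E)%E.
  move=> qp tq; apply: (le_trans tq); rewrite (addrC m) EFinD addeA; apply: leeD2r.
  by rewrite addeAC; exact: leeD2r.
have comb2 (p q z : \bar R) (t m k : R) : (q <= p + k%:E)%E ->
    (p + z <= (t + m)%:E)%E -> (q + z <= (t + (m + k))%:E)%E.
  move=> qp pz; rewrite addrA EFinD; apply: (le_trans _ (leeD2r _ pz)).
  by rewrite addeAC; exact: leeD2r.
rewrite -natr1 mulrDl mul1r ZS; split.
- by apply: comb2 s1 _; rewrite -Zn.
- by apply: comb s2 _; rewrite -Zn.
Qed.

End grid_dynkin.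

Section grid_approximation.
Context (R : realType) (d : measure_display) (Om : measurableType d).
Context (a b : \bar R) (mu sigma : R -> R) (r : R) (X : process R Om).
Context (psi : R -> R).
Hypothesis hr : 0 < r.
Hypothesis hX : regular_diffusion a b mu sigma X.
Hypothesis hpsi : increasing_solution a b mu sigma r X psi.
Notation I := (state_space a b).

Lemma filt_in_at_upto (h : R) B k : 0 <= h -> measurable B ->
  filt X (k%:R * h) [set w | forall j, (j <= k)%N -> in_at X (j%:R * h) B w].
Proof.
move=> h0 mB; elim: k => [|k IH].
  rewrite (_ : [set _ | _] = in_at X (0%:R * h) B).
    by apply: (coord_adapted hX) => //; rewrite mul0r.
  by apply/seteqP; split => [w /(_ 0%N)|w Bw [|j]//]; exact.
have -> : [set w | forall j, (j <= k.+1)%N -> in_at X (j%:R * h) B w] =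
  [set w | forall j, (j <= k)%N -> in_at X (j%:R * h) B w] `&` in_at X (k.+1%:R * h) B.
  apply/seteqP; split => [w H|w [H1 H2] j].
    by split => [j jk|]; apply: H => //; exact: leqW.
  by rewrite leq_eqVlt => /predU1P[->//|]; exact: H1.
have k0 n : 0 <= n%:R * h by rewrite mulr_ge0.
apply: (sigma_algebra_setI (filt_sigma_algebra hX (k0 k.+1)));
  last exact: (coord_adapted hX).
by apply: (filt_nondecreasing hX (k0 k)) IH; rewrite ler_wpM2r// ler_nat.
Qed.

Lemma grid_approximation (tau : Om -> \bar R) x c' c e e' (m : nat) :
  stopping_time X tau -> I c' -> I e' -> c' < c -> c <= x <= e -> e < e' ->
  exists Z : Om -> R,
  [/\ measurable_fun setT Z, forall w, 0 <= Z w <= psi e',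
    (\int[law X x]_w (Z w)%:E <= (psi x + m.+1%:R^-1)%:E)%E,
    ((psi x)%:E <= \int[law X x]_w (Z w)%:E + (m.+1%:R^-1)%:E)%E &
    forall w, exists t, [/\ 0 <= t, Z w <= expR (- r * t) * value_at X psi t w,
      (t%:E < life X w)%E -> c <= coord X t w <= e -> Z w = expR (- r * t) * psi
        (coord X t w),
      t = 0 \/ ((t - m.+1%:R^-1)%:E < tau w)%E &
      ~ [/\ t < m%:R, (t%:E < tau w)%E &
        forall s, 0 <= s <= t -> (s%:E < life X w)%E /\ c <= coord X s w <= e]]].
Proof.
move=> [tau0 tauf] Ic' Ie' cc /andP[cx xe] ee.
have ce : c <= e by exact: le_trans xe.
have bI y : c' <= y <= e' -> I y by exact: (state_space_between Ic' Ie').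
have Ix : I x by apply: bI; lra.
have [f [K [C2f fpsi fsupp f01 [K0 onestep]]]] := one_step hr hX hpsi Ic' Ie' cc ce ee.
(* With mesh [h = 1 / q] and [m q] steps the horizon is [m] and the accumulated error is [m K h].
   The two summands of [q] make this error and [h] itself at most [1 / (m + 1)]. *)
pose q := (Num.truncn (m%:R * K * m.+1%:R) + m).+1.
have q0 : 0 < q%:R :> R by rewrite ltr0n.
pose h : R := q%:R^-1.
have h0 : 0 < h by rewrite invr_gt0.
have h1 : h <= 1 by rewrite invf_le1// ler1n.
have hm : h <= m.+1%:R^-1 by rewrite lef_pV2 ?posrE ?ltr0n// ler_nat /q ltnS leq_addl.
pose N := (m * q)%N.
have Nh : N%:R * h = m%:R by rewrite /N natrM /h mulfK// gt_eqF.
have err : N%:R * (K * h ^+ 2) <= m.+1%:R^-1.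
  have -> : N%:R * (K * h ^+ 2) = m%:R * K * h.
    by rewrite -Nh; ring.
  rewrite -[leRHS]mul1r ler_pdivlMr ?ltr0n// mulrAC ler_pdivrMr// mul1r.
  apply: le_trans (ltW (truncnS_gt _)) _.
  by rewrite ler_nat /q ltnS leq_addr.
pose Cset := [set z : R | c <= z <= e].
have mC : measurable Cset.
  rewrite (_ : Cset = `[c, e]%classic); first exact: measurable_itv.
  by apply/seteqP; split=> z /=; rewrite in_itv.
(* Not yet past [tau], and inside [[c, e]] at all grid times so far. The event is known at time
   [k h] because [tau <= k h] is, so the filtration need not be right-continuous. *)
pose A k := ~` [set w | (tau w <= (k%:R * h)%:E)%E] `&`
  [set w | forall j, (j <= k)%N -> in_at X (j%:R * h) Cset w].
have kh0 k : 0 <= k%:R * h by rewrite mulr_ge0// ltW.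
have Af k : filt X (k%:R * h) (A k).
  apply: (sigma_algebra_setI (filt_sigma_algebra hX (kh0 k)));
    last by apply: filt_in_at_upto => //; exact: ltW.
  by apply: (sigma_algebra_setC (filt_sigma_algebra hX (kh0 k))); exact: tauf.
have Ad k : A k.+1 `<=` A k.
  move=> w [tw H]; split; last by move=> j jk; apply: H; exact: leqW.
  move=> /= tk; apply: tw => /=; apply: (le_trans tk).
  by rewrite lee_fin ler_pM2r// ler_nat.
have Ai k : A k `<=` in_at X (k%:R * h) Cset by move=> w [_]; apply.
have fB z : 0 <= f z <= psi e'.
  have pe := psi_gt0 hpsi Ie'.
  have [->|/fsupp/andP[cz ze]] := eqVneq (f z) 0; first by rewrite lexx ltW.
  have Iz : I z by apply: bI; rewrite !ltW.
  have /andP[-> fp] := f01 z Iz; apply: (le_trans fp).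
  by apply: (psi_nd hpsi) => //; exact: ltW.
have mf := C2_on_measurable C2f.
have h01 : 0 <= h <= 1 by rewrite h1 ltW.
have [E1 E2] := grid_dynkin hr hX mf fB fpsi h01 K0 onestep Af Ad Ai N Ix (introT
  andP (conj cx xe)).
exists (grid_stopped X r f h A N); split.
- exact: (grid_stopped_measurable r hX mf h01 Af).
- by move=> w; exact: grid_stopped_itv.
- by apply: (le_trans E1); rewrite lee_fin lerD2l.
- by apply: (le_trans E2); apply: leeD2l; rewrite lee_fin.
move=> w; have [k -> [kN Aj Ak]] := grid_stoppedP X r f h N w Ad.
exists (k%:R * h); split => //.
- rewrite /grid_value ler_wpM2l ?expR_ge0// /value_at; case: ifPn => // al.
  by have /andP[] := f01 _ (coord_in hX (kh0 k) al).
- by move=> al cez; rewrite /grid_value /value_at al fpsi.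
- case: k {kN Ak} Aj => [|k] Aj; first by left; rewrite mul0r.
  right; have [tk _] := Aj k (ltnSn k).
  have {}tk : ((k%:R * h)%:E < tau w)%E by rewrite ltNge; exact/negP.
  apply: le_lt_trans tk.
  by rewrite lee_fin -[k.+1%:R]natr1 mulrDl mul1r lerBlDr lerD2l.
- move=> [tm ttau H]; apply: Ak.
    by rewrite -(ltr_nat R) -(ltr_pM2r h0) Nh.
  split; first by apply/negP; rewrite -ltNge.
  move=> j jk; have [|al cez] := H (j%:R * h); last by split.
  by rewrite kh0 ler_pM2r// ler_nat.
Qed.

End grid_approximation.

(** * Paths and hitting times *)

Section paths.
Context (R : realType) (d : measure_display) (Om : measurableType d).
Context (a b : \bar R) (mu sigma : R -> R) (X : process R Om).
Hypothesis hX : regular_diffusion a b mu sigma X.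
Notation I := (state_space a b).

Lemma alive_le w s t : s <= t -> (t%:E < life X w)%E -> (s%:E < life X w)%E.
Proof. by move=> st; apply: le_lt_trans; rewrite lee_fin. Qed.

Lemma path_continuous w t e : 0 <= t -> (t%:E < life X w)%E -> 0 < e ->
  exists2 del, 0 < del & forall s, 0 <= s -> (s%:E < life X w)%E -> `|s - t| < del ->
    `|coord X s w - coord X t w| < e.
Proof.
move=> t0 tl e0; have /subspace_continuousP/(_ t (conj t0 tl)) := @coord_continuous
  _ _ _ _ _ _ _ _ hX w.
move=> /cvgrPdist_lt/(_ _ e0); rewrite near_withinE => /nbhs_ballP[del /= del0 H].
exists del => // s s0 sl st; rewrite distrC; apply: H => //.
by rewrite /ball/= distrC.
Qed.

Lemma path_continuous_segment w t : (t%:E < life X w)%E ->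
  {within `[0, t], continuous (fun s => coord X s w)}.
Proof.
move=> tl; apply: continuous_subspaceW (@coord_continuous _ _ _ _ _ _ _ _ hX w) => s /=.
by rewrite in_itv/= => /andP[s0 st]; split=> //; exact: alive_le tl.
Qed.

Lemma path_max w t : 0 <= t -> (t%:E < life X w)%E ->
  exists2 s, 0 <= s <= t & forall u, 0 <= u <= t -> coord X u w <= coord X s w.
Proof.
move=> t0 tl; have [s st H] := EVT_max t0 (path_continuous_segment tl).
by exists s; [move: st; rewrite in_itv|move=> u ut; apply: H; rewrite in_itv].
Qed.

Lemma path_min w t : 0 <= t -> (t%:E < life X w)%E ->
  exists2 s, 0 <= s <= t & forall u, 0 <= u <= t -> coord X s w <= coord X u w.
Proof.
move=> t0 tl; have [s st H] := EVT_min t0 (path_continuous_segment tl).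
by exists s; [move: st; rewrite in_itv|move=> u ut; apply: H; rewrite in_itv].
Qed.

Lemma path_compact w t : 0 <= t -> (t%:E < life X w)%E ->
  exists c e, [/\ I c, I e & forall u, 0 <= u <= t -> c <= coord X u w <= e].
Proof.
move=> t0 tl.
have [s /andP[s0 st] Hs] := path_min t0 tl; have [v /andP[v0 vt] Hv] := path_max t0 tl.
exists (coord X s w), (coord X v w); split.
- by apply: (coord_in hX) => //; exact: alive_le tl.
- by apply: (coord_in hX) => //; exact: alive_le tl.
- by move=> u ut; rewrite Hs ?Hv.
Qed.

Lemma life_fine w : (life X w < +oo)%E -> life X w = (fine (life X w))%:E /\ 0 <
  fine (life X w).
Proof.
move=> lf; have l0 := life_gt0 hX w.
have lE : life X w = (fine (life X w))%:E.
  by rewrite fineK// fin_numElt lf andbT (lt_trans _ l0)// ltNyr.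
by split=> //; rewrite -lte_fin -lE.
Qed.

Lemma exits_at_near e w (B : set (\bar R)) : exits_at X e w -> nbhs e B ->
  exists s0, [/\ 0 <= s0, (s0%:E < life X w)%E &
    forall s, s0 <= s -> (s%:E < life X w)%E -> B (coord X s w)%:E].
Proof.
move=> [lf ex] nB; have [lE l0] := life_fine lf.
have : \forall t \near (fine (life X w))^'-, B (coord X t w)%:E by exact: ex.
rewrite /at_left near_withinE => /nbhs_ballP[del /= del0 H].
have m0 : 0 < Num.min (del / 2) (fine (life X w)).
  by rewrite lt_min l0 andbT divr_gt0.
exists (fine (life X w) - Num.min (del / 2) (fine (life X w))); split.
- by rewrite subr_ge0 ge_min lexx orbT.
- by rewrite [ltRHS]lE lte_fin ltrBlDr ltrDl.
- move=> s s0; rewrite lE lte_fin => sl; apply: H => //.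
  rewrite /ball/= gtr0_norm ?subr_gt0//.
  have : Num.min (del / 2) (fine (life X w)) <= del / 2 by rewrite ge_min lexx.
  by move: s0 del0; set m := Num.min _ _; lra.
Qed.

Lemma exits_at_gt e y w : exits_at X e w -> (y%:E < e)%E ->
  exists s0, [/\ 0 <= s0, (s0%:E < life X w)%E &
    forall s, s0 <= s -> (s%:E < life X w)%E -> y < coord X s w].
Proof.
move=> ex ye; have [|s0 [? ? H]] := @exits_at_near e w [set z | (y%:E < z)%E] ex.
  exact: open_ereal_gt'.
by exists s0; split=> // s ss sl; have := H s ss sl; rewrite /= lte_fin.
Qed.

Lemma exits_at_lt e y w : exits_at X e w -> (e < y%:E)%E ->
  exists s0, [/\ 0 <= s0, (s0%:E < life X w)%E &
    forall s, s0 <= s -> (s%:E < life X w)%E -> coord X s w < y].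
Proof.
move=> ex ye; have [|s0 [? ? H]] := @exits_at_near e w [set z | (z < y%:E)%E] ex.
  exact: open_ereal_lt'.
by exists s0; split=> // s ss sl; have := H s ss sl; rewrite /= lte_fin.
Qed.

Lemma exits_at_left w z : I z -> (life X w < +oo)%E ->
  (forall s, 0 <= s -> (s%:E < life X w)%E -> coord X s w <= z) -> exits_at X a w.
Proof.
move=> [az zb] lf H; have [//|ex] := no_interior_death hX lf.
have [s0 [s00 s0l]] := exits_at_gt ex zb => /(_ s0 (lexx _) s0l).
by rewrite ltNge H.
Qed.

(** The delicate case is death before [t]. A path that stays below [z < b] can only exit at [a],
    hence is eventually below its starting value, and the maximum over the remaining compact time
    interval is global. *)
Lemma path_sup_attained w t z : I z -> 0 <= t ->
  (forall s, 0 <= s <= t -> (s%:E < life X w)%E -> coord X s w < z) ->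
  exists s, [/\ 0 <= s <= t, (s%:E < life X w)%E &
    forall u, 0 <= u <= t -> (u%:E < life X w)%E -> coord X u w <= coord X s w].
Proof.
move=> Iz t0 H; have l0 := life_gt0 hX w.
have [tl|lt] := ltP t%:E (life X w).
  have [s /andP[s0 st] Hs] := path_max t0 tl.
  by exists s; split; [rewrite s0|exact: alive_le tl|move=> u ut _; exact: Hs].
have lf : (life X w < +oo)%E by rewrite (le_lt_trans lt)// ltry.
have ut u : (u%:E < life X w)%E -> u <= t.
  by move=> ul; rewrite -lee_fin; exact/ltW/(lt_le_trans ul).
have exa : exits_at X a w.
  apply: (exits_at_left Iz lf) => s s0 sl; apply/ltW/H => //.
  by rewrite s0 ut.
have [aX0 _] := coord_in hX (lexx 0) l0.
have [s0 [s00 s0l Hs0]] := exits_at_lt exa aX0.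
have [s /andP[sp ss0] Hs] := path_max s00 s0l.
have sl := alive_le ss0 s0l.
exists s; split=> // [|u /andP[u0 _] ul]; first by rewrite sp ut.
have [us0|s0u] := leP u s0; first by apply: Hs; rewrite u0.
by apply: (le_trans (ltW (Hs0 u (ltW s0u) ul))); apply: Hs; rewrite lexx.
Qed.

Lemma hitting_time_ge0 z w : (0 <= hitting_time X z w)%E.
Proof. by apply: le_ereal_inf_tmp => _ [s [s0 _ _] <-]; rewrite lee_fin. Qed.

Lemma hitting_time_le z w s : 0 <= s -> (s%:E < life X w)%E -> z <= coord X s w ->
  (hitting_time X z w <= s%:E)%E.
Proof. by move=> s0 sl zs; apply: ereal_inf_lbound; exists s. Qed.

Lemma hitting_time_attained z w : (hitting_time X z w < +oo)%E ->
  exists t, [/\ hitting_time X z w = t%:E, 0 <= t, (t%:E < life X w)%E & z <= coord X t w].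
Proof.
move=> tf; have t0 := hitting_time_ge0 z w.
have tfin : hitting_time X z w \is a fin_num by rewrite ge0_fin_numE.
have tE : hitting_time X z w = (fine (hitting_time X z w))%:E by rewrite fineK.
set t := fine _ in tE.
have tp : 0 <= t by rewrite -lee_fin -tE; exact: t0.
have tl : (t%:E < life X w)%E.
  have [_ [s [s0 sl zs] <-] _] := @lb_ereal_inf_adherent _ _ 1 ltr01 tfin.
  by apply: (le_lt_trans _ sl); rewrite -tE; exact: hitting_time_le.
exists t; split=> //.
rewrite leNgt; apply/negP => Xz.
have e0 : 0 < z - coord X t w by rewrite subr_gt0.
have [del del0 H] := path_continuous tp tl e0.
have [_ [s [s0 sl zs] <-]] := @lb_ereal_inf_adherent _ _ del del0 tfin.
rewrite -/(hitting_time X z w) tE lte_fin => st.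
have ts : t <= s by rewrite -lee_fin -tE; exact: hitting_time_le.
have : `|s - t| < del by rewrite ger0_norm ?subr_ge0// ltrBlDl.
by move=> /(H s s0 sl); rewrite ltr_norml => /andP[_]; rewrite ltrD2r ltNge zs.
Qed.

Lemma before_hitting z w s : 0 <= s -> (s%:E < life X w)%E ->
  (s%:E < hitting_time X z w)%E -> coord X s w < z.
Proof.
move=> s0 sl st; rewrite ltNge; apply/negP => zs.
by move: st; rewrite ltNge hitting_time_le.
Qed.

Lemma coord_hitting z w t : coord X 0 w <= z -> 0 <= t -> hitting_time X z w = t%:E ->
  (t%:E < life X w)%E -> z <= coord X t w -> coord X t w = z.
Proof.
move=> X0 t0 tE tl; rewrite le_eqVlt => /predU1P[->//|zt].
have t1 : 0 < t.
  rewrite lt_neqAle t0 andbT; apply/negP => /eqP t00.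
  by move: zt; rewrite -t00 ltNge X0.
have e0 : 0 < coord X t w - z by rewrite subr_gt0.
have [del del0 H] := path_continuous t0 tl e0.
pose s := t - Num.min (del / 2) t.
have m0 : 0 < Num.min (del / 2) t by rewrite lt_min t1 andbT divr_gt0.
have s0 : 0 <= s by rewrite subr_ge0 ge_min lexx orbT.
have st : s < t by rewrite ltrBlDr ltrDl.
have sl := alive_le (ltW st) tl.
have : `|s - t| < del.
  rewrite ltr0_norm ?subr_lt0// opprB.
  have : Num.min (del / 2) t <= del / 2 by rewrite ge_min lexx.
  by rewrite /s; move: del0; set m := Num.min _ _; lra.
move=> /(H s s0 sl); rewrite ltr_norml => /andP[H1 _].
have : coord X s w < z by apply: before_hitting => //; rewrite tE lte_fin.
lra.
Qed.

(** If [z] is not hit by time [t], the supremum is attained, hence stays strictly below [z].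
    Negative [t] is allowed since the clock is nonnegative only almost surely; the supremum is then
    over the empty set. *)
Lemma le_running_sup z w t : I z ->
  (z%:E <= running_sup X t w)%E <-> (hitting_time X z w <= t%:E)%E.
Proof.
move=> Iz; split; last first.
  move=> tt; have [|s [sE s0 sl zs]] := @hitting_time_attained z w.
    by rewrite (le_lt_trans tt)// ltry.
  apply: (@le_trans _ _ (coord X s w)%:E); first by rewrite lee_fin.
  by apply: ereal_sup_ubound; exists s => //; split=> //; rewrite -lee_fin -sE.
move=> zM; rewrite leNgt; apply/negP => ttau.
have H s : 0 <= s <= t -> (s%:E < life X w)%E -> coord X s w < z.
  move=> /andP[s0 st] sl; apply: before_hitting => //.
  by apply: le_lt_trans ttau; rewrite lee_fin.
have [t0|t0] := leP 0 t; last first.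
  move: zM; rewrite /running_sup (_ : [set s | _] = set0).
    by rewrite image_set0 ereal_sup0 leeNy_eq.
  by apply/seteqP; split=> // s [s0 st _]; move: (le_trans s0 st); rewrite leNgt t0.
have [s [st sl Hs]] := path_sup_attained Iz t0 H.
have : (running_sup X t w <= (coord X s w)%:E)%E.
  by apply: ge_ereal_sup => _ [u [u0 ut ul] <-]; rewrite lee_fin Hs// u0.
move=> /(le_trans zM); rewrite lee_fin leNgt H//.
Qed.

End paths.

(** Nonnegative rationals indexed by pairs of naturals, to express countable unions over times. *)
Definition ratio (R : realType) (i j : nat) : R := i%:R / j.+1%:R.

Lemma ratio_between (R : realType) (s del : R) : 0 <= s -> 0 < del ->
  exists i j : nat, s < ratio R i j < s + del.
Proof.
move=> s0 d0; pose j := Num.truncn del^-1.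
have jd : j.+1%:R^-1 < del.
  by rewrite -[ltRHS]invrK ltf_pV2 ?posrE ?invr_gt0// truncnS_gt.
have /andP[ti tS] := truncn_itv (mulr_ge0 s0 (ler0n R j.+1)).
exists (Num.truncn (s * j.+1%:R)).+1, j; rewrite /ratio; apply/andP; split.
  by rewrite ltr_pdivlMr ?ltr0n.
rewrite -natr1 mulrDl mul1r ler_ltD// ler_pdivrMr ?ltr0n//.
Qed.

(** * Events determined by countably many times *)

Section events.
Context (R : realType) (d : measure_display) (Om : measurableType d).
Context (a b : \bar R) (mu sigma : R -> R) (X : process R Om).
Hypothesis hX : regular_diffusion a b mu sigma X.
Notation I := (state_space a b).

(* By continuity, the event is determined by rational times and [t]. *)
Lemma hitting_time_event (G : set (set Om)) z t : sigma_algebra setT G -> I z -> 0 <= t ->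
  (forall s C, 0 <= s <= t -> measurable C -> G (in_at X s C)) ->
  G [set w | (hitting_time X z w <= t%:E)%E].
Proof.
move=> sG Iz t0 GX.
(* Half-lines that are open and start below [z]: a hit of [z] before [t] is still visible at nearby
   rational times. Conversely, a path that misses [z] has an attained maximum below [z], hence
   misses some [Bn n] altogether. *)
pose Bn (n : nat) := [set x : R | z - n.+1%:R^-1 < x].
have mBn n : measurable (Bn n).
  rewrite (_ : Bn n = `]z - n.+1%:R^-1, +oo[%classic); first exact: measurable_itv.
  by apply/seteqP; split=> y /=; rewrite in_itv/= andbT.
have q0 i j : 0 <= ratio R i j by rewrite divr_ge0.
have -> : [set w | (hitting_time X z w <= t%:E)%E] =
  \bigcap_n (in_at X t (Bn n) `|` \bigcup_i \bigcup_j
    (if ratio R i j <= t then in_at X (ratio R i j) (Bn n) else set0)).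
  apply/seteqP; split => w /=.
    move=> tt n _.
    have [|s [sE s0 sl zs]] := @hitting_time_attained _ _ _ _ _ _ _ _ hX z w.
      by rewrite (le_lt_trans tt)// ltry.
    have nn : 0 < n.+1%:R^-1 :> R by rewrite invr_gt0.
    move: tt; rewrite sE lee_fin le_eqVlt => /predU1P[st|st].
      left; rewrite -st; split=> //.
      by apply: (lt_le_trans _ zs); rewrite ltrBlDr ltrDl.
    right; have [del del0 H] := path_continuous hX s0 sl nn.
    have lt : 0 < t - s by rewrite subr_gt0.
    have [l sl' llife] : exists2 l, s < l & (l%:E <= life X w)%E.
      move: sl; case: (life X w) => [l| |] //.
        by rewrite lte_fin => sl; exists l.
      by exists (s + 1); rewrite ?ltrDl ?leey.
    have m0 : 0 < Num.min del (Num.min (t - s) (l - s)).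
      by rewrite !lt_min del0 lt/= subr_gt0.
    have [i [j /andP[qs]]] := ratio_between s0 m0.
    rewrite -ltrBlDl !lt_min => /and3P[q1 q2 q3].
    have qt : ratio R i j <= t by lra.
    have ql : ((ratio R i j)%:E < life X w)%E.
      by apply: lt_le_trans llife; rewrite lte_fin; lra.
    exists i => //; exists j => //; rewrite qt; split=> //.
    have : `|ratio R i j - s| < del by rewrite gtr0_norm ?subr_gt0.
    move=> /(H _ (q0 i j) ql); rewrite ltr_norml => /andP[H1 _].
    by move: H1; rewrite /Bn/=; set en := n.+1%:R^-1; lra.
  move=> H; rewrite leNgt; apply/negP => ttau.
  have Hlt s : 0 <= s <= t -> (s%:E < life X w)%E -> coord X s w < z.
    move=> /andP[s0 st] sl; apply: before_hitting => //.
    by apply: le_lt_trans ttau; rewrite lee_fin.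
  have [s [st sl Hs]] := path_sup_attained hX Iz t0 Hlt.
  have e0 : 0 < z - coord X s w by rewrite subr_gt0; exact: Hlt.
  pose n := Num.truncn (z - coord X s w)^-1.
  have ne : n.+1%:R^-1 < z - coord X s w.
    by rewrite -[ltRHS]invrK ltf_pV2 ?posrE ?invr_gt0// truncnS_gt.
  have key u : 0 <= u <= t -> (u%:E < life X w)%E -> ~ Bn n (coord X u w).
    by move=> ut ul; have := Hs u ut ul; move: ne; rewrite /Bn/=; set en := n.+1%:R^-1; lra.
  have [[tl Bt]|[i _ [j _]]] := H n Logic.I.
    by apply: (key t) => //; rewrite t0 lexx.
  case: ifP => // qt [ql Bq]; apply: (key (ratio R i j)) => //.
  by rewrite q0.
apply: sigma_algebra_bigcap => // n; apply: sigma_algebra_setU => //.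
  by apply: GX; rewrite ?t0 ?lexx.
apply: sigma_algebra_bigcup => // i; apply: sigma_algebra_bigcup => // j.
case: ifP => qt; last exact: sigma_algebra_set0.
by apply: GX => //; rewrite q0.
Qed.

Lemma hitting_time_stopping z : I z -> stopping_time X (hitting_time X z).
Proof.
move=> Iz; split=> [w|t t0]; first exact: hitting_time_ge0.
apply: hitting_time_event => //; first exact: (filt_sigma_algebra hX).
move=> s C /andP[s0 st] mC.
by apply: (filt_nondecreasing hX s0 st); exact: (coord_adapted hX).
Qed.

Lemma measurable_sigma_algebra : sigma_algebra setT (measurable : set (set Om)).
Proof.
split; first exact: measurable0.
- by move=> A mA; rewrite setTD; exact: measurableC.
- by move=> A mA; exact: bigcupT_measurable.
Qed.

(** Given a finite lifetime, the path converges to [a] or to [b], so the exit is at [a] exactly when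
    the path is eventually not above [x]. Rational times decide this. *)
Lemma exits_at_left_measurable x : I x -> measurable (exits_at X a).
Proof.
move=> Ix; have [ax xb] := Ix.
have q0 i j : 0 <= ratio R i j by rewrite divr_ge0.
pose B := [set y : R | x < y].
have mB : measurable B.
  rewrite (_ : B = `]x, +oo[%classic); first exact: measurable_itv.
  by apply/seteqP; split=> y /=; rewrite in_itv/= andbT.
have -> : exits_at X a = (\bigcup_n ~` in_at X n%:R setT) `&`
  \bigcup_i \bigcup_j (in_at X (ratio R i j) setT `&`
    \bigcap_k \bigcap_l (if ratio R i j <= ratio R k l then ~` in_at X (ratio R k
      l) B else setT)).
  apply/seteqP; split => w.
    move=> ex; have [lf _] := ex; have [lE l0] := life_fine hX lf; split.
      exists (Num.truncn (fine (life X w))).+1 => //= -[].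
      by rewrite lE lte_fin => /ltW; rewrite leNgt truncnS_gt.
    have [s0 [s00 s0l Hs]] := exits_at_lt hX ex ax.
    have ls : 0 < fine (life X w) - s0 by rewrite subr_gt0 -lte_fin -lE.
    have [i [j /andP[qs ql]]] := ratio_between s00 ls.
    exists i => //; exists j => //; split.
      by split=> //; rewrite lE lte_fin; lra.
    move=> k _ l _; case: ifP => // qq [pl /= xp].
    by have := Hs (ratio R k l) (le_trans (ltW qs) qq) pl; rewrite ltNge ltW.
  move=> [[n _ /= nl] [i _ [j _ [[ql _] H]]]].
  have lf : (life X w < +oo)%E.
    rewrite ltNge; apply/negP; rewrite leye_eq => /eqP ly; apply: nl.
    by split=> //; rewrite ly ltry.
  have [lE l0] := life_fine hX lf.
  have [//|ex] := no_interior_death hX lf.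
  have [s0 [s00 s0l Hs]] := exits_at_gt hX ex xb.
  pose m := Num.max s0 (ratio R i j).
  have m0 : 0 <= m by rewrite le_max s00.
  have ml : 0 < fine (life X w) - m.
    by rewrite subr_gt0 gt_max -!lte_fin -lE s0l.
  have [k [l /andP[mq qml]]] := ratio_between m0 ml.
  have pl : ((ratio R k l)%:E < life X w)%E by rewrite lE lte_fin; lra.
  exfalso; have := H k Logic.I l Logic.I.
  rewrite ifT; last by apply/ltW/(le_lt_trans _ mq); rewrite le_max lexx orbT.
  apply; split=> //; apply: Hs => //.
  by apply/ltW/(le_lt_trans _ mq); rewrite le_max lexx.
have mX := in_at_measurable hX.
apply: measurableI.
  by apply: bigcupT_measurable => n; apply: measurableC; exact: mX.
apply: bigcupT_measurable => i; apply: bigcupT_measurable => j.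
apply: measurableI; first exact: mX.
apply: bigcapT_measurable => k; apply: bigcapT_measurable => l.
by case: ifP => _ //; apply: measurableC; exact: mX.
Qed.

Lemma start_null x : I x -> exists N, [/\ measurable N, law X x N = 0%E &
  forall w, ~ N w -> coord X 0 w = x].
Proof.
move=> Ix; exists (~` [set w | coord X 0 w = x]).
have m0 : measurable [set w | coord X 0 w = x].
  rewrite (_ : [set w | _] = in_at X 0 [set x]).
    by apply: (in_at_measurable hX) => //; exact: measurable_set1.
  by apply/seteqP; split=> [w /= Xw|w []//]; split=> //; exact: (life_gt0 hX).
split; first exact: measurableC.
  rewrite probability_setC//. 
  by rewrite [X in (1 - X)%E](coord_start hX Ix) subee.
by move=> w /contrapT.
Qed.

End events.

(** * Optional sampling and Laplace transforms *)

Section limn_einf_bounds.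
Context (R : realType).
Implicit Types (u : nat -> \bar R) (l : R).
Local Open Scope ereal_scope.

Lemma natr_gt (x : R) : exists n0 : nat, forall n, (n0 <= n)%N -> (x < n%:R)%R.
Proof.
exists (Num.truncn x).+1 => n nn; apply: (lt_le_trans (truncnS_gt _)).
by rewrite ler_nat.
Qed.

Lemma invS_lt (e : R) : (0 < e)%R -> exists n0 : nat, forall n, (n0 <= n)%N ->
  (n.+1%:R^-1 < e)%R.
Proof.
move=> e0; have [n0 H] := natr_gt e^-1; exists n0 => n /leqW/H.
by move=> H'; rewrite -[ltRHS]invrK ltf_pV2 ?posrE ?invr_gt0// ltr0n.
Qed.

Lemma limn_einf_ge u l :
  (forall e, (0 < e)%R -> exists n0, forall n, (n0 <= n)%N -> (l - e)%:E <= u n) ->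
  l%:E <= limn_einf u.
Proof.
move=> H; apply/lee_addgt0Pr => e e0; have [n0 Hn] := H e e0.
rewrite limn_einf_lim -leeBlDr//; apply: lime_ge; first exact: is_cvg_einfs.
exists n0 => // n /= nn; apply: le_ereal_inf_tmp => _ [m /= nm <-].
by rewrite -EFinB; apply: Hn; exact: leq_trans nm.
Qed.

Lemma limn_einf_le u l : (forall n, u n <= (l + n.+1%:R^-1)%:E) -> limn_einf u <= l%:E.
Proof.
move=> H; apply/lee_addgt0Pr => e e0; have [n0 Hn] := invS_lt e0.
rewrite limn_einf_lim; apply: lime_le; first exact: is_cvg_einfs.
exists n0 => // n /= nn; apply: (@le_trans _ _ (u n)).
  by apply: ereal_inf_lbound; exists n => /=.
by apply: (le_trans (H n)); rewrite -EFinD lee_fin lerD2l ltW// Hn.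
Qed.

Lemma measurable_limn_einf d (T : measurableType d) (f : nat -> T -> \bar R) :
  (forall n, measurable_fun setT (f n)) ->
  measurable_fun setT (fun x => limn_einf (f^~ x)).
Proof.
move=> mf; rewrite /limn_einf; apply: measurableT_comp => //.
by apply: measurable_fun_limn_esup => n; exact: measurableT_comp.
Qed.

End limn_einf_bounds.

Section optional_sampling.
Context (R : realType) (d : measure_display) (Om : measurableType d).
Context (a b : \bar R) (mu sigma : R -> R) (r : R) (X : process R Om).
Context (psi : R -> R).
Hypothesis hr : 0 < r.
Hypothesis hX : regular_diffusion a b mu sigma X.
Hypothesis hpsi : increasing_solution a b mu sigma r X psi.
Notation I := (state_space a b).

(* [Z] is the discounted value of [psi] at the first grid time [t] that is past
   [tau] or at which the path is out of [[c, e]], or at [t = m] if that comes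
   first; the mesh is at most [1 / (m + 1)]. *)
Definition stopped_spec (c e : R) (tau : Om -> \bar R) (m : nat) (Z : Om -> R) (w : Om) :=
  exists t, [/\ 0 <= t, Z w <= expR (- r * t) * value_at X psi t w,
      (t%:E < life X w)%E -> c <= coord X t w <= e -> Z w = expR (- r * t) * psi
        (coord X t w),
      t = 0 \/ ((t - m.+1%:R^-1)%:E < tau w)%E &
      ~ [/\ t < m%:R, (t%:E < tau w)%E &
        forall s, 0 <= s <= t -> (s%:E < life X w)%E /\ c <= coord X s w <= e]].

Lemma discounted_psi_continuous w t e : 0 <= t -> (t%:E < life X w)%E -> 0 < e ->
  exists2 del, 0 < del & forall s, 0 <= s -> (s%:E < life X w)%E -> `|s - t| < del ->
    `|expR (- r * s) * psi (coord X s w) - expR (- r * t) * psi (coord X t w)| < e.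
Proof.
move=> t0 tl e0; pose L := [set s : R | 0 <= s /\ (s%:E < life X w)%E].
have Lt : L t by [].
have /subspace_continuousP/(_ t Lt) cX := @coord_continuous _ _ _ _ _ _ _ _ hX w.
have cpsi : {for (coord X t w), continuous psi}.
  have [dpsi _ _] := C2_on_jet (psi_C2 hpsi) (coord_in hX t0 tl).
  exact: is_derive_continuous dpsi.
have cE : expR (- r * s) @[s --> within L (nbhs t)] --> expR (- r * t).
  apply: cvg_within_filter.
  apply: (@continuous_comp _ _ _ (fun s : R => - r * s) expR); last exact: continuous_expR.
  by apply: continuousM => //; exact: cst_continuous.
have cP : psi (coord X s w) @[s --> within L (nbhs t)] --> psi (coord X t w).
  exact: cvg_comp cX cpsi.
have cEP : expR (- r * s) * psi (coord X s w) @[s --> within L (nbhs t)] -->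
  expR (- r * t) * psi (coord X t w) by exact: cvgM cE cP.
move: cEP => /cvgrPdist_lt/(_ _ e0); rewrite near_withinE => /nbhs_ballP[del /= del0 H].
exists del => // s s0 sl st; rewrite distrC; apply: H => //.
by rewrite /ball/= distrC.
Qed.

(** For large [m] the grid stops in [[t0, t0 + 1 / (m + 1))], and the discounted [psi] is continuous
    along the path. The margin [s0 > t0] ensures that this overshoot neither kills the path nor
    leaves the window [[c m, e m]]. *)
Lemma stopped_spec_cvg (c e : nat -> R) tau (Z : nat -> Om -> R) w t0 s0 m0 eps :
  (forall m, stopped_spec (c m) (e m) tau m (Z m) w) ->
  tau w = t0%:E -> 0 <= t0 -> t0 < s0 -> (s0%:E < life X w)%E ->
  (forall m s, (m0 <= m)%N -> 0 <= s <= s0 -> c m <= coord X s w <= e m) ->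
  0 < eps -> exists m1, forall m, (m1 <= m)%N ->
    `|Z m w - expR (- r * t0) * psi (coord X t0 w)| < eps.
Proof.
move=> HZ tauE t00 ts s0l Hin e0.
have t0l := alive_le (ltW ts) s0l.
have [del del0 Hdel] := discounted_psi_continuous t00 t0l e0.
have m_gt0 : 0 < Num.min del (s0 - t0) by rewrite lt_min del0 subr_gt0.
have [n1 Hn1] := invS_lt m_gt0; have [n2 Hn2] := natr_gt s0.
exists (maxn m0 (maxn n1 n2)) => m; rewrite !geq_max => /and3P[mm0 mn1 mn2].
have [t [tp _ ZE tlow tno]] := HZ m.
have := Hn1 m mn1; rewrite lt_min => /andP[hd hs]; have sm := Hn2 m mn2.
have tclose : t = 0 \/ t < t0 + m.+1%:R^-1.
  by case: tlow => [->|]; [left|rewrite tauE lte_fin ltrBlDr; right].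
have ts0 : t < s0.
  case: tclose => [->|tt]; first exact: le_lt_trans ts.
  by apply: (lt_trans tt); rewrite -ltrBrDl.
have tl := alive_le (ltW ts0) s0l.
have t0t : t0 <= t.
  rewrite leNgt; apply/negP => tt0; apply: tno; split.
  - exact: lt_trans sm.
  - by rewrite tauE lte_fin.
  - move=> s /andP[sp st]; split; first exact: alive_le tl.
    by apply: Hin => //; rewrite sp (le_trans st)// ltW.
rewrite ZE//; last by apply: Hin => //; rewrite tp ltW.
apply: Hdel => //; rewrite ger0_norm ?subr_ge0// ltrBlDl.
case: tclose => [->|tt]; first by rewrite ltr_wpDl.
by apply: (lt_trans tt); rewrite ltrD2l.
Qed.

(* The bound is through a measurable majorant, so that no measurability of the
   stopped payoff is needed. *)
Lemma discounted_psi_majorant (tau : Om -> \bar R) x : stopping_time X tau -> I x ->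
  exists L : Om -> \bar R, [/\ measurable_fun setT L, forall w, (0 <= L w)%E,
    (\int[law X x]_w L w <= (psi x)%:E)%E &
    forall w, ((discounted X r psi tau w)%:E <= L w)%E].
Proof.
move=> st Ix.
have [c [Ic cH]] := exhaust_left Ix; have [e [Ie eH]] := exhaust_right Ix.
(* Enlarged so that every window contains the starting point. *)
pose c1 m := Num.min (c m) x; pose e1 m := Num.max (e m) x.
have Ic1 m : I (c1 m) by rewrite /c1; case: leP.
have Ie1 m : I (e1 m) by rewrite /e1; case: leP.
have ex m : exists Z : Om -> R,
    [/\ measurable_fun setT Z, forall w, 0 <= Z w,
    (\int[law X x]_w (Z w)%:E <= (psi x + m.+1%:R^-1)%:E)%E &
    forall w, stopped_spec (c1 m) (e1 m) tau m Z w].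
  have [c' Ic' cc] := state_space_left (Ic1 m).
  have [e' Ie' ee] := state_space_right (Ie1 m).
  have cxe : c1 m <= x <= e1 m by rewrite ge_min lexx orbT le_max lexx orbT.
  have [Z [mZ Z0 EZ _ HZ]] := grid_approximation hr hX hpsi m st Ic' Ie' cc cxe ee.
  by exists Z; split => // w; have /andP[] := Z0 w.
have [Z HZ] := boolp.choice ex.
have Z0 m w : 0 <= Z m w by have [_ H _ _] := HZ m; exact: H.
(* This limit inferior is measurable whatever the stopped payoff is. It equals at least the payoff
   when [tau] precedes death; otherwise the payoff is 0 and nonnegativity is enough. *)
exists (fun w => limn_einf (fun m => (Z m w)%:E)); split.
- by apply: measurable_limn_einf => m; apply/measurable_EFinP; have [] := HZ m.
- move=> w; apply: limn_einf_ge => eps eps0; exists 0%N => m _.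
  by rewrite lee_fin (@le_trans _ _ 0)// subr_le0 ltW.
- apply: (@le_trans _ _ (limn_einf (fun m => \int[law X x]_w (Z m w)%:E)%E)).
    apply: fatou => //.
      by move=> m; apply/measurable_EFinP; have [] := HZ m.
    by move=> m w _; rewrite lee_fin.
  by apply: limn_einf_le => m; have [] := HZ m.
- move=> w; rewrite /discounted; case: ifPn => tl; last first.
    apply: limn_einf_ge => eps eps0; exists 0%N => m _.
    by rewrite lee_fin (@le_trans _ _ 0)// subr_le0 ltW.
  have tau0 := st.1 w.
  have tfin : tau w \is a fin_num.
    by rewrite ge0_fin_numE//; apply: (lt_le_trans tl); exact: leey.
  have tE : tau w = (fine (tau w))%:E by rewrite fineK.
  set t0 := fine _ in tE *.
  have t00 : 0 <= t0 by rewrite -lee_fin -tE.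
  have [s0 ts s0l] : exists2 s0, t0 < s0 & (s0%:E < life X w)%E.
    move: tl; rewrite tE; case: (life X w) => [l| |] //.
      rewrite lte_fin => tl; exists ((t0 + l) / 2); rewrite ?lte_fin; lra.
    by move=> _; exists (t0 + 1); rewrite ?ltry// ltrDl.
  have [cc [ee [Icc Iee Hce]]] := path_compact hX (le_trans t00 (ltW ts)) s0l.
  have [m1 Hm1] := cH _ Icc; have [m2 Hm2] := eH _ Iee.
  apply: limn_einf_ge => eps eps0.
  have [||m3 Hm3] := @stopped_spec_cvg c1 e1 tau Z w t0 s0 (maxn m1 m2) eps _ tE
    t00 ts s0l _ eps0.
  + by move=> m; have [_ _ _] := HZ m; apply.
  + move=> m s; rewrite geq_max => /andP[mm1 mm2] /Hce/andP[lo hi].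
    rewrite ge_min (le_trans (Hm1 m mm1) lo)/= le_max.
    by rewrite (le_trans hi (Hm2 m mm2)).
  exists m3 => m /Hm3; rewrite ltr_norml => /andP[H _].
  by rewrite lee_fin lerBlDr -lerBlDl ltW//; move: H; lra.
Qed.

End optional_sampling.

(** The case distinction matters: [fine] sends [+oo] to 0, which would give discount 1 to a time
    that never comes. *)
Definition exp_discount (R : realType) (r : R) (t : \bar R) : R :=
  if (t < +oo)%E then expR (- r * fine t) else 0.

(** * The Laplace transform of hitting times *)

Section laplace_transform.
Context (R : realType) (d : measure_display) (Om : measurableType d).
Context (a b : \bar R) (mu sigma : R -> R) (r : R) (X : process R Om).
Context (psi : R -> R).
Hypothesis hr : 0 < r.
Hypothesis hX : regular_diffusion a b mu sigma X.
Hypothesis hpsi : increasing_solution a b mu sigma r X psi.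
Notation I := (state_space a b).

Lemma stopping_time_measurable (tau : Om -> \bar R) : stopping_time X tau ->
  measurable_fun setT tau.
Proof.
move=> [tau0 ft]; apply: (measurability _ (ErealGenOInfty.measurableE R)) => _ [_
  [y ->] <-].
rewrite setTI (_ : _ @^-1` _ = ~` [set w | (tau w <= y%:E)%E]); last first.
  apply/seteqP; split=> w /=; rewrite in_itv/= andbT ltNge; first by move/negP.
  by move=> H; apply/negP.
apply: measurableC; have [y0|y0] := leP 0 y;
  first exact: filt_measurable hX _ y0 _ (ft _ y0).
rewrite (_ : [set _ | _] = set0); first exact: measurable0.
apply/seteqP; split=> // w /= H; have := le_trans (tau0 w) H.
by rewrite lee_fin leNgt y0.
Qed.

Lemma exp_discount_measurable : measurable_fun setT (@exp_discount R r).
Proof.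
apply: measurable_fun_ifT => //.
- apply: (measurable_fun_bool true); rewrite setTI.
  rewrite (_ : _ @^-1` _ = ~` [set +oo%E]).
    by apply: measurableC; exact: emeasurable_set1.
  apply/seteqP; split=> t /=; first by move=> + tE; rewrite tE ltxx.
  by move=> ty; rewrite lt_neqAle leey andbT; exact/eqP.
- apply: measurableT_comp; first exact: measurable_expR.
  apply: measurable_funM; first exact: measurable_cst.
  exact: fine_measurable.
Qed.

Lemma exp_discount_itv t : (0 <= t)%E -> 0 <= exp_discount r t <= 1.
Proof.
rewrite /exp_discount => t0; case: ifPn => ty; last by rewrite lexx ler01.
rewrite expR_ge0/= -[leRHS](@expR0 R) ler_expR mulNr lerNl oppr0 mulr_ge0 ?(ltW hr)//.
by rewrite fine_ge0.
Qed.

Lemma discounted_path_small w z eps : I z -> 0 < eps ->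
  (exits_at X a w -> psi (fine y) @[y --> from_right a] --> (0 : R)) ->
  (forall s, 0 <= s -> (s%:E < life X w)%E -> coord X s w < z) ->
  exists s0, [/\ 0 <= s0, (s0%:E < life X w)%E &
    forall s, s0 <= s -> (s%:E < life X w)%E -> expR (- r * s) * psi (coord X s w) <= eps].
Proof.
move=> Iz eps0 exa H; have pz := psi_gt0 hpsi Iz.
have Ecs s : 0 <= s -> expR (- r * s) <= 1.
  by move=> s0; rewrite -[leRHS](@expR0 R) ler_expR mulNr lerNl oppr0 mulr_ge0// ltW.
have [lf|] := ltP (life X w) +oo%E; last first.
  (* Since [psi] is at most [psi z] along the path, it suffices that [psi z <= eps * exp(r s)]; the
     witness comes from [exp(r s) >= 1 + r s]. *)
  rewrite leye_eq => /eqP ly; exists (psi z / (eps * r)); split.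
  - by rewrite divr_ge0 ?ltW// mulr_gt0.
  - by rewrite ly ltry.
  - move=> s ss sl.
    have s0 : 0 <= s by apply: le_trans ss; rewrite divr_ge0 ?ltW// mulr_gt0.
    apply: (@le_trans _ _ (expR (- r * s) * psi z)).
      rewrite ler_wpM2l ?expR_ge0//; apply: (psi_nd hpsi) => //; first exact: (coord_in hX).
      exact/ltW/H.
    rewrite mulNr expRN mulrC ler_pdivrMr ?expR_gt0//.
    apply: (@le_trans _ _ (eps * (1 + r * s))); last first.
      by rewrite ler_pM2l//; exact: expR_ge1Dx.
    rewrite mulrDr mulr1 mulrA; apply: ler_wpDl; first exact: ltW.
    by rewrite mulrC -ler_pdivrMr// mulr_gt0.
have exw : exits_at X a w.
  by apply: (exits_at_left hX Iz lf) => s s0 sl; exact/ltW/H.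
have := exa exw => /cvgrPdist_lt/(_ _ eps0); rewrite /from_right near_withinE => nB.
have [s0 [s00 s0l Hs]] := exits_at_near hX exw nB.
exists s0; split=> // s ss sl; have sp := le_trans s00 ss.
have [aX _] := coord_in hX sp sl.
have := Hs s ss sl aX; rewrite /= sub0r normrN => /ltW Hp.
have pX := psi_gt0 hpsi (coord_in hX sp sl).
rewrite ger0_norm in Hp; last exact: ltW.
by apply: (le_trans _ Hp); rewrite ler_piMl ?Ecs// ltW.
Qed.

(** If [a] is attainable the limit of [psi] is the boundary condition; if not, exits at [a] form a
    null set, which serves as [N]. *)
Lemma boundary_null x : I x -> exists N, [/\ measurable N, law X x N = 0%E &
  forall w, ~ N w -> exits_at X a w -> psi (fine y) @[y --> from_right a] --> (0 : R)].
Proof.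
move=> Ix; have [att|natt] := pselect (attainable a b X a).
  by exists set0; split => // w _ _; exact: (psi_boundary hpsi).
exists (exits_at X a); split => //; first exact: (exits_at_left_measurable hX Ix).
apply/eqP; rewrite eq_le measure_ge0 andbT leNgt; apply/negP => P0.
by apply: natt; exists x.
Qed.

Lemma laplace_hitting_time x z : I x -> I z -> x <= z ->
  (\int[law X x]_w (exp_discount r (hitting_time X z w))%:E = (psi x / psi z)%:E)%E.
Proof.
move=> Ix Iz xz; have pz := psi_gt0 hpsi Iz; have px := psi_gt0 hpsi Ix.
pose D w := exp_discount r (hitting_time X z w).
have st := hitting_time_stopping hX Iz.
have mD : measurable_fun setT (fun w => (D w)%:E).
  apply/measurable_EFinP; apply: measurableT_comp; first exact: exp_discount_measurable.
  exact: stopping_time_measurable.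
have D01 w : 0 <= D w <= 1 by apply: exp_discount_itv; exact: hitting_time_ge0.
have D0 w : (0 <= (D w)%:E)%E by rewrite lee_fin; have /andP[] := D01 w.
have [N0 [mN0 PN0 HN0]] := start_null hX Ix.
suff : (\int[law X x]_w ((psi z)%:E * (D w)%:E) = (psi x)%:E)%E.
  rewrite ge0_integralZl_EFin//; last exact: ltW.
  have : (\int[law X x]_w (D w)%:E)%E \is a fin_num.
    have /andP[lo hi] := integral_bounded_between (law X x) D01.
    by rewrite fin_numElt (lt_le_trans _ lo) ?ltNyr// (le_lt_trans hi)// ltry.
  rewrite /D; case: (\int[_]_w _)%E => [v| |] // _; rewrite -EFinM => -[<-].
  by rewrite mulrAC divff ?mul1r// gt_eqF.
apply/eqP; rewrite eq_le; apply/andP; split.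
  have [L [mL L0 EL HL]] := discounted_psi_majorant hr hX hpsi st Ix.
  apply: le_trans EL.
  rewrite (@eq_integral_off_null _ _ _ _ _ _ _ (fun w => (discounted X r psi
    (hitting_time X z) w)%:E) mN0 PN0).
    by apply: le_integral_nonmeasurable => w _; exact: HL.
  move=> w _ /HN0 X0; rewrite -EFinM /discounted /D /exp_discount.
  have [tf|tf] := ltP (hitting_time X z w) +oo%E; last first.
    by rewrite ltNge (le_trans (leey _) tf)/= mulr0.
  have [t [tE t0 tl zt]] := hitting_time_attained hX tf.
  by rewrite tE tl/= (coord_hitting hX _ t0 tE tl zt) ?X0// mulrC.
have [N1 [mN1 PN1 HN1]] := boundary_null Ix.
pose N := N0 `|` N1.
have mN : measurable N by exact: measurableU.
have PN : law X x N = 0%E by rewrite -PN0; exact: measureU0.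
have [c [Ic cH]] := exhaust_left Ix.
pose c1 m := Num.min (c m) x.
have Ic1 m : I (c1 m) by rewrite /c1; case: leP.
have [e Ie ze] := state_space_right Iz.
have [e' Ie' ee] := state_space_right Ie.
(* Bounds all stopped values at once, whatever the lower ends [c1 m], so that [C - Z m] is
   nonnegative. *)
pose C := psi e'.
have C0 : 0 < C := psi_gt0 hpsi Ie'.
have ex m : exists Z : Om -> R,
    [/\ measurable_fun setT Z, forall w, 0 <= Z w <= C,
    ((psi x)%:E <= \int[law X x]_w (Z w)%:E + (m.+1%:R^-1)%:E)%E &
    forall w, stopped_spec r X psi (c1 m) e (hitting_time X z) m Z w].
  have [c' Ic' cc] := state_space_left (Ic1 m).
  have cxe : c1 m <= x <= e by rewrite ge_min lexx orbT/= (le_trans xz)// ltW.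
  have [Z [mZ Z0 _ EZ HZ]] := grid_approximation hr hX hpsi m st Ic' Ie' cc cxe ee.
  by exists Z; split.
have [Z HZ] := boolp.choice ex.
have ZC m w : 0 <= Z m w <= C by have [_ H _ _] := HZ m; exact: H.
have mZ m : measurable_fun setT (Z m) by have [] := HZ m.
have Zspec m w : stopped_spec r X psi (c1 m) e (hitting_time X z) m (Z m) w.
  by have [_ _ _ H] := HZ m; exact: H.
pose V m w := C - Z m w.
have mV m : measurable_fun setT (fun w => (V m w)%:E).
  by apply/measurable_EFinP; exact: measurable_funB.
have V0 m w : 0 <= V m w by rewrite subr_ge0; have /andP[] := ZC m w.
pose U w := limn_einf (fun m => (V m w)%:E).
have U0 w : (0 <= U w)%E.
  apply: limn_einf_ge => eps eps0; exists 0%N => m _.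
  by rewrite lee_fin (@le_trans _ _ 0)// subr_le0 ltW.
have mU : measurable_fun setT U by exact: measurable_limn_einf.
have EU : (\int[law X x]_w U w <= (C - psi x)%:E)%E.
  apply: (@le_trans _ _ (limn_einf (fun m => \int[law X x]_w (V m w)%:E)%E)).
    by apply: fatou => // m w _; rewrite lee_fin.
  apply: limn_einf_le => m; have [_ _ EZ _] := HZ m.
  have sumE : (\int[law X x]_w (V m w)%:E + \int[law X x]_w (Z m w)%:E = C%:E)%E.
    rewrite -ge0_integralD//.
    + rewrite -[RHS](integral_cst_probability (law X x)); apply: eq_integral => w _.
      by rewrite -EFinD subrK.
    + by move=> w _; rewrite lee_fin.
    + by move=> w _; rewrite lee_fin; have /andP[] := ZC m w.
    + exact/measurable_EFinP.
  have /andP[z0 z1] := integral_bounded_between (law X x) (ZC m).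
  move: EZ sumE z0 z1; case: (\int[_]_w (Z m w)%:E)%E => [v| |] //.
  case: (\int[_]_w (V m w)%:E)%E => [v'| |] //.
  by rewrite -!EFinD !lee_fin => EZ [vv] _ _; move: EZ vv; set em := m.+1%:R^-1; lra.
(* The term with [\1_N] makes the inequality hold on every path, so it can be integrated directly;
   it has integral 0. *)
have key w : (C%:E <= U w + (psi z)%:E * (D w)%:E + C%:E * (\1_N w)%:E)%E.
  have [Nw|Nw] := pselect (N w).
    rewrite indicE mem_set// mule1 leeDr// adde_ge0// mule_ge0//.
    by rewrite lee_fin ltW.
  rewrite indicE memNset// mule0 adde0.
  have [N0w N1w] : ~ N0 w /\ ~ N1 w by split=> H; apply: Nw; [left|right].
  have X0 := HN0 w N0w.
  suff : ((C - psi z * D w)%:E <= U w)%E.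
    by rewrite -EFinM -leeBlDr// -EFinB.
  have [tf|] := ltP (hitting_time X z w) +oo%E.
    have [t0 [tE t00 t0l zt]] := hitting_time_attained hX tf.
    have X0z : coord X 0 w <= z by rewrite X0.
    have Xz : coord X t0 w = z := coord_hitting hX X0z t00 tE t0l zt.
    have ez : 0 < e - z by rewrite subr_gt0.
    have [del del0 Hdel] := path_continuous hX t00 t0l ez.
    (* Shortly after hitting [z] the path is still alive and, by the choice of [del], still below
       [e]: this is the margin for the overshoot of the grid. *)
    have [s0 [ts sd s0l]] : exists s0, [/\ t0 < s0, s0 < t0 + del & (s0%:E < life X w)%E].
      move: t0l; case: (life X w) => [l| |] //.
        rewrite lte_fin => tl; exists (t0 + Num.min (del / 2) ((l - t0) / 2)).
        have m0 : 0 < Num.min (del / 2) ((l - t0) / 2).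
          by rewrite lt_min !divr_gt0// subr_gt0.
        have m1 : Num.min (del / 2) ((l - t0) / 2) <= del / 2 by rewrite ge_min lexx.
        have m2 : Num.min (del / 2) ((l - t0) / 2) <= (l - t0) / 2 by rewrite
          ge_min lexx orbT.
        by move: m0 m1 m2; set mm := Num.min _ _ => m0 m1 m2; rewrite lte_fin; split; lra.
      by move=> _; exists (t0 + del / 2); rewrite ltry; split=> //; lra.
    have [cc [eeb [Icc _ Hce]]] := path_compact hX (le_trans t00 (ltW ts)) s0l.
    have [m0 Hm0] := cH _ Icc.
    apply: limn_einf_ge => eps eps0.
    have [||m1 Hm1] := @stopped_spec_cvg _ _ _ _ _ _ _ _ _ psi hX hpsi c1 (fun=> e)
      (hitting_time X z) Z w t0 s0 m0 eps _ tE t00 ts s0l _ eps0.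
    - by move=> m; exact: Zspec.
    - move=> m s mm0 /[dup] ss0 /Hce/andP[lo _].
      rewrite ge_min (le_trans (Hm0 m mm0) lo)/=.
      have /andP[s_ge0 ss] := ss0.
      have sl := alive_le ss s0l.
      have [st0|t0s] := ltP s t0.
        apply/ltW/(lt_trans _ ze); apply: before_hitting => //.
        by rewrite tE lte_fin.
      have : `|s - t0| < del by rewrite ger0_norm ?subr_ge0//; lra.
      by move=> /(Hdel s s_ge0 sl); rewrite ltr_norml Xz => /andP[_];
        rewrite ltrD2r => /ltW.
    exists m1 => m /Hm1; rewrite Xz lee_fin /V /D tE /exp_discount ltry/= ltr_norml
      => /andP[_].
    by lra.
  rewrite leye_eq => /eqP ty.
  have DE : D w = 0 by rewrite /D ty /exp_discount ltxx.
  rewrite DE mulr0 subr0.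
  have Hz s : 0 <= s -> (s%:E < life X w)%E -> coord X s w < z.
    by move=> s0 sl; apply: before_hitting => //; rewrite ty ltry.
  apply: limn_einf_ge => eps eps0.
  (* The path never reaches [z]. For large [m] the grid stops after [s0], where the discounted [psi]
     is at most [eps], or after death, where it is 0. *)
  have [s0 [s00 s0l Hs]] := discounted_path_small Iz eps0 (HN1 w N1w) Hz.
  have [cc [eeb [Icc _ Hce]]] := path_compact hX s00 s0l.
  have [m0 Hm0] := cH _ Icc; have [m1 Hm1] := natr_gt s0.
  exists (maxn m0 m1) => m; rewrite geq_max => /andP[mm0 mm1].
  rewrite lee_fin lerD2l lerN2.
  have [t [t0 Zle _ _ tno]] := Zspec m w.
  have s0t : s0 <= t.
    rewrite leNgt; apply/negP => ts; apply: tno; split.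
    - exact: lt_trans (Hm1 m mm1).
    - by rewrite ty ltry.
    - move=> s /andP[sp s_t]; have sl := alive_le (ltW (le_lt_trans s_t ts)) s0l.
      split=> //; have /andP[lo _] : cc <= coord X s w <= eeb.
        by apply: Hce; rewrite sp (le_trans s_t)// ltW.
      by rewrite ge_min (le_trans (Hm0 m mm0) lo)/= ltW// (lt_trans (Hz s sp sl)).
  apply: (le_trans Zle); rewrite /value_at; case: ifPn => tl; first exact: Hs.
  by rewrite mulr0 ltW.
have : (C%:E <= (C - psi x)%:E + \int[law X x]_w ((psi z)%:E * (D w)%:E))%E.
  rewrite -[leLHS](integral_cst_probability (law X x)).
  apply: (@le_trans _ _ (\int[law X x]_w (U w + (psi z)%:E * (D w)%:E + C%:E *
    (\1_N w)%:E))%E).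
    by apply: le_integral_nonmeasurable => w _; exact: key.
  have mpD : measurable_fun setT (fun w => (psi z)%:E * (D w)%:E)%E by exact:
    measurable_funeM.
  have pD0 w : (0 <= (psi z)%:E * (D w)%:E)%E by rewrite mule_ge0// lee_fin ltW.
  have mI : measurable_fun setT (fun w => (\1_N w)%:E : \bar R).
    by apply/measurable_EFinP; exact: measurable_indic.
  rewrite ge0_integralD//; first last.
  - exact: measurable_funeM.
  - by move=> w _; rewrite mule_ge0// lee_fin ?ltW.
  - exact: emeasurable_funD.
  - by move=> w _; rewrite adde_ge0.
  rewrite ge0_integralD//.
  rewrite [X in (_ + X)%E](_ : _ = 0)%E ?adde0; first exact: leeD2r.
  rewrite ge0_integralZl_EFin//; last exact: ltW.
  by rewrite integral_indic// setIT [X in (_ * X)%E]PN mule0.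
case: (\int[_]_w _)%E => [v||].
- rewrite -EFinD !lee_fin; lra.
- by move=> _; rewrite leey.
- by rewrite addeNy.
Qed.

End laplace_transform.

(** * The exponential clock *)

Section clock.
Context (R : realType) (d : measure_display) (Om : measurableType d).
Context (a b : \bar R) (mu sigma : R -> R) (r : R) (X : process R Om).
Context (T : {mfun Om >-> R}).
Hypothesis hr : 0 < r.
Hypothesis hX : regular_diffusion a b mu sigma X.
Hypothesis hT : exponential_clock a b r X T.
Notation I := (state_space a b).

Lemma clock_preimage_measurable (B : set R) : measurable B -> measurable (T @^-1` B).
Proof. by move=> mB; rewrite -[_ @^-1` _]setTI; exact: measurable_funP. Qed.

Lemma clock_lt0 x : I x -> law X x (T @^-1` `]-oo, 0[) = 0%E.
Proof.
move=> Ix; have := clock_law hT Ix (measurable_itv `]-oo, 0[).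
rewrite /distribution /pushforward => ->; rewrite /exponential_prob integral0_eq// => y /=.
by rewrite in_itv/= => y0; rewrite lt0_exponential_pdf.
Qed.

Lemma clock_ge x t : I x -> 0 <= t -> law X x (T @^-1` `[t, +oo[) = (expR (- r * t))%:E.
Proof.
move=> Ix t0.
have m0 := clock_preimage_measurable (measurable_itv `]-oo, 0[).
have [->|tn0] := eqVneq t 0.
  rewrite mulr0 expR0 (_ : _ @^-1` _ = ~` (T @^-1` `]-oo, 0[)); last first.
    apply/seteqP; split=> w /=; rewrite !in_itv/= andbT leNgt; first by move/negP.
    by move=> H; apply/negP.
  by rewrite probability_setC// [X in (_ - X)%E](clock_lt0 Ix) sube0.
have {tn0}t0 : 0 < t by rewrite lt_neqAle eq_sym tn0.
have m1 := clock_preimage_measurable (measurable_itv `[0, t[).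
have P1 : law X x (T @^-1` `[0, t[) = (1 - (expR (- r * t))%:E)%E.
  rewrite -(exponential_prob_itv0c r t0).
  have := clock_law hT Ix (measurable_itv `[0, t[).
  rewrite /distribution /pushforward => ->.
  by rewrite /exponential_prob integral_itv_bndo_bndc//;
    apply/measurable_EFinP; apply: measurable_funTS; exact: measurable_exponential_pdf.
rewrite (_ : _ @^-1` _ = ~` (T @^-1` `]-oo, 0[ `|` T @^-1` `[0, t[)); last first.
  apply/seteqP; split=> w /=; rewrite !in_itv/= andbT.
    by move=> tT [|/andP[_]]; rewrite ltNge ?(le_trans (ltW t0) tT)// tT.
  move=> H; rewrite leNgt; apply/negP => Tt; apply: H.
  by case: ltP => T0; [left|right].
rewrite probability_setC; last exact: measurableU.
rewrite measureU//; last first.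
  apply/seteqP; split=> // w [] /=; rewrite !in_itv/= => T0 /andP[T1 _].
  by move: T0; rewrite ltNge T1.
rewrite [X in (_ - (X + _))%E](clock_lt0 Ix) add0e [X in (_ - X)%E]P1.
by rewrite -!EFinB subKr.
Qed.

(* On [k h < tau <= (k + 1) h], which is independent of the clock, both sides
   lie between [exp (- r (k + 1) h)] and [exp (- r k h)] times its probability. *)
Lemma clock_after x tau : I x -> (forall w, (0 <= tau w)%E) ->
  (forall t, 0 <= t -> (<<s [set E | exists t C,
     [/\ 0 <= t, measurable C & E = in_at X t C]] >>) [set w | (tau w <= t%:E)%E]) ->
  measurable_fun setT tau ->
  law X x [set w | (tau w <= (T w)%:E)%E] = (\int[law X x]_w (exp_discount r (tau w))%:E)%E.
Proof.
move=> Ix tau0 Gtau mtau; set G := <<s _ >> in Gtau.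
have sG : sigma_algebra setT G by exact: smallest_sigma_algebra.
have GmS : G `<=` measurable.
  apply: smallest_sub; first exact: measurable_sigma_algebra.
  by move=> _ [t [C [t0 mC ->]]]; exact: (in_at_measurable hX).
pose H := [set w | (tau w <= (T w)%:E)%E].
have mH : measurable H.
  have mT : measurable_fun setT (EFin \o T) by exact/measurable_EFinP.
  rewrite -[H]setTI; exact: (emeasurable_fun_le measurableT mtau mT).
pose D w := exp_discount r (tau w).
have mD : measurable_fun setT (fun w => (D w)%:E).
  by apply/measurable_EFinP; apply: measurableT_comp mtau; exact: exp_discount_measurable.
have D01 w : 0 <= D w <= 1 by exact: exp_discount_itv.
have D0 w : (0 <= (D w)%:E)%E by rewrite lee_fin; have /andP[] := D01 w.
have DE s w : (s%:E <= tau w)%E -> D w <= expR (- r * s).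
  rewrite /D /exp_discount => st; case: ifPn => ty; last exact: expR_ge0.
  rewrite ler_expR ler_nM2l ?oppr_lt0// -lee_fin fineK//.
  by rewrite ge0_fin_numE.
have DE' t w : (tau w <= t%:E)%E -> expR (- r * t) <= D w.
  move=> tt; have ty : (tau w < +oo)%E by rewrite (le_lt_trans tt)// ltry.
  rewrite /D /exp_discount ty ler_expR ler_nM2l ?oppr_lt0// -lee_fin fineK//.
  by rewrite ge0_fin_numE.
(* The error is proportional to the probability of [C]. It is therefore additive over disjoint
   cells, and refining the grid does not accumulate it. *)
pose Rel (eps : R) C := [/\ measurable C,
  (law X x (C `&` H) <= \int[law X x]_(w in C) (D w)%:E + eps%:E * law X x C)%E &
  (\int[law X x]_(w in C) (D w)%:E <= law X x (C `&` H) + eps%:E * law X x C)%E].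
have indep C B : G C -> measurable B ->
    law X x (C `&` T @^-1` B) = (law X x C * law X x (T @^-1` B))%E.
  by move=> GC mB; exact: (clock_independent hT Ix GC mB).
have cell s t C : G C -> 0 <= s -> s <= t ->
    (forall w, C w -> (s%:E <= tau w <= t%:E)%E) -> Rel (r * (t - s)) C.
  move=> GC s0 st Cst; have mC := GmS _ GC; have t0 := le_trans s0 st.
  have ms := clock_preimage_measurable (measurable_itv `[s, +oo[).
  have mt := clock_preimage_measurable (measurable_itv `[t, +oo[).
  have up : (law X x (C `&` H) <= law X x C * (expR (- r * s))%:E)%E.
    rewrite -(clock_ge Ix s0) -indep//; apply: le_measure; rewrite ?inE//;
      try exact: measurableI.
    move=> w [Cw Hw]; split=> //=; rewrite in_itv/= andbT -lee_fin.
    by have /andP[sw _] := Cst w Cw; exact: le_trans Hw.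
  have lo : (law X x C * (expR (- r * t))%:E <= law X x (C `&` H))%E.
    rewrite -(clock_ge Ix t0) -indep//; apply: le_measure; rewrite ?inE//;
      try exact: measurableI.
    move=> w [Cw /=]; rewrite in_itv/= andbT -lee_fin => tw; split=> //.
    by have /andP[_ wt] := Cst w Cw; exact: le_trans tw.
  have Dup : (\int[law X x]_(w in C) (D w)%:E <= law X x C * (expR (- r * s))%:E)%E.
    rewrite muleC -integral_cst//; apply: ge0_le_integral_nonmeasurable => w Cw //.
    by rewrite lee_fin DE//; have /andP[] := Cst w Cw.
  have Dlo : (law X x C * (expR (- r * t))%:E <= \int[law X x]_(w in C) (D w)%:E)%E.
    rewrite muleC -integral_cst//; apply: ge0_le_integral_nonmeasurable => w Cw.
      by rewrite lee_fin expR_ge0.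
    by rewrite lee_fin DE'//; have /andP[] := Cst w Cw.
  have close : (law X x C * (expR (- r * s))%:E <=
      law X x C * (expR (- r * t))%:E + (r * (t - s))%:E * law X x C)%E.
    rewrite [leRHS]addeC [X in (X + _)%E]muleC -ge0_muleDr ?lee_fin ?expR_ge0//; last first.
      by rewrite mulr_ge0 ?subr_ge0// ltW.
    apply: lee_wpmul2l => //; rewrite -EFinD lee_fin.
    have -> : expR (- r * t) = expR (- r * s) * expR (- (r * (t - s))).
      by rewrite -expRD; congr expR; ring.
    have e1 := expR_ge1Dx (- (r * (t - s))).
    have e2 : expR (- r * s) * (1 + - (r * (t - s))) <= expR (- r * s) * expR (- (r
      * (t - s))).
      by rewrite ler_wpM2l ?expR_ge0.
    have e3 : expR (- r * s) <= 1.
      by rewrite -[leRHS](@expR0 R) ler_expR mulNr lerNl oppr0 mulr_ge0// ltW.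
    have e4 : expR (- r * s) * (r * (t - s)) <= r * (t - s).
      by rewrite ler_piMl// mulr_ge0 ?subr_ge0// ltW.
    by rewrite mulrDr mulr1 mulrN in e2; lra.
  split=> //.
  - by apply: (le_trans up); apply: (le_trans close); exact: leeD2r.
  - by apply: (le_trans Dup); apply: (le_trans close); exact: leeD2r.
have RelU eps A C : Rel eps A -> Rel eps C -> [disjoint A & C] -> Rel eps (A `|` C).
  move=> [mA A1 A2] [mC C1 C2] dAC.
  have AC0 : A `&` C = set0 by apply/eqP; rewrite -disj_set2E.
  have mAH : measurable (A `&` H) by exact: measurableI.
  have mCH : measurable (C `&` H) by exact: measurableI.
  have pH : law X x ((A `|` C) `&` H) = (law X x (A `&` H) + law X x (C `&` H))%E.
    rewrite setIUl; apply: measureU => //.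
    by rewrite setIACA AC0 set0I.
  have p : law X x (A `|` C) = (law X x A + law X x C)%E by exact: measureU.
  have iD : (\int[law X x]_(w in A `|` C) (D w)%:E =
      \int[law X x]_(w in A) (D w)%:E + \int[law X x]_(w in C) (D w)%:E)%E.
    by rewrite ge0_integral_setU//; exact: measurable_funTS.
  have eD : (eps%:E * (law X x A + law X x C) = eps%:E * law X x A + eps%:E * law X x C)%E.
    by rewrite ge0_muleDr.
  split; first exact: measurableU.
  - by rewrite pH iD [X in (_ * X)%E]p eD [leRHS]addeACA; exact: leeD.
  - by rewrite pH iD [X in (_ * X)%E]p eD [leRHS]addeACA; exact: leeD.
pose F (s : R) := [set w | (tau w <= s%:E)%E].
have RelF h k : 0 <= h -> Rel (r * h) (F (k%:R * h)).
  move=> h0; elim: k => [|k IH].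
    (* Cells are closed intervals of times, so [tau = 0] is the degenerate cell with [s = t = 0] and
       no error. *)
    have [] := @cell 0 0 (F 0) (Gtau 0 (lexx _)) (lexx _) (lexx _).
      by move=> w Fw; rewrite tau0.
    rewrite subrr mulr0 mul0e !adde0 mul0r => m0 A1 A2.
    have rp : (0 <= (r * h)%:E * law X x (F 0%R))%E by rewrite mule_ge0// lee_fin
      mulr_ge0// ltW.
    by split=> //; [apply: (le_trans A1)|apply: (le_trans A2)]; rewrite leeDl.
  have k0 n : 0 <= n%:R * h by rewrite mulr_ge0.
  have FS : F (k.+1%:R * h) = F (k%:R * h) `|` (F (k.+1%:R * h) `&` ~` F (k%:R * h)).
    apply/seteqP; split=> w.
      by move=> Fw; have [?|?] := pselect (F (k%:R * h) w); [left|right].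
    move=> [Fw|[]//]; apply: (le_trans Fw).
    by rewrite lee_fin ler_wpM2r// ler_nat.
  rewrite FS; apply: RelU => //.
    have := @cell (k%:R * h) (k.+1%:R * h) (F (k.+1%:R * h) `&` ~` F (k%:R * h)).
    have -> : k.+1%:R * h - k%:R * h = h by rewrite -natr1 mulrDl mul1r addrAC subrr add0r.
    apply => //.
    - apply: (sigma_algebra_setI sG) => //; first exact: Gtau.
      by apply: (sigma_algebra_setC sG) => //; exact: Gtau.
    - by rewrite ler_wpM2r// ler_nat.
    - move=> w [Fw /negP]; rewrite -ltNge => /ltW ->; exact: Fw.
  by apply/eqP; rewrite setICA setICr setI0.
have mF s : 0 <= s -> measurable (F s) by move=> s0; apply: GmS; exact: Gtau.
have tail s : 0 <= s -> (law X x (~` F s `&` H) <= (expR (- r * s))%:E)%E /\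
    (\int[law X x]_(w in ~` F s) (D w)%:E <= (expR (- r * s))%:E)%E.
  move=> s0; have mC : measurable (~` F s) by apply: measurableC; exact: mF.
  have Fs w : (~` F s) w -> (s%:E <= tau w)%E.
    by move=> /negP; rewrite -ltNge => /ltW.
  split.
    rewrite -(clock_ge Ix s0); apply: le_measure; rewrite ?inE//; try exact: measurableI.
      exact: (clock_preimage_measurable (measurable_itv `[s, +oo[)).
    move=> w [/Fs sw Hw] /=; rewrite in_itv/= andbT -lee_fin; exact: le_trans Hw.
  apply: (@le_trans _ _ (\int[law X x]_(w in ~` F s) (expR (- r * s))%:E)%E).
    apply: ge0_le_integral_nonmeasurable => w Fw //.
    by rewrite lee_fin DE// Fs.
  rewrite integral_cst// -[leRHS]mule1 lee_wpmul2l ?lee_fin ?expR_ge0//.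
  exact: probability_le1.
have splitH s : 0 <= s -> law X x H = (law X x (F s `&` H) + law X x (~` F s `&` H))%E.
  move=> s0; have mFs := mF s s0; rewrite -measureU.
  - by rewrite -setIUl setUv setTI.
  - exact: measurableI.
  - by apply: measurableI => //; exact: measurableC.
  - by rewrite setIACA setICr set0I.
have splitD s : 0 <= s -> (\int[law X x]_w (D w)%:E = \int[law X x]_(w in F s) (D w)%:E +
    \int[law X x]_(w in ~` F s) (D w)%:E)%E.
  move=> s0; have mFs := mF s s0; have mC := measurableC mFs.
  rewrite -ge0_integral_setU//; [by rewrite setUv|by rewrite setUv|exact/disj_setPCl].
have bound e : 0 < e -> (law X x H <= \int[law X x]_w (D w)%:E + e%:E)%E /\
    (\int[law X x]_w (D w)%:E <= law X x H + e%:E)%E.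
  (* Half of [e] goes to the cells, whose relative error is [r h]. The other half goes to the tail
     beyond [k h], where [exp(r k h) >= 1 + r k h > 2 / e]. *)
  move=> e0; pose h := e / (2 * r).
  have h0 : 0 < h by rewrite divr_gt0// mulr_gt0.
  have rh : r * h = e / 2 by rewrite /h; field; rewrite gt_eqF.
  have [k Hk] := natr_gt (2 / e / (r * h)).
  have kh : 2 / e < r * (k%:R * h).
    by rewrite mulrCA -(ltr_pdivrMr _ _ (mulr_gt0 hr h0)); exact: Hk.
  have Ek : expR (- r * (k%:R * h)) <= e / 2.
    rewrite mulNr expRN -[leRHS]invrK lef_pV2 ?posrE ?expR_gt0 ?invr_gt0
      ?divr_gt0// invf_div.
    by apply: (le_trans (ltW kh)); apply: le_trans (expR_ge1Dx _); rewrite lerDr.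
  have kh0 : 0 <= k%:R * h by rewrite mulr_ge0// ltW.
  have [mFk F1 F2] := RelF h k (ltW h0); have [T1 T2] := tail _ kh0.
  have ep : ((r * h)%:E * law X x (F (k%:R * h)%R) <= (e / 2)%:E)%E.
    rewrite -rh -[leRHS]mule1; apply: lee_wpmul2l; last exact: (probability_le1 _ mFk).
    by rewrite lee_fin; exact/ltW/(mulr_gt0 hr h0).
  have Ek' : ((expR (- r * (k%:R * h)))%:E <= (e / 2)%:E)%E by rewrite lee_fin.
  have ee : e%:E = ((e / 2)%:E + (e / 2)%:E)%E by rewrite -EFinD; congr EFin; field.
  rewrite ee; split.
  - rewrite (splitH _ kh0) [leRHS]addeA; apply: (leeD _ (le_trans T1 Ek')).
    apply: (le_trans F1); apply: leeD => //.
    by rewrite (splitD _ kh0) leeDl//; apply: integral_ge0 => w _; exact: D0.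
  - rewrite (splitD _ kh0) [leRHS]addeA; apply: (leeD _ (le_trans T2 Ek')).
    apply: (le_trans F2); apply: leeD => //.
    by rewrite (splitH _ kh0) leeDl.
apply/eqP; rewrite eq_le; apply/andP; split; apply/lee_addgt0Pr => e e0;
  by have [] := bound e e0.
Qed.

Lemma clock_after_hitting x z : I x -> I z ->
  law X x [set w | (hitting_time X z w <= (T w)%:E)%E] =
  (\int[law X x]_w (exp_discount r (hitting_time X z w))%:E)%E.
Proof.
move=> Ix Iz; apply: clock_after => //.
- by move=> w; exact: hitting_time_ge0.
- move=> t t0; set G := <<s _ >>.
  have sG : sigma_algebra setT G by exact: smallest_sigma_algebra.
  apply: (hitting_time_event hX sG) => //.
  by move=> s C /andP[s0 _] mC; apply: sub_sigma_algebra; exists s, C.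
- exact: (stopping_time_measurable hX (hitting_time_stopping hX Iz)).
Qed.

End clock.

(** * The payoff *)

Lemma finite_set_closed (R : realType) (A : set R) : finite_set A -> closed A.
Proof.
have/accessible_finite_set_closed : accessible_space R.
  exact: (hausdorff_accessible (@Rhausdorff R)).
exact.
Qed.

Section payoff_analysis.
Context (R : realType) (d : measure_display) (Om : measurableType d).
Context (a b : \bar R) (mu sigma : R -> R) (r : R) (X : process R Om).
Context (psi g : R -> R) (kinks : set R) (xg ystar : R).
Hypothesis hr : 0 < r.
Hypothesis hpsi : increasing_solution a b mu sigma r X psi.
Hypothesis hg : payoff a b r X kinks xg g.
Hypothesis g_nd : nondecreasing_on (state_space a b) g.
Notation I := (state_space a b).
Notation fh := (fhat kinks g psi).
Hypothesis thr : threshold a b fh ystar.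
Hypothesis fhat_nd : nondecreasing_on (upper_part b ystar) fh.
Hypothesis ratio_dec : decreases_to_0 a b (fun x => g x / psi x).

(** Strict increase alone permits isolated zeros of [psi']. At such a zero [psi'] is minimal, so
    [psi''] vanishes too, and the equation leaves [r psi x = 0], contrary to positivity. *)
Lemma dpsi_gt0 x : I x -> 0 < derive1 psi x.
Proof.
move=> Ix; have oI := @state_space_open R a b.
have dpsi y : I y -> derivable psi y 1 by move=> Iy;
  have [H _ _] := psi_C2 hpsi Iy; exact: H.
have ge0 y : I y -> 0 <= derive1 psi y.
  move=> Iy; apply: (derive1_ge0_of_nondecreasing oI Iy dpsi) => u v Iu Iv.
  exact: (psi_nd hpsi).
rewrite lt_neqAle ge0// andbT; apply/negP => /eqP d0.
have [p Ip px] := state_space_left Ix; have [q Iq xq] := state_space_right Ix.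
have pqI y : y \in `]p, q[ -> I y.
  by rewrite in_itv/= => /andP[py yq]; apply: (state_space_between Ip Iq); rewrite !ltW.
have d2 : is_derive x 1 (derive1 psi) 0.
  apply: (@derive1_at_min _ _ p q).
  - exact/ltW/(lt_trans px).
  - by move=> y /pqI Iy; have [_ H _] := psi_C2 hpsi Iy; exact: H.
  - by rewrite in_itv/= px xq.
  - by move=> y /pqI Iy; rewrite -d0 ge0.
have := psi_ode hpsi Ix; rewrite /generator -d0 /derive1n/= (is_derive1_derive1 d2).
rewrite !mulr0 addr0 sub0r => /eqP; rewrite oppr_eq0 mulf_eq0 (gt_eqF hr)/=.
by rewrite gt_eqF// (psi_gt0 hpsi).
Qed.

Lemma regular_points_open : open (I `\` kinks).
Proof.
rewrite setDE; apply: openI; first exact: state_space_open.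
by apply: closed_openC; apply: finite_set_closed; exact: (kinks_finite hg).
Qed.

Lemma dpayoffE x : ~ kinks x -> dpayoff kinks g x = derive1 g x.
Proof. by move=> Kx; rewrite /dpayoff memNset. Qed.

Lemma psi_jet : C2_jet I psi (derive1 psi) (derive1n 2 psi).
Proof. exact: C2_on_jet (psi_C2 hpsi). Qed.

Lemma g_jet : C2_jet (I `\` kinks) g (derive1 g) (derive1n 2 g).
Proof. exact: C2_on_jet (g_C2 hg). Qed.

(** The filter is abstract to cover two-sided limits at regular points and right limits at kinks,
    where [dpayoff] is the right limit of the derivative. *)
Lemma fhat_cvg (F : set_system R) (FF : Filter F) x l : I x -> F --> nbhs x ->
  (\forall z \near F, ~ kinks z) -> derive1 g z @[z --> F] --> l ->
  fh z @[z --> F] --> g x - psi x * l / derive1 psi x.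
Proof.
move=> Ix Fx FK dgl; have [dpsi d2psi _] := psi_jet Ix.
have cpsi : psi z @[z --> F] --> psi x.
  apply: cvg_trans (is_derive_continuous dpsi); exact: cvg_app.
have cdpsi : derive1 psi z @[z --> F] --> derive1 psi x.
  apply: cvg_trans (is_derive_continuous d2psi); exact: cvg_app.
have cg : g z @[z --> F] --> g x.
  apply: cvg_trans (g_continuous hg Ix); exact: cvg_app.
have lim : (g z - psi z * derive1 g z / derive1 psi z) @[z --> F] --> g x - psi x *
  l / derive1 psi x.
  apply: cvgB => //; apply: cvgM; first exact: cvgM.
  by apply: cvgV => //; rewrite gt_eqF// dpsi_gt0.
apply: cvg_trans lim; apply: near_eq_cvg.
by apply: filterS FK => z Kz; rewrite /fhat dpayoffE.
Qed.

Lemma fhat_continuous x : I x -> ~ kinks x -> fh z @[z --> x] --> fh x.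
Proof.
move=> Ix Kx; rewrite {2}/fhat dpayoffE//.
have [_ d2g _] := g_jet (conj Ix Kx).
apply: fhat_cvg => //; last exact: is_derive_continuous d2g.
have : nbhs x (I `\` kinks) by apply: open_nbhs_nbhs; split => //;
  exact: regular_points_open.
by apply: filterS => z [].
Qed.

Lemma fhat_le0 x : I x -> ~ kinks x -> x < ystar -> fh x <= 0.
Proof.
move=> Ix Kx xy; have [_ H _] := thr; have [_] := H x Ix xy.
have -> // : lim (fh z @[z --> x^'+]) = fh x.
by apply/cvg_lim => //; apply: cvg_at_right_filter; exact: fhat_continuous.
Qed.

Lemma fhat_gt0 x : I x -> ~ kinks x -> ystar < x -> 0 < fh x.
Proof.
move=> Ix Kx xy; have [_ _ H] := thr; have [_] := H x Ix xy.
have -> // : lim (fh z @[z --> x^'+]) = fh x.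
by apply/cvg_lim => //; apply: cvg_at_right_filter; exact: fhat_continuous.
Qed.

Lemma kinks_near_right x : \forall z \near x^'+, ~ kinks z.
Proof.
have cK : closed (kinks `\ x) by apply: finite_set_closed; apply: finite_setD;
  exact: (kinks_finite hg).
have : nbhs x (~` (kinks `\ x)).
  by apply: open_nbhs_nbhs; split; [exact: closed_openC|move=> [_]; exact].
rewrite /at_right near_withinE; apply: filterS => z Nz xz Kz; apply: Nz; split=> //.
by move=> /= zx; rewrite zx ltxx in xz.
Qed.

Lemma fhat_cvg_right x : I x -> fh z @[z --> x^'+] --> fh x.
Proof.
move=> Ix; have [Kx|Kx] := pselect (kinks x); last first.
  by apply: cvg_at_right_filter; exact: fhat_continuous.
rewrite {2}/fhat /dpayoff mem_set//.
apply: fhat_cvg => //; first exact: cvg_within.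
  exact: kinks_near_right.
by have [_ ? _ _] := g_kinks hg Kx.
Qed.

(** The threshold condition says nothing at [ystar] itself; the sign is the limit of the positive
    values on the right. *)
Lemma fhat_ystar_ge0 : 0 <= fh ystar.
Proof.
have [Iy _ _] := thr.
apply: (cvgr_to_ge (fhat_cvg_right Iy)).
have nI : nbhs ystar I by apply: open_nbhs_nbhs; split => //; exact: state_space_open.
near=> z; apply/ltW/fhat_gt0.
- by near: z; rewrite /at_right near_withinE; apply: filterS nI => z ? _.
- by near: z; exact: kinks_near_right.
- by near: z; exact: nbhs_right_gt.
Unshelve. all: by end_near. Qed.

Lemma fhat_ge0 x : upper_part b ystar x -> 0 <= fh x.
Proof.
move=> [yx xb]; apply: (le_trans fhat_ystar_ge0); apply: fhat_nd => //.
by split=> //; apply: le_lt_trans xb; rewrite lee_fin.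
Qed.

Lemma upper_part_state x : upper_part b ystar x -> I x.
Proof.
move=> [yx xb]; have [[ay _] _ _] := thr; split=> //.
by apply: lt_le_trans ay _; rewrite lee_fin.
Qed.

Lemma gap_ratio_derive (C x : R) : I x -> ~ kinks x ->
  is_derive x 1 (fun z => (C - g z) / psi z) (derive1 psi x * (fh x - C) / psi x ^+ 2).
Proof.
move=> Ix Kx; have [dg _ _] := g_jet (conj Ix Kx); have [dpsi _ _] := psi_jet Ix.
have p0 : psi x != 0 by rewrite gt_eqF// (psi_gt0 hpsi).
have dp0 : derive1 psi x != 0 by rewrite gt_eqF// dpsi_gt0.
have := is_deriveM (is_deriveB (is_derive_cst C x 1) dg) (is_deriveV p0 dpsi).
congr is_derive; rewrite /GRing.scale/= /fhat dpayoffE//.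
by rewrite !fctE; field; rewrite p0 dp0.
Qed.

Lemma gap_ratio_continuous (C x : R) : I x -> {for x, continuous (fun z => (C - g
  z) / psi z)}.
Proof.
move=> Ix; have [dpsi _ _] := psi_jet Ix.
apply: continuousM.
  by apply: continuousB; [exact: cst_continuous|exact: (g_continuous hg)].
apply: continuousV; first by rewrite gt_eqF// (psi_gt0 hpsi).
exact: is_derive_continuous dpsi.
Qed.

(* The derivative of [(C - g) / psi] has the sign of [fhat - C]: the tangent to
   [g] at [z], as a function of [psi], lies above [g] on the whole interval. *)
Lemma gap_ratio_min (C z x : R) : I z -> I x ->
  (forall u, I u -> ~ kinks u -> z < u -> C <= fh u) ->
  (forall u, I u -> ~ kinks u -> u < z -> fh u <= C) ->
  (C - g z) / psi z <= (C - g x) / psi x.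
Proof.
move=> Iz Ix right_ge left_le.
have [s Ks] : exists s : seq R, kinks = [set` s] by apply/finite_seqP;
  exact: (kinks_finite hg).
have Kn u : u \notin s -> ~ kinks u by move=> us; rewrite Ks /=; exact/negP.
have psi2 u : I u -> 0 < psi u ^+ 2 by move=> Iu; rewrite exprn_gt0// (psi_gt0 hpsi).
have [zx|xz] := leP z x.
  have zxI u : z <= u <= x -> I u by exact: (state_space_between Iz Ix).
  apply: (@le_derive1_off_seq _ s (fun u => (C - g u) / psi u)) => //.
    by move=> u /zxI; exact: gap_ratio_continuous.
  move=> u /andP[zu ux] us; have Iu : I u by apply: zxI; rewrite !ltW.
  exists (derive1 psi u * (fh u - C) / psi u ^+ 2); first exact: gap_ratio_derive (Kn u us).
  by rewrite divr_ge0 ?(ltW (psi2 u Iu))// mulr_ge0 ?(ltW (dpsi_gt0 Iu))// subr_ge0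
    right_ge//; exact: Kn.
have xzI u : x <= u <= z -> I u by exact: (state_space_between Ix Iz).
rewrite -lerN2; apply: (@le_derive1_off_seq _ s (fun u => - ((C - g u) / psi u)));
  first exact: ltW.
  by move=> u /xzI Iu; apply: continuousN; exact: gap_ratio_continuous.
move=> u /andP[xu uz] us; have Iu : I u by apply: xzI; rewrite !ltW.
exists (- (derive1 psi u * (fh u - C) / psi u ^+ 2)).
  by apply: is_deriveN; exact: gap_ratio_derive (Kn u us).
rewrite -mulNr -mulrN divr_ge0 ?(ltW (psi2 u Iu))// mulr_ge0 ?(ltW (dpsi_gt0 Iu))//
  oppr_ge0 subr_le0 left_le//.
exact: Kn.
Qed.

(** To the left of [z] monotonicity of [fhat] is known only down to [ystar]; further left its sign
    suffices, as [fhat z >= 0]. *)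
Lemma tangent_above z x : upper_part b ystar z -> I x ->
  (fh z - g z) / psi z <= (fh z - g x) / psi x.
Proof.
move=> uz Ix; have Iz := upper_part_state uz; have [yz zb] := uz.
apply: gap_ratio_min => // [u Iu Ku zu|u Iu Ku uz'].
  by apply: fhat_nd => //; [split; [exact: (le_trans yz (ltW zu))|case: Iu]|exact: ltW].
have [yu|uy] := leP ystar u.
  by apply: fhat_nd => //; [split=> //; case: Iu|exact: ltW].
by apply: (le_trans (fhat_le0 Iu Ku uy)); exact: fhat_ge0.
Qed.

Lemma ratio_max x : I x -> g x / psi x <= g ystar / psi ystar.
Proof.
move=> Ix; have [Iy _ _] := thr.
have := @gap_ratio_min 0 ystar x Iy Ix.
rewrite !sub0r !mulNr lerN2; apply.
- by move=> u Iu Ku yu; exact/ltW/fhat_gt0.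
- by move=> u Iu Ku uy; exact: fhat_le0.
Qed.

(** The maximal value of [g / psi] is at least its value at a point above [xg], where [g] is
    positive. *)
Lemma g_ystar_gt0 : 0 < g ystar.
Proof.
have Ixg := xg_in hg; have [q Iq xq] := state_space_right Ixg.
have gq : 0 < g q by apply/(g_gt0 hg Iq).
have [Iy _ _] := thr; have := ratio_max Iq.
have py := psi_gt0 hpsi Iy; have pq := psi_gt0 hpsi Iq.
rewrite ler_pdivlMr//; apply: lt_le_trans.
by rewrite mulr_gt0// divr_gt0.
Qed.

Lemma from_left_near x (Q : \bar R -> Prop) : I x -> (\forall y \near from_left b, Q y) ->
  exists2 z0, I z0 & forall z, I z -> z0 <= z -> Q z%:E.
Proof.
move=> Ix; rewrite /from_left near_withinE; have [ax xb] := Ix.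
case: b xb Ix => [b'| |] // xb [_ xb'].
- rewrite lte_fin in xb; rewrite /= /nbhs/=.
  move=> /nbhs_ballP[e /= e0 He].
  exists (Num.max x (b' - e / 2)).
    split; first by apply: (lt_le_trans ax); rewrite lee_fin le_max lexx.
    by rewrite lte_fin gt_max xb ltrBlDr ltrDl divr_gt0.
  move=> z [_ zb]; rewrite ge_max => /andP[_ bz]; apply: He => //.
  rewrite lte_fin in zb; rewrite /ball/= gtr0_norm ?subr_gt0//; lra.
- move=> [M [_ HM]]; exists (Num.max x (M + 1)).
    split; first by apply: (lt_le_trans ax); rewrite lee_fin le_max lexx.
    by rewrite ltry.
  move=> z Iz; rewrite ge_max => /andP[_ Mz]; apply: HM; last exact: ltry.
  by rewrite lte_fin; lra.
Qed.

Lemma ratio_small e : 0 < e -> exists2 z0, I z0 & forall z, I z -> z0 <= z -> g z /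
  psi z < e.
Proof.
move=> e0; have [Iy _ _] := thr; have [_ cv] := ratio_dec.
have /(from_left_near Iy)[z0 Iz0 H] : \forall y \near from_left b, g (fine y) / psi
  (fine y) < e.
  move: cv => /cvgrPdist_lt/(_ _ e0); apply: filterS => y; rewrite sub0r normrN.
  by apply: le_lt_trans; exact: ler_norm.
by exists z0.
Qed.

(** Above [ystar] the payoff is at least [g ystar > 0], so [g / psi] can tend to 0 only if [psi]
    tends to infinity. *)
Lemma psi_large K : exists2 z0, I z0 & forall z, I z -> z0 <= z -> K < psi z.
Proof.
have [Iy _ _] := thr; have gy := g_ystar_gt0.
pose K' := Num.max K 1.
have K0 : 0 < K' by rewrite lt_max ltr01 orbT.
have [z0 Iz0 H] := ratio_small (divr_gt0 gy K0).
exists (Num.max z0 ystar).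
  by case: leP.
move=> z Iz; rewrite ge_max => /andP[z0z yz].
have pz := psi_gt0 hpsi Iz.
have := H z Iz z0z; rewrite ltr_pdivrMr// mulrAC ltr_pdivlMr// => Hz.
have gz : g ystar <= g z by exact: g_nd.
have : g ystar * K' < g ystar * psi z.
  by apply: le_lt_trans Hz; rewrite ler_pM2r.
rewrite ltr_pM2l// => K'p; apply: le_lt_trans K'p.
by rewrite le_max lexx.
Qed.

(** Let [x] tend to [b] in the hypothesis: its right side is at most [C / psi x], which tends to 0.
    A nonnegative slope is what lets the supermartingale bound on [psi] be multiplied by it. *)
Lemma tangent_slope_ge0 z C : I z -> 0 <= C ->
  (forall x, I x -> (C - g z) / psi z <= (C - g x) / psi x) -> 0 <= (g z - C) / psi z.
Proof.
move=> Iz C0 H; apply/ler_addgt0Pl => e e0.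
have [Iy _ _] := thr.
have [z0 Iz0 Hz0] := psi_large (C / e).
pose x := Num.max z0 ystar.
have Ix : I x by rewrite /x; case: leP.
have px := psi_gt0 hpsi Ix.
have gx : 0 <= g x.
  apply: (le_trans (ltW g_ystar_gt0)); apply: g_nd => //.
  by rewrite le_max lexx orbT.
have Cx : C / psi x < e.
  rewrite ltr_pdivrMr// mulrC -ltr_pdivrMr//; apply: Hz0 => //.
  by rewrite le_max lexx.
have := H x Ix.
have -> : (C - g z) / psi z = - ((g z - C) / psi z) by rewrite -mulNr opprB.
have : (C - g x) / psi x <= C / psi x.
  by rewrite ler_pM2r ?invr_gt0// lerBlDr lerDl.
lra.
Qed.

End payoff_analysis.

(* Repeated bisection of [q] halves the bound at each step. *)
Lemma additive_bisection (R : realType) (Delta : R -> R -> R) (q phi : R -> R) (A B : R) :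
  A <= B -> (forall y, A <= y <= B -> {for y, continuous q}) ->
  (forall u v, A <= u -> u <= v -> v <= B -> q v <= q u) ->
  (forall u m v, A <= u -> u <= m -> m <= v -> v <= B -> Delta u v = Delta u m +
    Delta m v) ->
  (forall u v, A <= u -> u <= v -> v <= B -> `|Delta u v| <= (q u - q v) * (phi v -
    phi u)) ->
  Delta A B = 0.
Proof.
move=> AB cq qdec Dadd Dle.
have key n : forall u v, A <= u -> u <= v -> v <= B ->
    `|Delta u v| <= 2^-1 ^+ n * ((q u - q v) * (phi v - phi u)).
  elim: n => [|n IH] u v Au uv vB; first by rewrite expr0 mul1r; exact: Dle.
  have quv := qdec u v Au uv vB.
  have cuv : {within `[u, v], continuous q}.
    by apply: continuous_within_segment => y /andP[uy yv]; apply: cq; lra.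
  have mid : Num.min (q u) (q v) <= (q u + q v) / 2 <= Num.max (q u) (q v).
    by rewrite (min_idPr quv) (max_idPl quv); lra.
  (* The bisection is by values: [q m] is halfway between [q u] and [q v]. The two bounds then add
     up to exactly half of the bound on [[u, v]], whatever [phi m] is. *)
  have [m] := IVT uv cuv mid; rewrite in_itv/= => /andP[um mv] qm.
  have mB := le_trans mv vB; have Am := le_trans Au um.
  rewrite (Dadd u m v)//; apply: (le_trans (ler_normD _ _)).
  apply: (le_trans (lerD (IH u m Au um mB) (IH m v Am mv vB))).
  rewrite qm exprS -mulrDr [leRHS]mulrAC -mulrA mulrC.
  rewrite le_eqVlt; apply/orP; left; apply/eqP.
  by field.
apply/eqP; rewrite -normr_le0; apply/ler_addgt0Pl => e e0; rewrite addr0.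
set C := (q A - q B) * (phi B - phi A) in key.
have C0 : 0 <= C by apply: le_trans (Dle A B (lexx _) AB (lexx _)).
have [n Hn] := natr_gt (C / e).
apply: (le_trans (key n A B (lexx _) AB (lexx _))); rewrite -/C.
rewrite exprVn mulrC ler_pdivrMr ?exprn_gt0// mulrC -ler_pdivrMr//.
apply: (le_trans (ltW (Hn n (leqnn n)))).
by rewrite -natrX ler_nat ltnW// ltn_expl.
Qed.

(** * The law of the supremum at the clock *)

Section distribution_of_supremum.
Context (R : realType) (d : measure_display) (Om : measurableType d).
Context (a b : \bar R) (mu sigma : R -> R) (r : R) (X : process R Om).
Context (T : {mfun Om >-> R}) (psi g : R -> R) (kinks : set R) (xg ystar : R).
Hypothesis hr : 0 < r.
Hypothesis hX : regular_diffusion a b mu sigma X.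
Hypothesis hT : exponential_clock a b r X T.
Hypothesis hpsi : increasing_solution a b mu sigma r X psi.
Hypothesis hg : payoff a b r X kinks xg g.
Hypothesis g_nd : nondecreasing_on (state_space a b) g.
Notation I := (state_space a b).
Notation fh := (fhat kinks g psi).
Hypothesis thr : threshold a b fh ystar.
Hypothesis fhat_nd : nondecreasing_on (upper_part b ystar) fh.
Hypothesis ratio_dec : decreases_to_0 a b (fun x => g x / psi x).

Definition sup_ge (z : R) : set Om := [set w | (z%:E <= running_sup X (T w) w)%E].

Lemma sup_geE z : I z -> sup_ge z = [set w | (hitting_time X z w <= (T w)%:E)%E].
Proof. by move=> Iz; apply/seteqP; split=> w /=;
  rewrite /sup_ge/= (le_running_sup hX _ _ Iz). Qed.

Lemma sup_ge_measurable z : I z -> measurable (sup_ge z).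
Proof.
move=> Iz; rewrite sup_geE//.
have mT : measurable_fun setT (EFin \o T) by exact/measurable_EFinP.
have mt := stopping_time_measurable hX (hitting_time_stopping hX Iz).
rewrite -[X in measurable X]setTI; exact: (emeasurable_fun_le measurableT mt mT).
Qed.

Lemma probability_sup_ge x z : I x -> I z -> x <= z -> law X x (sup_ge z) = (psi x
  / psi z)%:E.
Proof.
move=> Ix Iz xz; rewrite sup_geE//.
by rewrite [LHS](clock_after_hitting hr hX hT Ix Iz) (laplace_hitting_time hr hX hpsi).
Qed.

Lemma sup_ge_nincr u v : u <= v -> sup_ge v `<=` sup_ge u.
Proof. by move=> uv w; rewrite /sup_ge/=; apply: le_trans; rewrite lee_fin. Qed.

Definition sup_payoff (w : Om) : R :=
  if (ystar%:E <= running_sup X (T w) w < b)%E then fh (fine (running_sup X (T w)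
    w)) else 0.

Lemma sup_payoff_ge0 w : 0 <= sup_payoff w.
Proof.
rewrite /sup_payoff; case: ifPn => // /andP[yM Mb].
apply: (fhat_ge0 hr hpsi hg thr fhat_nd).
move: yM Mb; case: (running_sup _ _ _) => [| |] //.
by move=> _; rewrite ltNge leey.
Qed.

Lemma sup_between u v w : (sup_ge u `\` sup_ge v) w -> exists2 m, u <= m < v &
  running_sup X (T w) w = m%:E.
Proof.
move=> [uM /negP]; rewrite -ltNge; move: uM; rewrite /sup_ge /=.
case: (running_sup _ _ _) => [m| |] //; rewrite ?lee_fin ?lte_fin.
by move=> um mv; exists m => //; rewrite um.
Qed.

Lemma sup_payoffE u v w : I v -> ystar <= u -> (sup_ge u `\` sup_ge v) w ->
  exists m, [/\ u <= m < v, running_sup X (T w) w = m%:E & sup_payoff w = fh m].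
Proof.
move=> [_ vb] yu /sup_between[m /andP[um mv] Mm]; exists m; split; [by rewrite um| by []|].
rewrite /sup_payoff Mm lee_fin (le_trans yu um)/= ifT//.
by apply: lt_trans vb; rewrite lte_fin.
Qed.

Lemma sup_payoff_measurable u v : I v -> ystar <= u -> u <= v ->
  measurable_fun (sup_ge u `\` sup_ge v) sup_payoff.
Proof.
move=> Iv yu uv; have [Iy _ _] := thr.
have Iu : I u by apply: (state_space_between Iy Iv); rewrite yu.
pose E := sup_ge u `\` sup_ge v.
have mE : measurable E by apply: measurableD; exact: sup_ge_measurable.
pose M w := fine (running_sup X (T w) w).
have mM : measurable_fun E M.
  apply: (measurability _ (RGenCInfty.measurableE R)) => _ [_ [y ->] <-].
  (* On [E] the supremum lies in [[u, v)], so only levels strictly between [u] and [v] define a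
     nontrivial event. *)
  have [yu'|uy] := leP y u.
    rewrite (_ : _ `&` _ = E)//; apply/seteqP; split=> w; first by move=> [].
    move=> Ew; split=> //=; have [m /andP[um mv] Mm] := sup_between Ew.
    by rewrite /M Mm in_itv/= andbT (le_trans yu').
  have [vy|yv] := leP v y.
    rewrite (_ : _ `&` _ = set0)//; apply/seteqP; split=> // w [Ew] /=.
    have [m /andP[um mv] Mm] := sup_between Ew.
    by rewrite /M Mm in_itv/= andbT leNgt (lt_le_trans mv vy).
  have Iy' : I y by apply: (state_space_between Iu Iv); rewrite !ltW.
  rewrite (_ : _ `&` _ = E `&` sup_ge y); first by apply: measurableI => //;
    exact: sup_ge_measurable.
  apply/seteqP; split=> w [Ew] /=; have [m _ Mm] := sup_between Ew.
    by rewrite /M Mm in_itv/= andbT => ym; split=> //; rewrite /sup_ge/= Mm lee_fin.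
  by rewrite /sup_ge/= Mm lee_fin => ym; split=> //=; rewrite /M Mm in_itv/= andbT.
(* [fhat] is monotone on [[ystar, b)] only. Clamping its argument to [[u, v]] makes it nondecreasing
   on the whole line, hence Borel, without changing it on [E]. *)
pose clamp m := Num.min (Num.max m u) v.
have clampI m : upper_part b ystar (clamp m).
  have /andP[lo hi] : u <= clamp m <= v.
    by rewrite /clamp ge_min lexx orbT andbT le_min uv andbT le_max lexx orbT.
  split; first exact: le_trans lo.
  by have [_ vb] := Iv; apply: le_lt_trans vb; rewrite lee_fin.
have mF : measurable_fun setT (fun m => fh (clamp m)).
  apply: nondecreasing_measurable => // s t st; apply: fhat_nd => //.
  rewrite /clamp le_min; apply/andP; split; rewrite ge_min ?lexx ?orbT//.
  by rewrite ge_max !le_max st lexx orbT.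
apply: (eq_measurable_fun (fun w => fh (clamp (M w)))).
  move=> w /[!inE] Ew; have [m [/andP[um mv] Mm ->]] := sup_payoffE Iv yu Ew.
  by rewrite /M Mm /= /clamp (max_idPl um) (min_idPl (ltW mv)).
exact: measurableT_comp mF mM.
Qed.

Lemma probability_between x u v : I x -> I u -> I v -> x <= u -> u <= v ->
  law X x (sup_ge u `\` sup_ge v) = (psi x / psi u - psi x / psi v)%:E.
Proof.
move=> Ix Iu Iv xu uv; have mu' := sup_ge_measurable Iu; have mv := sup_ge_measurable Iv.
rewrite measureD//; last first.
  by rewrite [X in (X < _)%E](probability_sup_ge Ix Iu xu) ltry.
rewrite (setIidr (sup_ge_nincr uv)).
rewrite [X in (X - _)%E](probability_sup_ge Ix Iu xu).
by rewrite [X in (_ - X)%E](probability_sup_ge Ix Iv (le_trans xu uv)).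
Qed.

Lemma integral_sup_payoff_between x A B : I x -> I B -> x <= A -> ystar <= A -> A <= B ->
  (\int[law X x]_(w in sup_ge A `\` sup_ge B) (sup_payoff w)%:E =
   (psi x * (g A / psi A) - psi x * (g B / psi B))%:E)%E.
Proof.
move=> Ix IB xA yA AB; have [Iy _ _] := thr.
have bI z : A <= z <= B -> I z.
  by move=> /andP[Az zB]; apply: (state_space_between Iy IB); rewrite (le_trans yA).
have ub z : A <= z <= B -> upper_part b ystar z.
  by move=> zAB; have [_ zb] := bI z zAB; split=> //; move: zAB => /andP[Az _];
    exact: le_trans Az.
pose q z := psi x / psi z.
pose k z := psi x * (g z / psi z).
pose E u v := sup_ge u `\` sup_ge v.
have px := psi_gt0 hpsi Ix.
have pos z : A <= z <= B -> 0 < psi z by move=> /bI; exact: (psi_gt0 hpsi).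
have qdec u v : A <= u -> u <= v -> v <= B -> q v <= q u.
  move=> Au uv vB; rewrite /q ler_pM2l// lef_pV2 ?posrE ?pos ?Au ?vB ?(le_trans Au
    uv) ?(le_trans uv vB)//.
  by apply: (psi_nd hpsi) => //; apply: bI; lra.
have mE u v : A <= u -> u <= v -> v <= B -> measurable (E u v).
  move=> Au uv vB; apply: measurableD; apply: sup_ge_measurable; apply: bI; lra.
have mS u v : A <= u -> u <= v -> v <= B -> measurable_fun (E u v) (fun w =>
  (sup_payoff w)%:E).
  move=> Au uv vB; apply/measurable_EFinP; apply: sup_payoff_measurable => //.
    by apply: bI; lra.
  exact: le_trans Au.
have PE u v : A <= u -> u <= v -> v <= B -> law X x (E u v) = (q u - q v)%:E.
  by move=> Au uv vB; apply: probability_between => //; [apply: bI;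
    lra..|exact: le_trans Au].
have itv u v : A <= u -> u <= v -> v <= B ->
    (((fh u * (q u - q v))%:E <= \int[law X x]_(w in E u v) (sup_payoff w)%:E) /\
    (\int[law X x]_(w in E u v) (sup_payoff w)%:E <= (fh v * (q u - q v))%:E))%E.
  move=> Au uv vB; have yu := le_trans yA Au.
  have Iv : I v by apply: bI; lra.
  have cst_int (c : R) : (\int[law X x]_(w in E u v) c%:E = (c * (q u - q v))%:E)%E.
    by rewrite integral_cst; [rewrite EFinM; congr (_ * _)%E; exact: PE|exact: mE].
  rewrite -!cst_int; split; apply: le_integral_nonmeasurable => w Ew;
    have [m [/andP[um mv] _ ->]] := sup_payoffE Iv yu Ew; rewrite lee_fin;
    apply: fhat_nd => //; try (apply: ub; lra); lra.
pose J u v := fine (\int[law X x]_(w in E u v) (sup_payoff w)%:E)%E.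
have JE u v : A <= u -> u <= v -> v <= B ->
    (\int[law X x]_(w in E u v) (sup_payoff w)%:E)%E = (J u v)%:E.
  move=> Au uv vB; have [lo hi] := itv u v Au uv vB.
  by rewrite fineK// fin_numElt (lt_le_trans _ lo) ?ltNyr// (le_lt_trans hi)// ltry.
(* The tangent inequality at [u], evaluated at [v] and multiplied by [psi x]. Exchanging [u] and [v]
   gives the opposite bound, with [fh v]. *)
have tang u v : A <= u <= B -> A <= v <= B -> fh u * (q u - q v) <= k u - k v.
  move=> uAB vAB; have := tangent_above hr hpsi hg thr fhat_nd (ub u uAB) (bI v vAB).
  have pu := pos u uAB; have pv := pos v vAB.
  rewrite -(ler_pM2l px) /q /k !mulrBl !mulrBr !mulrA => H.
  by move: H; rewrite !(mulrC (psi x)) -!mulrA; lra.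
suff : J A B - (k A - k B) = 0.
  by move/subr0_eq => H; rewrite JE ?lexx// H.
apply: (@additive_bisection _ (fun u v => J u v - (k u - k v)) q fh) => //.
- move=> z zAB; have [dpsi _ _] := psi_jet hpsi (bI z zAB).
  apply: continuousM; first exact: cst_continuous.
  apply: continuousV; first by rewrite gt_eqF// pos.
  exact: is_derive_continuous dpsi.
- move=> u m v Au um mv vB.
  have uv := le_trans um mv; have Am := le_trans Au um; have mB := le_trans mv vB.
  suff -> : J u v = J u m + J m v by ring.
  apply: EFin_inj; rewrite EFinD -!JE//.
  have -> : E u v = E u m `|` E m v.
    apply/seteqP; split=> w.
      move=> [Hu Hv]; have [Hm|Hm] := pselect (sup_ge m w); by [right|left].
    move=> [[Hu Hm]|[Hm Hv]]; split=> //.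
      by move=> Hv; apply: Hm; exact: (sup_ge_nincr mv).
    exact: (sup_ge_nincr um).
  rewrite ge0_integral_setU//; try exact: mE; last 2 first.
  - by move=> w _; rewrite lee_fin sup_payoff_ge0.
  - by apply/disj_setPS => w [[_ Hm] [Hm' _]].
  by apply/measurable_funU; [exact: mE|exact: mE|split; exact: mS].
- move=> u v Au uv vB.
  have uAB : A <= u <= B by lra.
  have vAB : A <= v <= B by lra.
  have [lo hi] := itv u v Au uv vB; rewrite JE// !lee_fin in lo hi.
  have t1 := tang u v uAB vAB; have t2 := tang v u vAB uAB.
  rewrite ler_norml; apply/andP; split; lra.
Qed.

End distribution_of_supremum.

(** * Optimal stopping *)

Section optimal_stopping.
Context (R : realType) (d : measure_display) (Om : measurableType d).
Context (a b : \bar R) (mu sigma : R -> R) (r : R) (X : process R Om).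
Context (T : {mfun Om >-> R}) (psi g : R -> R) (kinks : set R) (xg ystar : R).
Hypothesis hr : 0 < r.
Hypothesis hX : regular_diffusion a b mu sigma X.
Hypothesis hT : exponential_clock a b r X T.
Hypothesis hpsi : increasing_solution a b mu sigma r X psi.
Hypothesis hg : payoff a b r X kinks xg g.
Hypothesis g_nd : nondecreasing_on (state_space a b) g.
Notation I := (state_space a b).
Notation fh := (fhat kinks g psi).
Hypothesis thr : threshold a b fh ystar.
Hypothesis fhat_nd : nondecreasing_on (upper_part b ystar) fh.
Hypothesis ratio_dec : decreases_to_0 a b (fun x => g x / psi x).

Let Iy : I ystar. Proof. by have [] := thr. Qed.

Lemma g_ge0_above z : I z -> ystar <= z -> 0 <= g z.
Proof.
move=> Iz yz; apply: (le_trans (ltW (g_ystar_gt0 hr hpsi hg thr))).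
exact: g_nd.
Qed.

Section at_point.
Variable x : R.
Hypothesis Ix : I x.
(** With this [c], both cases of the threshold value become [psi x * (g c / psi c)], the common
    value to which the functionals are reduced. *)
Let c := Num.max x ystar.
Let Ic : I c. Proof. by rewrite /c; case: leP. Qed.
Let xc : x <= c. Proof. by rewrite /c le_max lexx. Qed.
Let yc : ystar <= c. Proof. by rewrite /c le_max lexx orbT. Qed.

(** Almost surely the hitting time of [ystar] can be replaced by that of [c]: they coincide if
    [x < ystar], and both are 0 otherwise. By continuity the payoff there is the constant [g c]. *)
Lemma threshold_value_at :
  threshold_value X r g ystar x = (psi x * (g c / psi c))%:E.
Proof.
have [N0 [mN0 PN0 HN0]] := start_null hX Ix.
have st := hitting_time_stopping hX Ic.
rewrite /threshold_value.
rewrite (@eq_integral_off_null _ _ _ _ _ _ _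
  (fun w => ((g c)%:E * (exp_discount r (hitting_time X c w))%:E)%E) mN0 PN0); last first.
  move=> w _ /HN0 X0; rewrite -EFinM /discounted /exp_discount.
  have l0 := life_gt0 hX w.
  have [xy|yx] := ltP x ystar.
    have cE : c = ystar by apply/max_idPr/ltW.
    rewrite cE; have [tf|tf] := ltP (hitting_time X ystar w) +oo%E; last first.
      by rewrite ltNge (le_trans (leey _) tf)/= mulr0.
    have [t [tE t0 tl zt]] := hitting_time_attained hX tf.
    have X0y : coord X 0 w <= ystar by rewrite X0 ltW.
    by rewrite tE tl/= (coord_hitting hX X0y t0 tE tl zt) mulrC.
  have cE : c = x by apply/max_idPl.
  have h0 z : z <= x -> hitting_time X z w = 0%E.
    move=> zx; apply/eqP; rewrite eq_le hitting_time_ge0 andbT.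
    by apply: hitting_time_le => //; rewrite X0.
  by rewrite cE !h0// l0 ltry/= mulr0 expR0 mulr1 mul1r X0.
rewrite ge0_integralZl_EFin//.
- by rewrite (laplace_hitting_time hr hX hpsi Ix Ic xc) -EFinM; congr EFin; ring.
- move=> w _; rewrite lee_fin.
  by have /andP[] := exp_discount_itv hr (hitting_time_ge0 X c w).
- apply/measurable_EFinP; apply: measurableT_comp; first exact: exp_discount_measurable.
  exact: (stopping_time_measurable hX).
- exact: g_ge0_above.
Qed.

Lemma discounted_payoff_le tau : stopping_time X tau ->
  (\int[law X x]_w (discounted X r g tau w)%:E <= (psi x * (g c / psi c))%:E)%E.
Proof.
move=> st; have [L [mL L0 EL HL]] := discounted_psi_majorant hr hX hpsi st Ix.
have px := psi_gt0 hpsi Ix; have pc := psi_gt0 hpsi Ic.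
have [C [C0 Cmin Cval]] : exists C, [/\ 0 <= C,
    forall z, I z -> (C - g c) / psi c <= (C - g z) / psi z &
    C + (g c - C) / psi c * psi x = psi x * (g c / psi c)].
  have [xy|yx] := ltP x ystar.
    have cE : c = ystar by apply/max_idPr/ltW.
    exists 0; split => // [z Iz|]; last by rewrite add0r subr0 mulrC.
    rewrite cE !sub0r !mulNr lerN2; exact: (ratio_max hr hpsi hg thr).
  have cE : c = x by apply/max_idPl.
  have ux : upper_part b ystar x by split => //; case: Ix.
  exists (fh x); split.
  - exact: (fhat_ge0 hr hpsi hg thr fhat_nd).
  - by move=> z Iz; rewrite cE; exact: (tangent_above hr hpsi hg thr fhat_nd).
  - by rewrite cE divfK ?gt_eqF// addrC subrK mulrC divfK ?gt_eqF.
have S0 := tangent_slope_ge0 hr hpsi hg g_nd thr ratio_dec Ic C0 Cmin.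
set S := (g c - C) / psi c in S0 Cval.
have gle z : I z -> g z <= C + S * psi z.
  move=> Iz; have pz := psi_gt0 hpsi Iz; have := Cmin z Iz.
  rewrite ler_pdivlMr// (_ : (C - g c) / psi c = - S); last by rewrite /S -mulNr opprB.
  by rewrite mulNr => H; lra.
(* As [C >= 0], it may stay undiscounted, and it also covers the paths dead before [tau], whose
   payoff is 0. *)
apply: (@le_trans _ _ (\int[law X x]_w (C%:E + S%:E * L w))%E).
  apply: le_integral_nonmeasurable => w _.
  apply: (@le_trans _ _ (C%:E + S%:E * (discounted X r psi tau w)%:E)%E); last first.
    by apply: leeD2l; apply: lee_wpmul2l; [rewrite lee_fin|exact: HL].
  rewrite -EFinM -EFinD lee_fin /discounted; case: ifPn => tl; last by rewrite mulr0 addr0.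
  have t0 : 0 <= fine (tau w) by apply: fine_ge0; exact: st.1.
  have E1 : expR (- r * fine (tau w)) <= 1.
    by rewrite -[leRHS](@expR0 R) ler_expR mulNr lerNl oppr0 mulr_ge0// ltW.
  have E0 : 0 <= expR (- r * fine (tau w)) by exact: expR_ge0.
  have tfin : tau w \is a fin_num.
    by rewrite ge0_fin_numE ?st.1//; apply: (lt_le_trans tl); exact: leey.
  have IX : I (coord X (fine (tau w)) w) by apply: (coord_in hX) => //; rewrite fineK.
  apply: (le_trans (ler_wpM2l E0 (gle _ IX))).
  rewrite mulrDr [leRHS]addrC [leLHS]addrC; apply: lerD.
    by rewrite mulrCA.
  by rewrite ler_piMl.
rewrite ge0_integralD//; first last.
- exact: measurable_funeM.
- by move=> w _; rewrite mule_ge0// lee_fin.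
rewrite integral_cst_probability ge0_integralZl_EFin//.
rewrite -Cval EFinD (EFinM S); apply: leeD2l; apply: lee_wpmul2l => //.
Qed.

Lemma value_function_at : value_function X r g x = (psi x * (g c / psi c))%:E.
Proof.
apply/eqP; rewrite eq_le; apply/andP; split.
  by apply: ge_ereal_sup => _ [tau st <-]; exact: discounted_payoff_le.
rewrite -threshold_value_at; apply: ereal_sup_ubound.
by exists (hitting_time X ystar) => //; exact: (hitting_time_stopping hX).
Qed.

Lemma sup_representation_at :
  sup_representation b X T fh ystar x = (psi x * (g c / psi c))%:E.
Proof.
have px := psi_gt0 hpsi Ix.
pose k z := psi x * (g z / psi z).
have k0 z : I z -> ystar <= z -> 0 <= k z.
  by move=> Iz yz; rewrite /k mulr_ge0 ?(ltW px)// divr_ge0 ?g_ge0_above ?(ltW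
    (psi_gt0 hpsi Iz)).
have -> : sup_representation b X T fh ystar x = (\int[law X x]_w (sup_payoff b X T
  psi g kinks ystar w)%:E)%E by [].
set Rw := sup_payoff b X T psi g kinks ystar.
have R0 w : (0 <= (Rw w)%:E)%E by rewrite lee_fin;
  exact: (sup_payoff_ge0 _ hr hpsi hg thr fhat_nd).
pose E z := sup_ge X T c `\` sup_ge X T z.
have mE z : I z -> measurable (E z).
  by move=> Iz; apply: measurableD; exact: (sup_ge_measurable T hX).
have int_E z : I z -> c <= z -> (\int[law X x]_(w in E z) (Rw w)%:E)%E = (k c - k z)%:E.
  by move=> Iz cz; exact: (integral_sup_payoff_between hr hX hT hpsi hg thr fhat_nd).
(* The lower bound restricts to [c <= M_T < z] with [k z] small. The upper bound lets [z] increase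
   to [b] and uses Fatou's lemma with [k z >= 0]. *)
apply/eqP; rewrite eq_le; apply/andP; split; last first.
  apply/lee_addgt0Pr => e e0.
  have [z0 Iz0 Hz0] := ratio_small thr ratio_dec (divr_gt0 e0 px).
  pose z := Num.max z0 c.
  have Iz : I z by rewrite /z; case: leP.
  have cz : c <= z by rewrite /z le_max lexx orbT.
  have kz : k z < e.
    rewrite /k mulrC -ltr_pdivlMr//; apply: Hz0 => //.
    by rewrite /z le_max lexx.
  apply: (@le_trans _ _ ((k c - k z)%:E + e%:E)%E).
    by rewrite -EFinD lee_fin /k in kz *; lra.
  apply: leeD2r; rewrite -int_E// integral_mkcond.
  apply: ge0_le_integral_nonmeasurable => w _; rewrite patchE; case: ifPn => //.
have [N0 [mN0 PN0 HN0]] := start_null hX Ix.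
have [s [Is Hs]] := exhaust_right Ic.
pose z n := Num.max (s n) c.
have Iz n : I (z n) by rewrite /z; case: leP.
have cz n : c <= z n by rewrite /z le_max lexx orbT.
pose Rn n := (fun w => (Rw w)%:E) \_ (E (z n)).
have mR n : measurable_fun setT (Rn n).
  apply/(measurable_restrictT _ (mE _ (Iz n))).1.
  by apply/measurable_EFinP; exact: (sup_payoff_measurable hX thr fhat_nd).
have Rn0 n w : (0 <= Rn n w)%E by rewrite /Rn patchE; case: ifPn.
(* Off [N0] the path starts at [x], so [M_T >= ystar] entails [M_T >= c]. On [N0] a value between
   [ystar] and [c] would be missed by every [E (z n)]. *)
pose R' w := if w \in N0 then 0%E else (Rw w)%:E.
rewrite (@eq_integral_off_null _ _ _ _ _ _ _ R' mN0 PN0); last first.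
  by move=> w _ Nw; rewrite /R' memNset.
apply: (@le_trans _ _ (\int[law X x]_w limn_einf (fun n => Rn n w))%E).
  apply: ge0_le_integral_nonmeasurable => w _; first by rewrite /R'; case: ifP.
  rewrite /R'; case: ifPn => [_|/negP Nw].
    apply: limn_einf_ge => e e0; exists 0%N => n _.
    by apply: le_trans (Rn0 n w); rewrite lee_fin sub0r oppr_le0 ltW.
  have X0 : coord X 0 w = x by apply: HN0 => Nw'; apply: Nw; exact: mem_set.
  have [RE|Rn0'] := eqVneq (Rw w) 0.
    rewrite RE; apply: limn_einf_ge => e e0; exists 0%N => n _.
    by apply: le_trans (Rn0 n w); rewrite lee_fin sub0r oppr_le0 ltW.
  have [yM Mb] : (ystar%:E <= running_sup X (T w) w)%E /\ (running_sup X (T w) w < b)%E.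
    by move: Rn0'; rewrite /Rw /sup_payoff; case: ifPn => [/andP[]//|_]; rewrite eqxx.
  have Im : exists2 m, I m & running_sup X (T w) w = m%:E.
    move: yM Mb; case: (running_sup _ _ _) => [m| |] //.
      rewrite lee_fin => ym mb; exists m => //; split=> //.
      by have [ay _] := Iy; apply: (lt_le_trans ay); rewrite lee_fin.
    by move=> _; rewrite ltNge leey.
  have [m {}Im Mm] := Im.
  have cM : sup_ge X T c w.
    rewrite /sup_ge/= /c; case: (leP x ystar) => [//|yx].
    have T0 : 0 <= T w.
      move: yM; rewrite (le_running_sup hX _ _ Iy) => /(le_trans (hitting_time_ge0
        X ystar w)).
      by rewrite lee_fin.
    apply: ereal_sup_ubound; exists 0; last by rewrite X0.
    by split=> //; exact: (life_gt0 hX).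
  have [m' Im' mm'] := state_space_right Im.
  have [n0 Hn0] := Hs m' Im'.
  apply: limn_einf_ge => e e0; exists n0 => n nn.
  rewrite /Rn patchE ifT; first by rewrite lee_fin lerBlDr lerDl ltW.
  apply/mem_set; split=> //; rewrite /sup_ge/= Mm lee_fin; apply/negP; rewrite -ltNge.
  by rewrite /z lt_max (lt_le_trans mm' (Hn0 n nn)).
apply: (@le_trans _ _ (limn_einf (fun n => \int[law X x]_w Rn n w)%E)).
  exact: fatou.
apply: limn_einf_le => n; rewrite -integral_mkcond int_E// lee_fin.
have := k0 _ (Iz n) (le_trans yc (cz n)); rewrite -/(k c).
have : 0 <= n.+1%:R^-1 :> R by rewrite invr_ge0.
by set e := n.+1%:R^-1; lra.
Qed.

(** The integrands agree almost surely. The clock is nonnegative, and since [psi] is unbounded,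
    [M_T] is below some point of the state space; the supremum is then attained, and a nondecreasing
    function of the path is largest there. *)
Lemma sup_functional_at :
  sup_functional b X T fh ystar x = sup_representation b X T fh ystar x.
Proof.
have px := psi_gt0 hpsi Ix.
have [s [Is Hs]] := exhaust_right Ic.
pose z n := Num.max (s n) c.
have Iz n : I (z n) by rewrite /z; case: leP.
have cz n : c <= z n by rewrite /z le_max lexx orbT.
pose Nb := \bigcap_n sup_ge X T (z n).
have mNb : measurable Nb.
  by apply: bigcapT_measurable => n; exact: (sup_ge_measurable T hX).
have PNb : law X x Nb = 0%E.
  apply/eqP; rewrite eq_le measure_ge0 andbT; apply/lee_addgt0Pr => e e0; rewrite add0e.
  have [z0 Iz0 Hz0] := psi_large hr hpsi hg g_nd thr ratio_dec (psi x / e).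
  have [n Hn] := Hs z0 Iz0.
  apply: (@le_trans _ _ (law X x (sup_ge X T (z n)))).
    apply: le_measure; rewrite ?inE//; first exact: (sup_ge_measurable T hX).
    by move=> w; apply.
  rewrite [leLHS](probability_sup_ge hr hX hT hpsi Ix (Iz n) (le_trans xc (cz n))).
  have pz := psi_gt0 hpsi (Iz n).
  rewrite lee_fin ler_pdivrMr// mulrC -ler_pdivrMr//; apply/ltW/Hz0 => //.
  by rewrite /z le_max Hn.
pose N := T @^-1` `]-oo, 0[ `|` Nb.
have mT0 := clock_preimage_measurable T (measurable_itv `]-oo, 0[).
have mN : measurable N by exact: measurableU.
have PN : law X x N = 0%E by rewrite -(clock_lt0 hT Ix); exact: measureU0.
rewrite /sup_functional /sup_representation.
apply: (eq_integral_off_null mN PN) => w _ Nw.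
have T0 : 0 <= T w.
  by rewrite leNgt; apply/negP => T0; apply: Nw; left; rewrite /= in_itv.
have [n Mz] : exists n, (running_sup X (T w) w < (z n)%:E)%E.
  apply: contrapT => H; apply: Nw; right => n _; rewrite /sup_ge/= leNgt.
  by apply/negP => ?; apply: H; exists n.
have Xz u : 0 <= u <= T w -> (u%:E < life X w)%E -> coord X u w < z n.
  move=> /andP[u0 uT] ul; rewrite -lte_fin; apply: le_lt_trans Mz.
  by apply: ereal_sup_ubound; exists u.
have [u [/andP[u0 uT] ul Hu]] := path_sup_attained hX (Iz n) T0 Xz.
have Im := coord_in hX u0 ul.
set m := coord X u w in Hu Im.
have Mm : running_sup X (T w) w = m%:E.
  apply/eqP; rewrite eq_le; apply/andP; split.
    by apply: ge_ereal_sup => _ [v [v0 vT vl] <-]; rewrite lee_fin Hu// v0.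
  by apply: ereal_sup_ubound; exists u.
pose H v := fh v * \1_(upper_part b ystar) v.
have HE v : I v -> H v = if ystar <= v then fh v else 0.
  move=> [_ vb]; rewrite /H indicE; case: leP => yv.
    by rewrite mem_set// mulr1.
  by rewrite memNset ?mulr0// => -[]; rewrite leNgt yv.
have ub v : I v -> ystar <= v -> upper_part b ystar v by move=> [].
have fh0 v : I v -> ystar <= v -> 0 <= fh v.
  by move=> Iv yv; apply: (fhat_ge0 hr hpsi hg thr fhat_nd); exact: ub.
(* Nonnegativity of [fhat] above [ystar] makes the truncated function nondecreasing across [ystar],
   and makes the cemetery value 0 harmless in the supremum. *)
have H0 v : I v -> 0 <= H v by move=> Iv; rewrite HE//; case: ifP => // /(fh0 v Iv).
have Hnd v v' : I v -> I v' -> v <= v' -> H v <= H v'.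
  move=> Iv Iv' vv; rewrite !HE//; case: ifPn => yv.
    by rewrite (le_trans yv vv); apply: fhat_nd => //; apply: ub => //; exact: le_trans vv.
  by case: ifPn => // /(fh0 v' Iv').
rewrite Mm lee_fin.
have -> : (if (ystar <= m) && (m%:E < b)%E then fh (fine m%:E) else 0) = H m.
  by rewrite HE//; have [_ ->] := Im; rewrite andbT.
apply/eqP; rewrite eq_le; apply/andP; split.
  apply: ge_ereal_sup => _ [t /= + <-]; rewrite in_itv/= => /andP[t0 tT].
  rewrite lee_fin /value_at; case: ifPn => tl; last exact: H0.
  apply: Hnd => //; first exact: (coord_in hX).
  by apply: Hu => //; rewrite t0.
apply: ereal_sup_ubound; exists u; first by rewrite /= in_itv/= u0.
by rewrite /value_at ul.
Qed.

End at_point.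

End optimal_stopping.

Theorem theorem3p7 (R : realType) (d : measure_display) (Om : measurableType d)
    (a b : \bar R) (mu sigma : R -> R) (r : R) (X : process R Om)
    (T : {mfun Om >-> R}) (psi g : R -> R) (kinks : set R) (xg ystar : R)
    (hr : 0 < r)
    (hX : regular_diffusion a b mu sigma X)
    (hT : exponential_clock a b r X T)
    (hpsi : increasing_solution a b mu sigma r X psi)
    (hg : payoff a b r X kinks xg g)
    (g_nondecreasing : nondecreasing_on (state_space a b) g)
    (hystar : unique (threshold a b (fhat kinks g psi)) ystar)
    (dg_lsc : lsc_on (upper_part b ystar) (dpayoff kinks g))
    (fhat_nondecreasing :
       nondecreasing_on (upper_part b ystar) (fhat kinks g psi))
    (ratio_decreases : decreases_to_0 a b (fun x => g x / psi x)) :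
  forall x, state_space a b x ->
    [/\ value_function X r g x = threshold_value X r g ystar x,
        threshold_value X r g ystar x =
          sup_representation b X T (fhat kinks g psi) ystar x &
        sup_representation b X T (fhat kinks g psi) ystar x =
          sup_functional b X T (fhat kinks g psi) ystar x].
Proof.
move=> x Ix; have [thr _] := hystar.
rewrite (value_function_at hr hX hpsi hg g_nondecreasing thr fhat_nondecreasing
  ratio_decreases Ix).
rewrite (threshold_value_at hr hX hpsi hg g_nondecreasing thr Ix).
rewrite (sup_functional_at hr hX hT hpsi hg g_nondecreasing thr fhat_nondecreasing
  ratio_decreases Ix).
by rewrite (sup_representation_at hr hX hT hpsi hg g_nondecreasing thr
  fhat_nondecreasing ratio_decreases Ix).
Qed.
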